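(* Let $\alpha\in(\mathbb{N}\cup\{0\})^n$ and let $x^0\in\mathbb{G}^{n+1}_\alpha$ be a Riemannian point. Every arc-length parametrized geodesic $x:[0,T]\to\mathbb{G}^{n+1}_\alpha$ with $x(0)=x^0$ has a unique lift $\lambda=(x,p)$ which satisfies Hamilton's equations $x_j'=\xi_j(x)^2p_j$, $p_j'=-\partial H/\partial x_j$ with initial covector $p(0)=p^0$ satisfying $H(x^0,p^0)=1/2$, and for $1\le j\le n+1$ $$x_j(t)=f_j\Big(\int_0^t\xi_j(x(s))^2ds\Big),\qquad p_j(t)=g_j\Big(\int_0^t\xi_j(x(s))^2ds\Big),$$ where $$f_j(s)=\begin{cases}x^0_j+p^0_js, & R_{j+1}=0\text{ or }\alpha_j=0,\\ A_j\sin_{\alpha_j}(\omega_js+\phi_j), & R_{j+1}\neq0\text{ and }\alpha_j\ge1,\end{cases}\qquad g_j(s)=\begin{cases}p^0_j, & R_{j+1}=0\text{ or }\alpha_j=0,\\ A_j\omega_j\cos_{\alpha_j}(\omega_js+\phi_j), & R_{j+1}\neq0\text{ and }\alpha_j\ge1.\end{cases}$$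
   Context: $\mathbb{G}^{n+1}_\alpha$ is $\mathbb{R}^{n+1}$ with the sub-Riemannian structure generated by $X_j=\xi_j\partial_{x_j}$, $\xi_j(x)=\prod_{i=1}^{j-1}x_i^{\alpha_i}$, and its Carnot–Carathéodory distance; a geodesic is a constant-speed horizontal curve that locally minimizes this distance. $H(x,p)=\tfrac12\sum_j\xi_j(x)^2p_j^2$. $J=\{j\le n:\alpha_j\neq0\}$; $x^0$ Riemannian means $x^0_j\neq0$ for $j\in J$. For real $a\ge1$: $\pi_a=2\int_0^1(1-t^{2a})^{-1/2}dt$; $\sin_a$ is the inverse of $s\mapsto\int_0^s(1-t^{2a})^{-1/2}dt$ on $[0,\pi_a/2]$, extended by $\sin_a(s)=\sin_a(\pi_a-s)$ to $[0,\pi_a]$, oddly and $2\pi_a$-periodically; $\cos_a=\sin_a'$; $\rho_\theta(s)=|s|^{\theta-1}s$. Spherical coordinates of $p^0$: $\tilde\alpha_j=\alpha_j$ ($j\in J$), $=1$ otherwise; $\tilde x^0_j=x^0_j$ ($j\in J$), $=1$ otherwise; $\phi\in\prod_{j\le n-1}[0,\pi_{\tilde\alpha_j}]\times[0,2\pi_{\tilde\alpha_n})$ with $p^0_j=\cos_{\tilde\alpha_j}(\phi_j)\prod_{i<j}\delta_i$ ($j\le n$), $p^0_{n+1}=\prod_{i\le n}\delta_i$, $\delta_i=\rho_{\tilde\alpha_i}(\sin_{\tilde\alpha_i}(\phi_i)/\tilde x^0_i)$. For $j\in J$ with $\sin_{\alpha_j}(\phi_j)\neq0$: $A_j=x^0_j/\sin_{\alpha_j}(\phi_j)$,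 $\omega_j=\frac{\sin_{\alpha_j}(\phi_j)}{x^0_j}\prod_{i<j}\delta_i$. Constants: $R_{n+2}=0$, $R_{n+1}=|p^0_{n+1}|$, $R_j=\sqrt{R_{j+1}^2(x^0_j)^{2\alpha_j}+(p^0_j)^2}$ for $j\le n$. *)

(* Defs.v *)
From Stdlib Require Import Reals Lra Lia ClassicalEpsilon.
From Coquelicot Require Import Coquelicot.
Open Scope R_scope.

(* Points of R^{n+1} are functions nat -> R, only coordinates 1..n+1 matter.
   alpha : nat -> nat, only alpha 1 .. alpha n matter. *)

Fixpoint prod_upto (f : nat -> R) (m : nat) : R :=
  match m with O => 1 | S m' => prod_upto f m' * f m end.
Fixpoint sum_upto (f : nat -> R) (m : nat) : R :=
  match m with O => 0 | S m' => sum_upto f m' + f m end.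

(* xi_j(x) = prod_{i=1}^{j-1} x_i^{alpha_i}  (with 0^0 = 1) *)
Definition xi (alpha : nat -> nat) (x : nat -> R) (j : nat) : R :=
  prod_upto (fun i => x i ^ alpha i) (j - 1).

Definition Ham (n : nat) (alpha : nat -> nat) (x p : nat -> R) : R :=
  / 2 * sum_upto (fun j => (xi alpha x j) ^ 2 * (p j) ^ 2) (S n).

Definition upd (x : nat -> R) (j : nat) (s : R) : nat -> R :=
  fun i => if Nat.eqb i j then s else x i.

Definition dHdx (n : nat) (alpha : nat -> nat) (x p : nat -> R) (j : nat) : R :=
  Derive (fun s => Ham n alpha (upd x j s) p) (x j).

Definition null_set (N : R -> Prop) : Prop :=
  forall eps, 0 < eps ->
    exists a b : nat -> R,
      (forall k, a k <= b k) /\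
      (forall t, N t -> exists k, a k < t < b k) /\
      (forall m, sum_f_R0 (fun k => b k - a k) m <= eps).

Definition lipschitz_on (n : nat) (g : R -> nat -> R) (T : R) : Prop :=
  exists L, forall s t, 0 <= s <= T -> 0 <= t <= T ->
    forall j, (1 <= j <= S n)%nat -> Rabs (g s j - g t j) <= L * Rabs (s - t).

(* g is Lipschitz and for a.e. t, g'(t) = sum_j h_j X_j(g(t)) with X_j = xi_j d/dx_j *)
Definition horizontal (n : nat) (alpha : nat -> nat) (g : R -> nat -> R) (T : R) : Prop :=
  lipschitz_on n g T /\
  exists N, null_set N /\
    forall t, 0 < t < T -> ~ N t ->
      exists h : nat -> R, forall j, (1 <= j <= S n)%nat ->
        is_derive (fun s => g s j) t (h j * xi alpha (g t) j).

Definition subunit (n : nat) (alpha : nat -> nat) (g : R -> nat -> R) (T : R) : Prop :=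
  lipschitz_on n g T /\
  exists N, null_set N /\
    forall t, 0 < t < T -> ~ N t ->
      exists h : nat -> R, sum_upto (fun j => h j ^ 2) (S n) <= 1 /\
        forall j, (1 <= j <= S n)%nat ->
          is_derive (fun s => g s j) t (h j * xi alpha (g t) j).

Definition ccdist (n : nat) (alpha : nat -> nat) (x y : nat -> R) : Rbar :=
  Glb_Rbar (fun T => 0 <= T /\ exists g, subunit n alpha g T /\
     forall j, (1 <= j <= S n)%nat -> g 0 j = x j /\ g T j = y j).

(* arc-length parametrized geodesic on [0,T]: horizontal, and locally
   d(x(s),x(s')) = |s - s'| (arc length + local minimality) *)
Definition arclength_geodesic (n : nat) (alpha : nat -> nat) (x : R -> nat -> R) (T : R)
  : Prop :=
  horizontal n alpha x T /\
  forall t, 0 <= t <= T -> exists eps, 0 < eps /\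
    forall s s', 0 <= s <= T -> 0 <= s' <= T -> Rabs (s - t) < eps -> Rabs (s' - t) < eps ->
      ccdist n alpha (x s) (x s') = Finite (Rabs (s - s')).

Definition riemannian_point (n : nat) (alpha : nat -> nat) (x0 : nat -> R) : Prop :=
  forall j, (1 <= j <= n)%nat -> alpha j <> 0%nat -> x0 j <> 0.

Definition gt_integrand (a : nat) (t : R) : R := / sqrt (1 - t ^ (2 * a)).

Definition pi_a (a : nat) : R :=
  2 * RInt_gen (gt_integrand a) (at_point 0) (at_left 1).

Definition Fa (a : nat) (y : R) : R :=
  if Rlt_dec y 1 then RInt (gt_integrand a) 0 y else pi_a a / 2.

Definition sin_a0 (a : nat) (s : R) : R :=
  epsilon (inhabits 0) (fun y => 0 <= y <= 1 /\ Fa a y = s).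

(* extension: symmetric about pi_a/2 on [0,pi_a], odd, 2 pi_a periodic *)
Definition sin_a (a : nat) (s : R) : R :=
  let P := pi_a a in
  let r := s - 2 * P * IZR (Int_part (s / (2 * P))) in
  if Rle_dec r P then sin_a0 a (Rmin r (P - r))
  else - sin_a0 a (Rmin (2 * P - r) (P - (2 * P - r))).

Definition cos_a (a : nat) (s : R) : R := Derive (sin_a a) s.

Definition rho (theta : nat) (s : R) : R := Rabs s ^ (theta - 1) * s.

Definition alpha_t (alpha : nat -> nat) (j : nat) : nat :=
  if Nat.eqb (alpha j) 0 then 1%nat else alpha j.
Definition x0_t (alpha : nat -> nat) (x0 : nat -> R) (j : nat) : R :=
  if Nat.eqb (alpha j) 0 then 1 else x0 j.

Definition delta (alpha : nat -> nat) (x0 phi : nat -> R) (i : nat) : R :=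
  rho (alpha_t alpha i) (sin_a (alpha_t alpha i) (phi i) / x0_t alpha x0 i).

Definition spherical_coords (n : nat) (alpha : nat -> nat) (x0 p0 phi : nat -> R) : Prop :=
  (forall j, (1 <= j <= n - 1)%nat -> 0 <= phi j <= pi_a (alpha_t alpha j)) /\
  0 <= phi n < 2 * pi_a (alpha_t alpha n) /\
  (forall j, (1 <= j <= n)%nat ->
     p0 j = cos_a (alpha_t alpha j) (phi j) * prod_upto (delta alpha x0 phi) (j - 1)) /\
  p0 (S n) = prod_upto (delta alpha x0 phi) n.

Definition A_coef (alpha : nat -> nat) (x0 phi : nat -> R) (j : nat) : R :=
  x0 j / sin_a (alpha j) (phi j).
Definition omega_coef (alpha : nat -> nat) (x0 phi : nat -> R) (j : nat) : R :=
  sin_a (alpha j) (phi j) / x0 j * prod_upto (delta alpha x0 phi) (j - 1).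

(* R constants: Raux d = R_{n+1-d} *)
Fixpoint Raux (n : nat) (alpha : nat -> nat) (x0 p0 : nat -> R) (d : nat) : R :=
  match d with
  | O => Rabs (p0 (S n))
  | S d' => let j := (n - d')%nat in
      sqrt ((Raux n alpha x0 p0 d') ^ 2 * x0 j ^ (2 * alpha j) + p0 j ^ 2)
  end.
Definition Rconst (n : nat) (alpha : nat -> nat) (x0 p0 : nat -> R) (j : nat) : R :=
  if Nat.leb (n + 2) j then 0 else Raux n alpha x0 p0 (n + 1 - j).

Definition linear_case (n : nat) (alpha : nat -> nat) (x0 p0 : nat -> R) (j : nat) : Prop :=
  Rconst n alpha x0 p0 (S j) = 0 \/ alpha j = 0%nat.

Definition f_fun (n : nat) (alpha : nat -> nat) (x0 p0 phi : nat -> R) (j : nat) (s : R) : R :=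
  match excluded_middle_informative (linear_case n alpha x0 p0 j) with
  | left _ => x0 j + p0 j * s
  | right _ => A_coef alpha x0 phi j *
               sin_a (alpha j) (omega_coef alpha x0 phi j * s + phi j)
  end.

Definition g_fun (n : nat) (alpha : nat -> nat) (x0 p0 phi : nat -> R) (j : nat) (s : R) : R :=
  match excluded_middle_informative (linear_case n alpha x0 p0 j) with
  | left _ => p0 j
  | right _ => A_coef alpha x0 phi j * omega_coef alpha x0 phi j *
               cos_a (alpha j) (omega_coef alpha x0 phi j * s + phi j)
  end.

Definition hamiltonian_lift (n : nat) (alpha : nat -> nat) (x p : R -> nat -> R) (T : R)
  : Prop :=
  (forall j, (1 <= j <= S n)%nat -> forall t, 0 <= t <= T ->
     filterlim (fun s => p s j) (within (fun s => 0 <= s <= T) (locally t))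
               (locally (p t j))) /\
  (forall j, (1 <= j <= S n)%nat -> forall t, 0 < t < T ->
     is_derive (fun s => x s j) t ((xi alpha (x t) j) ^ 2 * p t j) /\
     is_derive (fun s => p s j) t (- dHdx n alpha (x t) (p t) j)).

(* Main.v *)
Require Import Defs.
From Stdlib Require Import ZArith Reals Lra Lia ClassicalEpsilon Classical.
From Coquelicot Require Import Coquelicot.
Open Scope R_scope.

(* The structure is triangular (xi_j depends only on the coordinates below j), so the first
   variation can be made explicit, by descent from j = n+1 to j = 1.  Once the coordinates above j
   are known to follow a fixed curve run with the clock int xi_{j+1}^2, move x_j by
   eps * int xi_j^2 w and run the coordinates above j along the same curve with the perturbed
   clock, rescaled to end at the same point.  The time needed is differentiable in eps and minimal
   at eps = 0, which gives x_j' = xi_j^2 p_j with the right p_j'.  No abnormal extremal occurs: a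
   minimizing piece may be started at a time where all xi_j are nonzero, and such times are dense
   along a normal curve because the R_j are conserved; so normal pieces glue up to time T.  The
   merely bounded controls are never integrated; they enter only through Lipschitz functions whose
   derivative is bounded off a null set. *)

(** * Calculus on the real line *)


(** Since the control of a minimizer is only bounded, no Euler-Lagrange equation can be written for
    it directly. Two choices avoid this. The time [tau] granted to a competitor is built from [x_j]
    itself, whose derivative contains the control linearly, so that the first-order change of time
    is an increment of [x_j]. And w is a step function jumping at s minus a constant, so that
    stationarity is the integrated equation at the single time s, in the manner of du Bois-Reymond.
    The obstacle is that moving [x_j] changes every weight above j. Rescaling the clock by a factor
    rho repairs the end point at a cost proportional to r (rho^2 - 1) / 2, where r is the constant
    squared speed of the upper coordinates in their own structure; it requires positive clocks,
    hence regular starting times. Differentiating this cost in eps produces alpha_j r x_j^(2 alpha_j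
    - 1) xi_j^2, so each coordinate in its own clock obeys the oscillator F'' = - alpha r F^(2 alpha
    - 1), which [sin_a] solves. *)

Notation RC := R_CompleteNormedModule (only parsing).

(** Restates an equality in the carrier of an algebraic structure as an equality in [R], where
    [ring] applies. *)
Ltac eqR := match goal with |- ?u = ?v => change (@eq R u v) end.

Lemma is_derive_eps (f : R -> R) (x l : R) :
  is_derive f x l <->
  (forall eps, 0 < eps -> exists d, 0 < d /\ forall y, Rabs (y - x) < d ->
     Rabs (f y - f x - l * (y - x)) <= eps * Rabs (y - x)).
Proof.
  split.
  - intros [_ H] eps He.
    specialize (H x (fun P HP => HP) (mkposreal eps He)).
    destruct H as [d Hd]. exists d. split; [apply cond_pos|].
    intros y Hy. specialize (Hd y Hy).
    unfold norm, minus, plus, opp, scal in Hd; simpl in Hd.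
    unfold mult, abs in Hd; simpl in Hd.
    replace (f y - f x - l * (y - x)) with (f y + - f x + - ((y + - x) * l)) by ring.
    exact Hd.
  - intros H. split; [apply is_linear_scal_l|].
    intros y Hy.
    rewrite <- (is_filter_lim_locally_unique (V := R_NormedModule) x y Hy).
    intros eps. destruct (H eps (cond_pos eps)) as [d [Hd0 Hd]].
    exists (mkposreal d Hd0). intros z Hz.
    unfold norm, minus, plus, opp, scal; simpl. unfold mult, abs; simpl.
    replace (f z + - f x + - ((z + - x) * l)) with (f z - f x - l * (z - x)) by ring.
    apply Hd. exact Hz.
Qed.

Lemma continuous_eps (f : R -> R) (x : R) :
  continuous f x <->
  (forall eps, 0 < eps -> exists d, 0 < d /\ forall y, Rabs (y - x) < d -> Rabs (f y - f x) < eps).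
Proof.
  split.
  - intros H eps He.
    destruct (proj1 (filterlim_locally f (f x)) H (mkposreal eps He)) as [d Hd].
    exists d. split; [apply cond_pos|]. intros y Hy. exact (Hd y Hy).
  - intros H. apply filterlim_locally. intros eps.
    destruct (H eps (cond_pos eps)) as [d [Hd0 Hd]].
    exists (mkposreal d Hd0). intros y Hy. exact (Hd y Hy).
Qed.

Lemma is_derive_continuous (f : R -> R) (x l : R) : is_derive f x l -> continuous f x.
Proof. intros H. apply (ex_derive_continuous f x). exists l; exact H. Qed.

Lemma is_derive_value (f : R -> R) (x l l' : R) : is_derive f x l -> l = l' -> is_derive f x l'.
Proof. intros H <-; exact H. Qed.

Lemma is_derive_uniq (f : R -> R) (x l l' : R) : is_derive f x l -> is_derive f x l' -> l = l'.
Proof. intros H H'. rewrite <- (is_derive_unique _ _ _ H). apply is_derive_unique, H'. Qed.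

Lemma is_derive_Rext (f g : R -> R) (x l : R) :
  (forall t, f t = g t) -> is_derive f x l -> is_derive g x l.
Proof. apply is_derive_ext. Qed.

Lemma is_derive_Rplus (f g : R -> R) (x df dg : R) :
  is_derive f x df -> is_derive g x dg -> is_derive (fun t => f t + g t) x (df + dg).
Proof. intros; apply (is_derive_plus f g); assumption. Qed.

Lemma is_derive_Rminus (f g : R -> R) (x df dg : R) :
  is_derive f x df -> is_derive g x dg -> is_derive (fun t => f t - g t) x (df - dg).
Proof. intros; apply (is_derive_minus f g); assumption. Qed.

Lemma is_derive_Rmult (f g : R -> R) (x df dg : R) :
  is_derive f x df -> is_derive g x dg ->
  is_derive (fun t => f t * g t) x (df * g x + f x * dg).
Proof. intros; apply (is_derive_mult f g); try assumption. intros; apply Rmult_comm. Qed.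

Lemma is_derive_Rscal (f : R -> R) (x df k : R) :
  is_derive f x df -> is_derive (fun t => k * f t) x (k * df).
Proof.
  intros H. eapply is_derive_value.
  - apply (is_derive_Rmult (fun _ => k) f x 0 df); [apply (is_derive_const k x)|exact H].
  - ring.
Qed.

Lemma is_derive_Rcomp (f g : R -> R) (x df dg : R) :
  is_derive f (g x) df -> is_derive g x dg -> is_derive (fun t => f (g t)) x (dg * df).
Proof. intros; apply (is_derive_comp f g); assumption. Qed.

Lemma is_derive_affine (k c x : R) : is_derive (fun t => k * t + c) x k.
Proof. auto_derive; [trivial|ring]. Qed.

Lemma mvt_open (f df : R -> R) (a b : R) : a < b ->
  (forall t, a < t < b -> is_derive f t (df t)) ->
  (forall t, a <= t <= b -> continuous f t) ->
  exists c, a < c < b /\ f b - f a = df c * (b - a).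
Proof.
  intros Hab Hd Hc.
  assert (pr : forall c, a < c < b -> derivable_pt f c).
  { intros c Hc'. exists (df c). apply is_derive_Reals, Hd, Hc'. }
  destruct (MVT f id a b pr (fun c _ => derivable_pt_id c) Hab) as [c [Pc E]].
  - intros c Hc'. apply continuity_pt_filterlim, Hc, Hc'.
  - intros c _. apply derivable_continuous_pt, derivable_pt_id.
  - exists c. split; [exact Pc|].
    assert (E1 : derive_pt f c (pr c Pc) = df c).
    { apply derive_pt_eq_0. apply is_derive_Reals, Hd, Pc. }
    assert (E2 : derive_pt id c (derivable_pt_id c) = 1).
    { apply derive_pt_eq_0, derivable_pt_lim_id. }
    rewrite E1, E2 in E. unfold id in E. lra.
Qed.

Lemma mvt_closed (f df : R -> R) (a b : R) : a < b ->
  (forall t, a <= t <= b -> is_derive f t (df t)) ->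
  exists c, a < c < b /\ f b - f a = df c * (b - a).
Proof.
  intros Hab Hd. apply mvt_open; [exact Hab| |]; intros t Ht; [apply Hd; lra|].
  eapply is_derive_continuous, Hd, Ht.
Qed.

Lemma derive_zero_const (f : R -> R) (a b : R) :
  (forall t, a < t < b -> is_derive f t 0) ->
  (forall t, a <= t <= b -> continuous f t) ->
  forall s t, a <= s <= b -> a <= t <= b -> f s = f t.
Proof.
  intros Hd Hc.
  assert (H : forall s t, a <= s -> s < t -> t <= b -> f s = f t).
  { intros s t Hs Hst Ht.
    destruct (mvt_open f (fun _ => 0) s t Hst) as [c [_ E]].
    - intros u Hu. apply Hd. lra.
    - intros u Hu. apply Hc. lra.
    - lra. }
  intros s t Hs Ht. destruct (Rtotal_order s t) as [h|[h|h]].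
  - apply H; lra.
  - now subst.
  - symmetry; apply H; lra.
Qed.

(** Mean value theorem between p and y: the difference quotient is a value of [g] near p. This
    carries the derivatives of [sin_a] and [cos_a] through [pi_a a / 2], where the inverse function
    argument breaks down. *)
Lemma derive_extends (f g : R -> R) (p d : R) : 0 < d ->
  (forall u, Rabs (u - p) < d -> u <> p -> is_derive f u (g u)) ->
  continuous f p -> continuous g p -> is_derive f p (g p).
Proof.
  intros Hd Hf Cf Cg. apply is_derive_eps. intros eps He.
  destruct (proj1 (continuous_eps g p) Cg eps He) as [e [He0 Hg]].
  exists (Rmin d e). split; [apply Rmin_pos; assumption|].
  intros y Hy.
  assert (Hyd : Rabs (y - p) < d) by (eapply Rlt_le_trans; [exact Hy|apply Rmin_l]).
  assert (Hye : Rabs (y - p) < e) by (eapply Rlt_le_trans; [exact Hy|apply Rmin_r]).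
  destruct (Req_dec y p) as [->|Hyp].
  { replace (f p - f p - g p * (p - p)) with 0 by ring.
    rewrite Rabs_R0. apply Rmult_le_pos; [lra|apply Rabs_pos]. }
  assert (E : exists c, Rabs (c - p) < e /\ f y - f p = g c * (y - p)).
  { assert (Hb : forall t, Rmin y p <= t <= Rmax y p -> Rabs (t - p) <= Rabs (y - p)).
    { intros t. unfold Rmin, Rmax, Rabs. repeat destruct Rle_dec; repeat destruct Rcase_abs; lra. }
    destruct (mvt_open f g (Rmin y p) (Rmax y p)) as [c [Hc E]].
    - unfold Rmin, Rmax. destruct Rle_dec; lra.
    - intros t Ht. apply Hf; [specialize (Hb t); lra|].
      intros ->. unfold Rmin, Rmax in Ht. destruct Rle_dec; lra.
    - intros t Ht. destruct (Req_dec t p) as [->|h]; [exact Cf|].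
      eapply is_derive_continuous, Hf; [specialize (Hb t Ht); lra|exact h].
    - exists c. split; [specialize (Hb c); lra|].
      unfold Rmin, Rmax in E. destruct Rle_dec; lra. }
  destruct E as [c [Hc E]]. rewrite E.
  replace (g c * (y - p) - g p * (y - p)) with ((g c - g p) * (y - p)) by ring.
  rewrite Rabs_mult. apply Rmult_le_compat_r; [apply Rabs_pos|]. left; apply Hg, Hc.
Qed.

(** The inverse enters only through its continuity and [F (th u) = u] near s, so one statement
    serves both [sin_a] and the inverse of a time change. *)
Lemma is_derive_inverse (F th : R -> R) (s l : R) :
  is_derive F (th s) l -> l <> 0 -> continuous th s ->
  locally s (fun u => F (th u) = u) -> is_derive th s (/ l).
Proof.
  intros HF Hl Hth [dl Hloc].
  assert (Hl' : 0 < Rabs l) by (apply Rabs_pos_lt, Hl).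
  apply is_derive_eps. intros eps He.
  (* The first bound gives |l| |D| <= 2 |h|; with it, the second brings the error down to eps |h|
     after division by |l|. *)
  set (e1 := Rmin (Rabs l / 2) (eps * Rabs l * Rabs l / 2)).
  assert (He1 : 0 < e1).
  { apply Rmin_pos; [lra|]. apply Rdiv_lt_0_compat; [|lra].
    repeat apply Rmult_lt_0_compat; assumption. }
  destruct (proj1 (is_derive_eps _ _ _) HF e1 He1) as [d1 [Hd1 H1]].
  destruct (proj1 (continuous_eps _ _) Hth d1 Hd1) as [d2 [Hd2 H2]].
  exists (Rmin dl d2). split; [apply Rmin_pos; [apply cond_pos|assumption]|].
  intros y Hy.
  assert (Ey : F (th y) = y) by (apply Hloc; eapply Rlt_le_trans; [exact Hy|apply Rmin_l]).
  assert (Es : F (th s) = s) by (apply Hloc; apply ball_center).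
  assert (Hy2 : Rabs (th y - th s) < d1) by (apply H2; eapply Rlt_le_trans; [exact Hy|apply Rmin_r]).
  specialize (H1 _ Hy2). rewrite Ey, Es in H1.
  set (D := th y - th s) in *. set (h := y - s) in *.
  assert (Ha : Rabs l * Rabs D <= 2 * Rabs h).
  { assert (Rabs (l * D) <= Rabs h + Rabs (h - l * D)).
    { replace (l * D) with (h - (h - l * D)) by ring.
      replace (h - (h - (h - l * D))) with (h - l * D) by ring.
      apply Rle_trans with (1 := Rabs_triang h (- (h - l * D))). rewrite Rabs_Ropp. lra. }
    rewrite Rabs_mult in H.
    assert (e1 * Rabs D <= Rabs l / 2 * Rabs D).
    { apply Rmult_le_compat_r; [apply Rabs_pos|apply Rmin_l]. }
    lra. }
  replace (D - / l * h) with (- (/ l * (h - l * D))) by (field; assumption).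
  rewrite Rabs_Ropp, Rabs_mult, Rabs_inv.
  apply Rmult_le_reg_l with (Rabs l); [assumption|].
  rewrite <- Rmult_assoc, Rinv_r, Rmult_1_l by lra.
  apply Rle_trans with (1 := H1).
  apply Rle_trans with (eps * Rabs l * Rabs l / 2 * Rabs D).
  { apply Rmult_le_compat_r; [apply Rabs_pos|apply Rmin_r]. }
  assert (eps * Rabs l * (Rabs l * Rabs D) <= eps * Rabs l * (2 * Rabs h)).
  { apply Rmult_le_compat_l; [|exact Ha]. apply Rmult_le_pos; lra. }
  lra.
Qed.

Lemma Rlt_Rmin (x a b : R) : x < Rmin a b -> x < a /\ x < b.
Proof. intros H. split; apply (Rmin_Rgt_l a b x H). Qed.

Lemma locally_interior (a b t : R) : a < t < b -> locally t (fun u => a < u < b).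
Proof.
  intros Ht. assert (Hd : 0 < Rmin (t - a) (b - t)) by (apply Rmin_pos; lra).
  exists (mkposreal _ Hd). intros u Hu. change (Rabs (u - t) < Rmin (t - a) (b - t)) in Hu.
  destruct (Rlt_Rmin _ _ _ Hu) as [Hu1 Hu2].
  apply Rabs_def2 in Hu1. apply Rabs_def2 in Hu2. lra.
Qed.


Lemma lipschitz_continuous (f : R -> R) (L x : R) :
  (forall y, Rabs (f y - f x) <= L * Rabs (y - x)) -> continuous f x.
Proof.
  intros H. apply continuous_eps. intros eps He.
  assert (HL : 0 < Rabs L + 1) by (pose proof (Rabs_pos L); lra).
  exists (eps / (Rabs L + 1)). split; [apply Rdiv_lt_0_compat; assumption|].
  intros y Hy. apply Rle_lt_trans with (1 := H y).
  apply Rle_lt_trans with ((Rabs L + 1) * Rabs (y - x)).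
  { apply Rmult_le_compat_r; [apply Rabs_pos|]. pose proof (Rle_abs L); lra. }
  replace eps with ((Rabs L + 1) * (eps / (Rabs L + 1))) by (field; lra).
  apply Rmult_lt_compat_l; assumption.
Qed.

Lemma nonneg_root (z : R) (m : nat) : 0 <= z -> (1 <= m)%nat -> exists y, 0 <= y /\ y ^ m = z.
Proof.
  intros Hz Hm. destruct Hz as [Hz|<-].
  - exists (Rpower z (/ INR m)). split; [left; apply exp_pos|].
    rewrite <- Rpower_pow by apply exp_pos. rewrite Rpower_mult, Rinv_l, Rpower_1; auto.
    apply not_0_INR; lia.
  - exists 0. split; [lra|]. apply pow_i; lia.
Qed.

(** * Generalized trigonometric functions *)


Lemma pow_double (t : R) (a : nat) : t ^ (2 * a) = t ^ a * t ^ a.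
Proof. rewrite <- pow_add. f_equal. lia. Qed.

Lemma pow_double_nonneg (t : R) (a : nat) : 0 <= t ^ (2 * a).
Proof. rewrite pow_mult. apply pow_le, pow2_ge_0. Qed.

Lemma pow_double_opp (t : R) (a : nat) : (- t) ^ (2 * a) = t ^ (2 * a).
Proof. rewrite !pow_mult. f_equal. ring. Qed.

Lemma pow_double_lt_1 (t : R) (a : nat) : (1 <= a)%nat -> -1 < t < 1 -> t ^ (2 * a) < 1.
Proof.
  intros Ha Ht. rewrite pow_mult.
  destruct (pow_lt_1_compat (t ^ 2) a) as [_ H]; [split; [apply pow2_ge_0|nra]|lia|exact H].
Qed.

Lemma sqrt_gap_pos (a : nat) (t : R) : (1 <= a)%nat -> -1 < t < 1 ->
  0 < sqrt (1 - t ^ (2 * a)) <= 1.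
Proof.
  intros Ha Ht. pose proof (pow_double_lt_1 t a Ha Ht). pose proof (pow_double_nonneg t a).
  split; [apply sqrt_lt_R0; lra|]. rewrite <- sqrt_1 at 2. apply sqrt_le_1_alt; lra.
Qed.

Lemma gt_integrand_ge_1 (a : nat) (t : R) : (1 <= a)%nat -> -1 < t < 1 -> 1 <= gt_integrand a t.
Proof.
  intros Ha Ht. destruct (sqrt_gap_pos a t Ha Ht). unfold gt_integrand.
  rewrite <- Rinv_1 at 1. apply Rinv_le_contravar; assumption.
Qed.

Lemma continuous_gt_integrand (a : nat) (t : R) : (1 <= a)%nat -> -1 < t < 1 ->
  continuous (gt_integrand a) t.
Proof.
  intros Ha Ht. unfold gt_integrand.
  pose proof (pow_double_lt_1 t a Ha Ht). destruct (sqrt_gap_pos a t Ha Ht).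
  apply (ex_derive_continuous (fun t => / sqrt (1 - t ^ (2 * a)))).
  auto_derive. change (a + (a + 0))%nat with (2 * a)%nat.
  split; [lra|split; [|trivial]]. change (sqrt (1 - t ^ (2 * a)) <> 0). lra.
Qed.

Definition arcsin_int (a : nat) (y : R) : R := RInt (gt_integrand a) 0 y.

Lemma ex_arcsin_int (a : nat) (y : R) : (1 <= a)%nat -> -1 < y < 1 ->
  ex_RInt (gt_integrand a) 0 y.
Proof.
  intros Ha Hy. apply (ex_RInt_continuous (V := RC)).
  intros z Hz. apply continuous_gt_integrand; [exact Ha|].
  unfold Rmin, Rmax in Hz; destruct Rle_dec in Hz; lra.
Qed.

Lemma is_derive_arcsin_int (a : nat) (y : R) : (1 <= a)%nat -> -1 < y < 1 ->
  is_derive (arcsin_int a) y (gt_integrand a y).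
Proof.
  intros Ha Hy. apply (is_derive_RInt (gt_integrand a) (arcsin_int a) 0 y).
  - assert (Hd : 0 < Rmin (1 - y) (y + 1)) by (apply Rmin_pos; lra).
    exists (mkposreal _ Hd). intros z Hz. apply (RInt_correct (V := RC)).
    apply ex_arcsin_int; [exact Ha|].
    assert (Rabs (z - y) < Rmin (1 - y) (y + 1)) by exact Hz.
    pose proof (Rmin_l (1 - y) (y + 1)). pose proof (Rmin_r (1 - y) (y + 1)).
    assert (Rabs (z - y) < 1 - y) by lra. assert (Rabs (z - y) < y + 1) by lra.
    apply Rabs_def2 in H2. apply Rabs_def2 in H3. lra.
  - apply continuous_gt_integrand; assumption.
Qed.

Lemma arcsin_int_0 (a : nat) : arcsin_int a 0 = 0.
Proof. apply (RInt_point (V := RC)). Qed.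

(** The integrand is at least 1. Read backwards, [sin_a] is 1-Lipschitz on its central branch, and
    the integral is injective. *)
Lemma arcsin_int_expands (a : nat) (y z : R) : (1 <= a)%nat -> -1 < y -> y <= z -> z < 1 ->
  z - y <= arcsin_int a z - arcsin_int a y.
Proof.
  intros Ha Hy [Hyz|<-] Hz; [|lra].
  destruct (mvt_closed (arcsin_int a) (gt_integrand a) y z Hyz) as [c [Hc E]].
  - intros t Ht. apply is_derive_arcsin_int; [exact Ha|lra].
  - pose proof (gt_integrand_ge_1 a c Ha ltac:(lra)). nra.
Qed.

Lemma arcsin_int_opp (a : nat) (y : R) : (1 <= a)%nat -> -1 < y < 1 ->
  arcsin_int a (- y) = - arcsin_int a y.
Proof.
  intros Ha Hy. unfold arcsin_int.
  pose proof (RInt_comp_lin (V := RC) (gt_integrand a) (-1) 0 0 y) as E.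
  replace (-1 * 0 + 0) with 0 in E by ring. replace (-1 * y + 0) with (- y) in E by ring.
  rewrite <- E by (apply ex_arcsin_int; [exact Ha|lra]).
  rewrite (RInt_ext _ (fun t => opp (gt_integrand a t))).
  - apply (RInt_opp (V := RC)), ex_arcsin_int; assumption.
  - intros t _. unfold gt_integrand. replace (-1 * t + 0) with (- t) by ring.
    rewrite pow_double_opp. unfold scal, opp; simpl. unfold mult; simpl. eqR. ring.
Qed.

(** Comparison with 2 - 2 sqrt (1 - t), whose derivative 1 / sqrt (1 - t) dominates the integrand
    since t^(2a) <= t on [0,1]. The bound makes the improper integral in [pi_a] converge. *)
Lemma arcsin_int_le_2 (a : nat) (y : R) : (1 <= a)%nat -> 0 <= y < 1 -> arcsin_int a y <= 2.
Proof.
  intros Ha [[Hy|<-] Hy1]; [|rewrite arcsin_int_0; lra].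
  set (h := fun t => 2 * sqrt (1 - t) + arcsin_int a t).
  assert (D : forall t, 0 <= t <= y ->
    is_derive h t (2 * (-1 / (2 * sqrt (1 - t))) + gt_integrand a t)).
  { intros t Ht. apply is_derive_Rplus.
    - apply is_derive_Rscal. apply (is_derive_sqrt (fun t => 1 - t)); [|lra].
      auto_derive; [trivial|ring].
    - apply is_derive_arcsin_int; [exact Ha|lra]. }
  destruct (mvt_closed h _ 0 y Hy D) as [c [Hc E]].
  - unfold h in E. rewrite arcsin_int_0, Rminus_0_r, sqrt_1 in E.
    assert (Hs : 0 < sqrt (1 - c)) by (apply sqrt_lt_R0; lra).
    assert (gt_integrand a c <= / sqrt (1 - c)).
    { apply Rinv_le_contravar; [exact Hs|]. apply sqrt_le_1_alt.
      rewrite pow_mult. destruct a as [|a]; [lia|]. simpl (_ ^ S a).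
      assert (0 <= (c ^ 2) ^ a <= 1).
      { split; [apply pow_le, pow2_ge_0|]. rewrite <- (pow1 a). apply pow_incr.
        split; [apply pow2_ge_0|nra]. }
      assert (c ^ 2 * (c ^ 2) ^ a <= c ^ 2 * 1).
      { apply Rmult_le_compat_l; [apply pow2_ge_0|lra]. }
      simpl in *. nra. }
    replace (2 * (-1 / (2 * sqrt (1 - c)))) with (- / sqrt (1 - c)) in E by (field; lra).
    pose proof (sqrt_pos (1 - y)). nra.
Qed.

(** The improper integral is the supremum of its partial integrals because these increase. Later
    arguments know the value of [pi_a] only through these two properties. *)
Lemma pi_a_lub (a : nat) : (1 <= a)%nat ->
  (forall y, 0 <= y < 1 -> arcsin_int a y < pi_a a / 2) /\
  (forall eps, 0 < eps -> exists y, 0 <= y < 1 /\ pi_a a / 2 - eps < arcsin_int a y).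
Proof.
  intros Ha.
  destruct (completeness (fun z => exists y, 0 <= y < 1 /\ z = arcsin_int a y)) as [l [Hub Hl]].
  - exists 2. intros z [y [Hy ->]]. apply arcsin_int_le_2; assumption.
  - exists 0, 0. split; [lra|]. symmetry; apply arcsin_int_0.
  - assert (Happ : forall eps, 0 < eps -> exists y, 0 <= y < 1 /\ l - eps < arcsin_int a y).
    { intros eps He. apply NNPP. intros HN.
      assert (l <= l - eps); [|lra]. apply Hl. intros z [y [Hy ->]].
      apply Rnot_lt_le. intros h. apply HN. exists y. split; assumption. }
    assert (E : RInt_gen (gt_integrand a) (at_point 0) (at_left 1) = l).
    { apply is_RInt_gen_unique. intros P [e He].
      destruct (Happ e (cond_pos e)) as [y0 [Hy0 Hl0]].
      exists (fun x => x = 0) (fun y => y0 < y < 1).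
      - reflexivity.
      - assert (Hd : 0 < 1 - y0) by lra. exists (mkposreal _ Hd). intros z Hz Hz1.
        assert (Rabs (z - 1) < 1 - y0) by exact Hz. apply Rabs_def2 in H. lra.
      - intros x y -> Hy. cbv beta in Hy. exists (arcsin_int a y). split.
        + apply (RInt_correct (V := RC)). apply ex_arcsin_int; [exact Ha|simpl; lra].
        + apply He. assert (arcsin_int a y <= l) by (apply Hub; exists y; split; [lra|reflexivity]).
          pose proof (arcsin_int_expands a y0 y Ha ltac:(lra) ltac:(lra) ltac:(lra)).
          change (Rabs (arcsin_int a y - l) < e). rewrite Rabs_left1; lra. }
    unfold pi_a. rewrite E. replace (2 * l / 2) with l by field. split; [|exact Happ].
    (* The midpoint of y and 1 turns the bound by the supremum into a strict one. *)
    intros y Hy. set (z := (y + 1) / 2).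
    assert (arcsin_int a z <= l) by (apply Hub; exists z; split; [unfold z; lra|reflexivity]).
    assert (Hz : y < z < 1) by (unfold z; lra).
    pose proof (arcsin_int_expands a y z Ha ltac:(lra) ltac:(lra) ltac:(lra)). lra.
Qed.

Lemma pi_a_pos (a : nat) : (1 <= a)%nat -> 0 < pi_a a.
Proof.
  intros Ha. pose proof (proj1 (pi_a_lub a Ha) 0 ltac:(lra)). rewrite arcsin_int_0 in H. lra.
Qed.

Lemma sin_a0_spec (a : nat) (s : R) : (1 <= a)%nat -> 0 <= s < pi_a a / 2 ->
  0 <= sin_a0 a s < 1 /\ arcsin_int a (sin_a0 a s) = s.
Proof.
  intros Ha Hs.
  assert (HE : exists y, 0 <= y <= 1 /\ Fa a y = s).
  { destruct (proj2 (pi_a_lub a Ha) (pi_a a / 2 - s) ltac:(lra)) as [y1 [Hy1 H1]].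
    (* The argument is clamped to [0,y1] because this form of the intermediate value theorem asks
       for continuity on the whole line, while the integral is controlled only inside (-1,1). *)
    destruct (IVT_gen_consistent (fun y => arcsin_int a (Rmax 0 (Rmin y y1))) 0 y1 s) as [y [Hy E]].
    - intros y.
      apply (continuous_comp (fun y => Rmax 0 (Rmin y y1)) (arcsin_int a)).
      + apply (lipschitz_continuous _ 1). intros z.
        unfold Rmax, Rmin; repeat destruct Rle_dec; unfold Rabs; repeat destruct Rcase_abs; lra.
      + eapply is_derive_continuous. apply is_derive_arcsin_int; [exact Ha|].
        unfold Rmax, Rmin; repeat destruct Rle_dec; lra.
    - rewrite (Rmin_left 0 y1), (Rmin_left y1 y1), (Rmax_left 0 0), (Rmax_right 0 y1), arcsin_int_0 by lra.
      unfold Rmin, Rmax; destruct Rle_dec; lra.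
    - rewrite Rmin_left, Rmax_right in Hy by lra. exists y. rewrite Rmin_left, Rmax_right in E by lra.
      split; [lra|]. unfold Fa. destruct Rlt_dec; [exact E|lra]. }
  destruct (epsilon_spec (inhabits 0) _ HE) as [Hy E]. fold (sin_a0 a s) in Hy, E.
  unfold Fa in E. destruct Rlt_dec; [|lra]. split; [lra|exact E].
Qed.

Lemma sin_a0_half_pi (a : nat) : (1 <= a)%nat -> sin_a0 a (pi_a a / 2) = 1.
Proof.
  intros Ha.
  assert (HE : exists y, 0 <= y <= 1 /\ Fa a y = pi_a a / 2).
  { exists 1. split; [lra|]. unfold Fa. destruct Rlt_dec; [lra|reflexivity]. }
  destruct (epsilon_spec (inhabits 0) _ HE) as [Hy E]. fold (sin_a0 a (pi_a a / 2)) in Hy, E.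
  unfold Fa in E. destruct Rlt_dec; [|lra].
  pose proof (proj1 (pi_a_lub a Ha) _ (conj (proj1 Hy) r)). unfold arcsin_int in H. lra.
Qed.

Lemma sin_a0_arcsin_int (a : nat) (y : R) : (1 <= a)%nat -> 0 <= y < 1 ->
  sin_a0 a (arcsin_int a y) = y.
Proof.
  intros Ha Hy.
  pose proof (arcsin_int_expands a 0 y Ha ltac:(lra) ltac:(lra) ltac:(lra)) as H0.
  rewrite arcsin_int_0 in H0. pose proof (proj1 (pi_a_lub a Ha) y Hy).
  destruct (sin_a0_spec a (arcsin_int a y) Ha ltac:(lra)) as [Hz E].
  destruct (Rtotal_order (sin_a0 a (arcsin_int a y)) y) as [h|[h|h]]; [|exact h|].
  - pose proof (arcsin_int_expands a _ y Ha (Rlt_le_trans (-1) 0 _ ltac:(lra) (proj1 Hz)) ltac:(lra) ltac:(lra)). lra.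
  - pose proof (arcsin_int_expands a y _ Ha ltac:(lra) (Rlt_le _ _ h) ltac:(lra)). lra.
Qed.

Lemma sin_a0_0 (a : nat) : (1 <= a)%nat -> sin_a0 a 0 = 0.
Proof. intros Ha. rewrite <- (arcsin_int_0 a) at 1. apply sin_a0_arcsin_int; [exact Ha|lra]. Qed.

Definition sin_a_base (a : nat) (r : R) : R :=
  if Rle_dec r (pi_a a) then sin_a0 a (Rmin r (pi_a a - r))
  else - sin_a0 a (Rmin (2 * pi_a a - r) (r - pi_a a)).

Lemma sin_a_period (a : nat) (r : R) (k : Z) : (1 <= a)%nat -> 0 <= r < 2 * pi_a a ->
  sin_a a (r + 2 * pi_a a * IZR k) = sin_a_base a r.
Proof.
  intros Ha Hr. pose proof (pi_a_pos a Ha) as HP. unfold sin_a, sin_a_base.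
  replace (Int_part ((r + 2 * pi_a a * IZR k) / (2 * pi_a a))) with k.
  2: { apply Int_part_spec.
       replace ((r + 2 * pi_a a * IZR k) / (2 * pi_a a)) with (r / (2 * pi_a a) + IZR k) by (field; lra).
       assert (0 <= r / (2 * pi_a a) < 1).
       { split; [apply Rle_mult_inv_pos; lra|]. apply Rlt_div_l; lra. }
       lra. }
  replace (r + 2 * pi_a a * IZR k - 2 * pi_a a * IZR k) with r by ring.
  replace (pi_a a - (2 * pi_a a - r)) with (r - pi_a a) by ring. reflexivity.
Qed.

Lemma real_mod (P s : R) : 0 < P -> exists (k : Z) (r : R), 0 <= r < P /\ s = r + P * IZR k.
Proof.
  intros HP. exists (Int_part (s / P)), (s - P * IZR (Int_part (s / P))). split; [|ring].
  destruct (base_Int_part (s / P)) as [H1 H2].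
  assert (E : s = P * (s / P)) by (field; lra).
  split; rewrite E at 1; nra.
Qed.

(** The branches of the definition meet at multiples of [pi_a], where all give [sin_a0 a 0 = 0].
    This symmetry transports everything proved on one window to the whole line. *)
Lemma sin_a_antiperiodic (a : nat) (s : R) : (1 <= a)%nat ->
  sin_a a (s + pi_a a) = - sin_a a s.
Proof.
  intros Ha. pose proof (pi_a_pos a Ha) as HP.
  destruct (real_mod (2 * pi_a a) s ltac:(lra)) as [k [r [Hr ->]]].
  rewrite (sin_a_period a r k Ha Hr).
  destruct (Rlt_dec r (pi_a a)) as [h|h].
  - replace (r + 2 * pi_a a * IZR k + pi_a a) with (r + pi_a a + 2 * pi_a a * IZR k) by ring.
    rewrite sin_a_period by (try exact Ha; lra). unfold sin_a_base.
    destruct (Rle_dec r (pi_a a)); [|lra].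
    destruct (Rle_dec (r + pi_a a) (pi_a a)).
    + replace r with 0 by lra. rewrite (Rmin_right (0 + pi_a a)), (Rmin_left 0) by lra.
      replace (pi_a a - (0 + pi_a a)) with 0 by ring. rewrite (sin_a0_0 a Ha). ring.
    + replace (2 * pi_a a - (r + pi_a a)) with (pi_a a - r) by ring.
      replace (r + pi_a a - pi_a a) with r by ring. now rewrite Rmin_comm.
  - replace (r + 2 * pi_a a * IZR k + pi_a a) with (r - pi_a a + 2 * pi_a a * IZR (k + 1)).
    2: rewrite plus_IZR; ring.
    rewrite sin_a_period by (try exact Ha; lra). unfold sin_a_base.
    destruct (Rle_dec (r - pi_a a) (pi_a a)); [|lra].
    destruct (Rle_dec r (pi_a a)).
    + replace r with (pi_a a) by lra. rewrite Rmin_left, Rmin_right by lra.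
      replace (pi_a a - pi_a a) with 0 by ring. rewrite (sin_a0_0 a Ha). ring.
    + replace (pi_a a - (r - pi_a a)) with (2 * pi_a a - r) by ring.
      rewrite Rmin_comm. ring.
Qed.

Lemma sin_a_antiperiodic_l (a : nat) (s : R) : (1 <= a)%nat ->
  sin_a a (s - pi_a a) = - sin_a a s.
Proof.
  intros Ha. pose proof (sin_a_antiperiodic a (s - pi_a a) Ha).
  replace (s - pi_a a + pi_a a) with s in H by ring. lra.
Qed.

Lemma sin_a_first_quarter (a : nat) (s : R) : (1 <= a)%nat -> 0 <= s <= pi_a a / 2 ->
  sin_a a s = sin_a0 a s.
Proof.
  intros Ha Hs. pose proof (pi_a_pos a Ha) as HP.
  replace s with (s + 2 * pi_a a * IZR 0) at 1 by (simpl; ring).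
  rewrite sin_a_period by (try exact Ha; lra). unfold sin_a_base.
  destruct Rle_dec; [|lra]. now rewrite Rmin_left by lra.
Qed.

Lemma sin_a_reflect (a : nat) (s : R) : (1 <= a)%nat -> 0 <= s <= pi_a a ->
  sin_a a (pi_a a - s) = sin_a a s.
Proof.
  intros Ha Hs. pose proof (pi_a_pos a Ha) as HP.
  replace s with (s + 2 * pi_a a * IZR 0) at 2 by (simpl; ring).
  replace (pi_a a - s) with (pi_a a - s + 2 * pi_a a * IZR 0) at 1 by (simpl; ring).
  rewrite !sin_a_period by (try exact Ha; lra). unfold sin_a_base.
  do 2 (destruct Rle_dec; [|lra]). rewrite Rmin_comm. f_equal. f_equal. ring.
Qed.

Lemma sin_a_opp (a : nat) (s : R) : (1 <= a)%nat -> 0 <= s <= pi_a a ->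
  sin_a a (- s) = - sin_a a s.
Proof.
  intros Ha Hs. rewrite <- (sin_a_reflect a s) by assumption.
  replace (- s) with (pi_a a - s - pi_a a) by ring.
  apply sin_a_antiperiodic_l, Ha.
Qed.

Lemma arcsin_int_sin_a (a : nat) (s : R) : (1 <= a)%nat -> - (pi_a a / 2) < s < pi_a a / 2 ->
  -1 < sin_a a s < 1 /\ arcsin_int a (sin_a a s) = s.
Proof.
  intros Ha Hs. destruct (Rle_dec 0 s) as [h|h].
  - rewrite sin_a_first_quarter by (try exact Ha; lra).
    destruct (sin_a0_spec a s Ha ltac:(lra)). split; [lra|assumption].
  - replace s with (- - s) by ring. rewrite sin_a_opp by (try exact Ha; lra).
    rewrite sin_a_first_quarter by (try exact Ha; lra).
    destruct (sin_a0_spec a (- s) Ha ltac:(lra)). split; [lra|].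
    rewrite arcsin_int_opp by (try exact Ha; lra). lra.
Qed.

Lemma is_derive_sin_a_center (a : nat) (s : R) : (1 <= a)%nat -> - (pi_a a / 2) < s < pi_a a / 2 ->
  is_derive (sin_a a) s (sqrt (1 - sin_a a s ^ (2 * a))).
Proof.
  intros Ha Hs. destruct (arcsin_int_sin_a a s Ha Hs) as [Hy E].
  destruct (sqrt_gap_pos a _ Ha Hy).
  destruct (locally_interior _ _ s Hs) as [d Hloc].
  rewrite <- (Rinv_inv (sqrt _)).
  apply (is_derive_inverse (arcsin_int a)).
  - apply is_derive_arcsin_int; assumption.
  - apply Rinv_neq_0_compat; lra.
  (* [sin_a] is 1-Lipschitz here because its inverse expands distances. *)
  - apply continuous_eps. intros eps He.
    exists (Rmin d eps). split; [apply Rmin_pos; [apply cond_pos|exact He]|].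
    intros u Hu. destruct (Rlt_Rmin _ _ _ Hu) as [Hu1 Hu2].
    destruct (arcsin_int_sin_a a u Ha (Hloc u Hu1)) as [Hyu Eu].
    apply Rle_lt_trans with (2 := Hu2).
    destruct (Rle_dec (sin_a a s) (sin_a a u)) as [h|h].
    + pose proof (arcsin_int_expands a _ _ Ha (proj1 Hy) h (proj2 Hyu)).
      rewrite (Rabs_right (sin_a a u - sin_a a s)) by lra. rewrite Eu, E in H1.
      eapply Rle_trans; [exact H1|apply Rle_abs].
    + pose proof (arcsin_int_expands a _ _ Ha (proj1 Hyu) (Rlt_le _ _ (Rnot_le_lt _ _ h)) (proj2 Hy)).
      rewrite (Rabs_left (sin_a a u - sin_a a s)) by lra. rewrite Eu, E in H1.
      rewrite Rabs_minus_sym. eapply Rle_trans; [|apply Rle_abs]. lra.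
  - exists d. intros u Hu. apply (arcsin_int_sin_a a u Ha (Hloc u Hu)).
Qed.

Lemma sin_a_half_pi (a : nat) : (1 <= a)%nat -> sin_a a (pi_a a / 2) = 1.
Proof.
  intros Ha. pose proof (pi_a_pos a Ha). rewrite sin_a_first_quarter by (try exact Ha; lra).
  apply sin_a0_half_pi, Ha.
Qed.

(** Just left of the top, 1 - sin_a u <= pi_a / 2 - u: otherwise the expansion of [arcsin_int] would
    push it beyond its supremum. The reflection gives the other side. *)
Lemma continuous_sin_a_half_pi (a : nat) : (1 <= a)%nat -> continuous (sin_a a) (pi_a a / 2).
Proof.
  intros Ha. pose proof (pi_a_pos a Ha) as HP.
  assert (HL : forall u, 0 <= u < pi_a a / 2 -> 0 <= 1 - sin_a a u <= pi_a a / 2 - u).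
  { intros u Hu. destruct (arcsin_int_sin_a a u Ha ltac:(lra)) as [Hy E]. split; [lra|].
    assert (Hp : 0 <= sin_a a u).
    { rewrite sin_a_first_quarter by (try exact Ha; lra). apply sin_a0_spec; assumption. }
    apply Rnot_lt_le. intros h.
    assert (Hy2 : sin_a a u + (pi_a a / 2 - u) < 1) by lra.
    assert (Hle : sin_a a u <= sin_a a u + (pi_a a / 2 - u)) by lra.
    pose proof (arcsin_int_expands a _ _ Ha (proj1 Hy) Hle Hy2) as H1.
    rewrite E in H1.
    pose proof (proj1 (pi_a_lub a Ha) (sin_a a u + (pi_a a / 2 - u)) ltac:(lra)). lra. }
  apply continuous_eps. intros eps He. exists (Rmin eps (pi_a a / 2)).
  split; [apply Rmin_pos; lra|]. intros u Hu. rewrite sin_a_half_pi by exact Ha.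
  destruct (Rlt_Rmin _ _ _ Hu) as [Hu1 Hu2].
  apply Rabs_def2 in Hu1. apply Rabs_def2 in Hu2.
  destruct (Rtotal_order u (pi_a a / 2)) as [h|[->|h]].
  - destruct (HL u ltac:(lra)). rewrite Rabs_left1; lra.
  - rewrite sin_a_half_pi by exact Ha. rewrite Rminus_diag, Rabs_R0. exact He.
  - rewrite <- sin_a_reflect by (try exact Ha; lra).
    destruct (HL (pi_a a - u) ltac:(lra)). rewrite Rabs_left1; lra.
Qed.

(** An explicit candidate for [cos_a], which is itself given only as a [Derive]. It is meant for the
    window from - pi_a / 2 to 3 pi_a / 2, which has the half period [0, pi_a] in its interior; the
    sign changes at the middle. *)
Definition cos_window (a : nat) (s : R) : R :=
  if Rle_dec s (pi_a a / 2) then sqrt (1 - sin_a a s ^ (2 * a))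
  else - sqrt (1 - sin_a a s ^ (2 * a)).

Lemma sin_a_pow_lt_1 (a : nat) (s : R) : (1 <= a)%nat ->
  - (pi_a a / 2) < s < 3 * (pi_a a / 2) -> s <> pi_a a / 2 -> sin_a a s ^ (2 * a) < 1.
Proof.
  intros Ha Hs Hne. destruct (Rlt_dec s (pi_a a / 2)) as [h|h].
  - apply pow_double_lt_1; [exact Ha|]. apply arcsin_int_sin_a; [exact Ha|lra].
  - replace s with (s - pi_a a + pi_a a) by ring. rewrite sin_a_antiperiodic by exact Ha.
    rewrite pow_double_opp. apply pow_double_lt_1; [exact Ha|].
    apply arcsin_int_sin_a; [exact Ha|lra].
Qed.

Lemma cos_window_sqr (a : nat) (s : R) : (1 <= a)%nat ->
  - (pi_a a / 2) < s < 3 * (pi_a a / 2) -> cos_window a s ^ 2 + sin_a a s ^ (2 * a) = 1.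
Proof.
  intros Ha Hs.
  assert (0 <= 1 - sin_a a s ^ (2 * a)).
  { destruct (Req_dec s (pi_a a / 2)) as [->|h].
    - rewrite sin_a_half_pi, pow1 by exact Ha. lra.
    - pose proof (sin_a_pow_lt_1 a s Ha Hs h). lra. }
  unfold cos_window. destruct Rle_dec;
    [|replace ((- sqrt (1 - sin_a a s ^ (2 * a))) ^ 2)
        with (sqrt (1 - sin_a a s ^ (2 * a)) ^ 2) by ring];
    rewrite pow2_sqrt by exact H; ring.
Qed.

(** Off [pi_a a / 2] both derivatives come from the inverse function and the half-period shift. At
    [pi_a a / 2] the square root is taken at 0, where it has no derivative, and [derive_extends]
    fills the gap by continuity. *)
Lemma is_derive_sin_a_window (a : nat) (s : R) : (1 <= a)%nat ->
  - (pi_a a / 2) < s < 3 * (pi_a a / 2) ->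
  is_derive (sin_a a) s (cos_window a s) /\
  is_derive (cos_window a) s (- (INR a * sin_a a s ^ (2 * a - 1))).
Proof.
  intros Ha. pose proof (pi_a_pos a Ha) as HP.
  set (g := fun s => sqrt (1 - sin_a a s ^ (2 * a))).
  assert (Dg : forall s l, is_derive (sin_a a) s l -> sin_a a s ^ (2 * a) < 1 ->
    is_derive g s (- (INR a * l * sin_a a s ^ (2 * a - 1)) / g s)).
  { intros u l Hu H1. eapply is_derive_value.
    - apply (is_derive_sqrt (fun s => 1 - sin_a a s ^ (2 * a))); [|lra].
      apply (is_derive_Rminus (fun _ => 1)); [apply (is_derive_const 1)|].
      apply is_derive_pow, Hu.
    - replace (pred (2 * a)) with (2 * a - 1)%nat by lia.
      rewrite mult_INR. simpl (INR 2). fold (g u).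
      assert (0 < g u) by (apply sqrt_lt_R0; lra). unfold zero; simpl. field. lra. }
  assert (DS : forall s, - (pi_a a / 2) < s < 3 * (pi_a a / 2) -> s <> pi_a a / 2 ->
    is_derive (sin_a a) s (cos_window a s)).
  { intros u Hu Hne. unfold cos_window. destruct Rle_dec as [h|h].
    - apply is_derive_sin_a_center; [exact Ha|lra].
    - apply (is_derive_ext (fun v => - sin_a a (v - pi_a a))).
      { intros v. rewrite sin_a_antiperiodic_l by exact Ha. apply Ropp_involutive. }
      apply (is_derive_opp (fun v => sin_a a (v - pi_a a))).
      eapply is_derive_value.
      + apply (is_derive_Rcomp (sin_a a) (fun v => v - pi_a a) u).
        * apply is_derive_sin_a_center; [exact Ha|lra].
        * auto_derive; [trivial|reflexivity].
      + rewrite sin_a_antiperiodic_l, pow_double_opp by exact Ha. ring. }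
  assert (DC : forall s, - (pi_a a / 2) < s < 3 * (pi_a a / 2) -> s <> pi_a a / 2 ->
    is_derive (cos_window a) s (- (INR a * sin_a a s ^ (2 * a - 1)))).
  { intros u Hu Hne. pose proof (sin_a_pow_lt_1 a u Ha Hu Hne) as H1.
    assert (Hg : 0 < g u) by (apply sqrt_lt_R0; lra).
    specialize (Dg u _ (DS u Hu Hne) H1). unfold cos_window in Dg.
    destruct Rle_dec as [h|h]; fold (g u) in Dg.
    - apply (is_derive_ext_loc g).
      + generalize (open_lt (pi_a a / 2) u ltac:(lra)). apply filter_imp. intros v Hv.
        unfold cos_window, g. destruct Rle_dec; [reflexivity|lra].
      + eapply is_derive_value; [exact Dg|]. field. lra.
    - apply (is_derive_ext_loc (fun v => - g v)).
      + generalize (open_gt (pi_a a / 2) u ltac:(lra)). apply filter_imp. intros v Hv.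
        unfold cos_window, g. destruct Rle_dec; [lra|reflexivity].
      + eapply is_derive_value; [apply (is_derive_opp g), Dg|]. unfold opp; simpl. field. lra. }
  assert (CS := continuous_sin_a_half_pi a Ha).
  assert (CC : continuous (cos_window a) (pi_a a / 2)).
  { assert (Cg : continuous g (pi_a a / 2)).
    { apply (continuous_comp (sin_a a) (fun y => sqrt (1 - y ^ (2 * a)))); [exact CS|].
      apply (continuous_comp (fun y => 1 - y ^ (2 * a)) sqrt).
      - apply (ex_derive_continuous (fun y => 1 - y ^ (2 * a))). auto_derive. trivial.
      - apply continuity_pt_filterlim, continuity_pt_sqrt.
        rewrite sin_a_half_pi, pow1 by exact Ha. lra. }
    assert (Eg : g (pi_a a / 2) = 0).
    { unfold g. rewrite sin_a_half_pi, pow1, Rminus_diag by exact Ha. apply sqrt_0. }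
    apply continuous_eps. intros eps He.
    destruct (proj1 (continuous_eps _ _) Cg eps He) as [d [Hd0 Hd]].
    exists d. split; [exact Hd0|]. intros v Hv. specialize (Hd v Hv).
    rewrite Eg, Rminus_0_r in Hd.
    unfold cos_window. fold (g v). fold (g (pi_a a / 2)). rewrite Eg.
    destruct (Rle_dec (pi_a a / 2) (pi_a a / 2)); [|lra]. rewrite Rminus_0_r.
    destruct Rle_dec; [exact Hd|]. rewrite Rabs_Ropp. exact Hd. }
  intros Hs. destruct (Req_dec s (pi_a a / 2)) as [->|Hne]; [|split; [apply DS|apply DC]; assumption].
  split.
  - apply (derive_extends _ (cos_window a) _ (pi_a a / 2)); try assumption; [lra|].
    intros u Hu Hne. apply Rabs_def2 in Hu. apply DS; lra.
  - apply (derive_extends _ (fun s => - (INR a * sin_a a s ^ (2 * a - 1))) _ (pi_a a / 2));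
      try assumption; [lra| |].
    + intros u Hu Hne. apply Rabs_def2 in Hu. apply DC; lra.
    + apply (continuous_comp (sin_a a) (fun y => - (INR a * y ^ (2 * a - 1)))); [exact CS|].
      apply (ex_derive_continuous (fun y => - (INR a * y ^ (2 * a - 1)))). auto_derive. trivial.
Qed.

Definition trig_at (a : nat) (s : R) : Prop :=
  is_derive (sin_a a) s (cos_a a s) /\
  is_derive (cos_a a) s (- (INR a * sin_a a s ^ (2 * a - 1))) /\
  cos_a a s ^ 2 + sin_a a s ^ (2 * a) = 1.

Lemma cos_a_window (a : nat) (s : R) : (1 <= a)%nat ->
  - (pi_a a / 2) < s < 3 * (pi_a a / 2) -> cos_a a s = cos_window a s.
Proof. intros Ha Hs. apply is_derive_unique, is_derive_sin_a_window; assumption. Qed.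

Lemma cos_a_antishift (a : nat) (q s : R) : (forall v, sin_a a (v + q) = - sin_a a v) ->
  ex_derive (sin_a a) s -> is_derive (sin_a a) (s + q) (- cos_a a s).
Proof.
  intros Hq [l Hl]. unfold cos_a. rewrite (is_derive_unique _ _ _ Hl).
  apply (is_derive_ext (fun v => - sin_a a (v - q))).
  { intros v. rewrite <- Hq. f_equal. ring. }
  apply (is_derive_opp (fun v => sin_a a (v - q))).
  eapply is_derive_value.
  - apply (is_derive_Rcomp (sin_a a) (fun v => v - q) (s + q) l 1).
    + replace (s + q - q) with s by ring. exact Hl.
    + auto_derive; [trivial|reflexivity].
  - ring.
Qed.

Lemma locally_shift (P : R -> Prop) (q s : R) :
  locally s (fun v => P (v + q)) -> locally (s + q) P.
Proof.
  intros [d Hd]. exists d. intros v Hv. replace v with (v - q + q) by ring. apply Hd.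
  change (Rabs (v - (s + q)) < d) in Hv. change (Rabs (v - q - s) < d).
  replace (v - q - s) with (v - (s + q)) by ring. exact Hv.
Qed.

(** The property travels on neighbourhoods, since the derivative of [cos_a] at a point involves
    [cos_a] nearby. *)
Lemma trig_at_antishift (a : nat) (q s : R) : (1 <= a)%nat ->
  (forall v, sin_a a (v + q) = - sin_a a v) ->
  locally s (trig_at a) -> locally (s + q) (trig_at a).
Proof.
  intros Ha Hq Hloc.
  assert (HC : forall v, trig_at a v -> cos_a a (v + q) = - cos_a a v).
  { intros v [Hv _]. apply is_derive_unique, cos_a_antishift; [exact Hq|]. eexists; exact Hv. }
  apply locally_shift. apply locally_locally in Hloc. revert Hloc. apply filter_imp.
  intros v Hv. change R in v. pose proof (locally_singleton _ _ Hv) as Hv0.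
  unfold trig_at. rewrite (HC v Hv0), Hq.
  destruct Hv0 as [H1 [H2 H3]]. split; [|split].
  - apply cos_a_antishift; [exact Hq|]. eexists; exact H1.
  - apply (is_derive_ext_loc (fun v => - cos_a a (v - q))).
    + apply locally_shift. revert Hv. apply filter_imp. intros w Hw.
      rewrite (HC w Hw). f_equal. f_equal. ring.
    (* The exponent 2a - 1 is odd, so the sign of [sin_a] passes to its power. *)
    + replace (2 * a - 1)%nat with (S (2 * (a - 1))) by lia.
      replace (2 * a - 1)%nat with (S (2 * (a - 1))) in H2 by lia.
      eapply is_derive_value.
      * apply (is_derive_opp (fun v => cos_a a (v - q))).
        apply (is_derive_Rcomp (cos_a a) (fun v => v - q) (v + q)
                 (- (INR a * sin_a a v ^ S (2 * (a - 1)))) 1).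
        -- replace (v + q - q) with v by ring. exact H2.
        -- auto_derive; [trivial|reflexivity].
      * rewrite <- !tech_pow_Rmult, pow_double_opp. unfold opp; simpl. ring.
  - rewrite pow_double_opp, <- H3. ring.
Qed.

Lemma trig_identities (a : nat) (s : R) : (1 <= a)%nat -> trig_at a s.
Proof.
  intros Ha. pose proof (pi_a_pos a Ha) as HP.
  assert (HW : forall u, - (pi_a a / 2) < u < 3 * (pi_a a / 2) -> trig_at a u).
  { intros u Hu. destruct (is_derive_sin_a_window a u Ha Hu) as [H1 H2]. unfold trig_at.
    rewrite (cos_a_window a u Ha Hu). split; [exact H1|split].
    - apply (is_derive_ext_loc (cos_window a)); [|exact H2].
      generalize (locally_interior _ _ u Hu). apply filter_imp. intros v Hv.
      symmetry. apply cos_a_window; assumption.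
    - apply cos_window_sqr; assumption. }
  destruct (real_mod (pi_a a) s HP) as [k [r [Hr ->]]].
  apply locally_singleton.
  assert (H0 : locally r (trig_at a)).
  { exists (mkposreal (pi_a a / 2) ltac:(lra)). intros v Hv.
    change (Rabs (v - r) < pi_a a / 2) in Hv. apply Rabs_def2 in Hv. apply HW. lra. }
  assert (HN : forall q m, (forall v, sin_a a (v + q) = - sin_a a v) ->
    locally (r + q * INR m) (trig_at a)).
  { intros q m Hq. induction m as [|m IH].
    - simpl. rewrite Rmult_0_r, Rplus_0_r. exact H0.
    - rewrite S_INR. replace (r + q * (INR m + 1)) with (r + q * INR m + q) by ring.
      apply trig_at_antishift; assumption. }
  destruct (Z.le_gt_cases 0 k) as [h|h].
  - replace (IZR k) with (INR (Z.to_nat k)) by (rewrite INR_IZR_INZ, Z2Nat.id; auto).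
    apply HN. intros v. apply sin_a_antiperiodic, Ha.
  - replace (pi_a a * IZR k) with (- pi_a a * INR (Z.to_nat (- k))).
    2: { rewrite INR_IZR_INZ, Z2Nat.id, opp_IZR by lia. ring. }
    apply HN. intros v. apply sin_a_antiperiodic_l, Ha.
Qed.

Lemma sin_a_0 (a : nat) : (1 <= a)%nat -> sin_a a 0 = 0.
Proof.
  intros Ha. pose proof (pi_a_pos a Ha). rewrite sin_a_first_quarter by (try exact Ha; lra).
  apply sin_a0_0, Ha.
Qed.

(** The range [0, pi_a] is the one allowed for all spherical angles but the last; it covers the half
    y >= 0 of the curve. The sign of c decides between an angle of the first quarter and its
    reflection. *)
Lemma angle_upper_half (a : nat) (c y : R) : (1 <= a)%nat -> 0 <= y -> c ^ 2 + y ^ (2 * a) = 1 ->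
  exists phi, 0 <= phi <= pi_a a /\ cos_a a phi = c /\ sin_a a phi = y.
Proof.
  intros Ha Hy E. pose proof (pi_a_pos a Ha) as HP.
  assert (Hy1 : y <= 1).
  { apply Rnot_lt_le. intros h. pose proof (pow2_ge_0 c).
    pose proof (Rlt_pow_R1 y (2 * a) h ltac:(lia)). lra. }
  assert (HS : exists s, 0 <= s <= pi_a a / 2 /\ sin_a a s = y).
  { destruct Hy1 as [Hy1| ->].
    - exists (arcsin_int a y).
      pose proof (arcsin_int_expands a 0 y Ha ltac:(lra) ltac:(lra) ltac:(lra)) as H0.
      rewrite arcsin_int_0 in H0. pose proof (proj1 (pi_a_lub a Ha) y ltac:(lra)).
      split; [lra|]. rewrite sin_a_first_quarter by (try exact Ha; lra).
      apply sin_a0_arcsin_int; [exact Ha|lra].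
    - exists (pi_a a / 2). split; [lra|]. apply sin_a_half_pi, Ha. }
  destruct HS as [s [Hs Es]].
  assert (Er : sqrt (1 - y ^ (2 * a)) = Rabs c).
  { replace (1 - y ^ (2 * a)) with (Rsqr c) by (unfold Rsqr; lra). apply sqrt_Rsqr_abs. }
  destruct (Rle_dec 0 c) as [h|h].
  - exists s. split; [lra|]. split; [|exact Es].
    rewrite cos_a_window by (try exact Ha; lra). unfold cos_window.
    destruct Rle_dec; [|lra]. rewrite Es, Er. apply Rabs_right. lra.
  - assert (Esr : sin_a a (pi_a a - s) = y) by (rewrite sin_a_reflect; try exact Ha; lra).
    exists (pi_a a - s). split; [lra|]. split; [|exact Esr].
    rewrite cos_a_window by (try exact Ha; lra). unfold cos_window.
    rewrite Esr, Er, Rabs_left by lra. destruct Rle_dec; [|ring].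
    assert (s = pi_a a / 2) by lra. subst s. rewrite sin_a_half_pi in Es by exact Ha.
    subst y. rewrite pow1 in E. nra.
Qed.

Lemma angle_full_turn (a : nat) (c y : R) : (1 <= a)%nat -> c ^ 2 + y ^ (2 * a) = 1 ->
  exists phi, 0 <= phi < 2 * pi_a a /\ cos_a a phi = c /\ sin_a a phi = y.
Proof.
  intros Ha E. pose proof (pi_a_pos a Ha) as HP.
  destruct (Rle_dec 0 y) as [h|h].
  - destruct (angle_upper_half a c y Ha h E) as [phi [H1 H2]]. exists phi. split; [lra|exact H2].
  - destruct (angle_upper_half a (- c) (- y) Ha ltac:(lra)) as [phi [H1 [H2 H3]]].
    { rewrite pow_double_opp, <- E. ring. }
    (* Excluding [pi_a a] keeps the shifted angle strictly below a full turn. *)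
    assert (phi <> pi_a a).
    { intros ->. replace (pi_a a) with (0 + pi_a a) in H3 by ring.
      rewrite sin_a_antiperiodic, sin_a_0 in H3 by exact Ha. lra. }
    exists (phi + pi_a a). split; [lra|]. split.
    + replace c with (- cos_a a phi) by lra. apply is_derive_unique, cos_a_antishift.
      * intros v. apply sin_a_antiperiodic, Ha.
      * eexists. exact (proj1 (trig_identities a phi Ha)).
    + rewrite sin_a_antiperiodic by exact Ha. lra.
Qed.

(** The equation F'' = - a r F^(2a-1) is solved explicitly by a rescaled [sin_a], or by an affine
    function when there is no force. The solution is global because the clock of a competitor is not
    confined to the interval of the original clock values. *)
Lemma oscillator_solution (r x0 p0 : R) (a : nat) : 0 <= r -> exists F G : R -> R,
  F 0 = x0 /\ G 0 = p0 /\
  (forall s, is_derive F s (G s)) /\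
  (forall s, is_derive G s (- (INR a * r * F s ^ (2 * a - 1)))).
Proof.
  intros Hr.
  assert (Hlin : INR a * r = 0 \/ (p0 = 0 /\ x0 ^ (2 * a - 1) = 0) ->
    exists F G : R -> R, F 0 = x0 /\ G 0 = p0 /\ (forall s, is_derive F s (G s)) /\
      (forall s, is_derive G s (- (INR a * r * F s ^ (2 * a - 1))))).
  { intros H. exists (fun s => p0 * s + x0), (fun _ => p0).
    split; [ring|split; [reflexivity|split]]; intros s.
    - apply is_derive_affine.
    - eapply is_derive_value; [apply (is_derive_const p0 s)|].
      destruct H as [E|[-> E]]; [rewrite E|rewrite Rmult_0_l, Rplus_0_l, E]; unfold zero; simpl; ring. }
  destruct (Nat.eq_dec a 0) as [->|Ha0]; [apply Hlin; left; simpl; ring|].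
  assert (Ha : (1 <= a)%nat) by lia.
  destruct Hr as [Hr|<-]; [|apply Hlin; left; ring].
  (* The conserved energy divided by r; the amplitude A is its 2a-th root. *)
  set (E := p0 ^ 2 / r + x0 ^ (2 * a)).
  assert (HE : 0 <= E).
  { apply Rplus_le_le_0_compat; [|apply pow_double_nonneg].
    apply Rle_mult_inv_pos; [apply pow2_ge_0|exact Hr]. }
  destruct (nonneg_root E (2 * a) HE ltac:(lia)) as [A [HA EA]].
  destruct HA as [HA|<-].
  (* Zero amplitude is the equilibrium: p0 and x0 both vanish. *)
  2: { apply Hlin. right. rewrite pow_i in EA by lia. unfold E in EA.
       pose proof (pow_double_nonneg x0 a).
       assert (0 <= p0 ^ 2 / r) by (apply Rle_mult_inv_pos; [apply pow2_ge_0|exact Hr]).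
       assert (Hx : x0 ^ (2 * a) = 0) by lra.
       assert (Hp : p0 ^ 2 / r = 0) by lra.
       assert (p0 ^ 2 = p0 ^ 2 / r * r) by (field; lra). split; [nra|].
       apply NNPP. intros Hn. apply (pow_nonzero x0 (2 * a)); [|exact Hx].
       intros ->. apply Hn. apply pow_i. lia. }
  (* The frequency is forced by w^2 = r A^(2a-2), so that A w^2 sin^(2a-1) equals r (A
     sin)^(2a-1). *)
  set (w := sqrt r * A ^ (a - 1)).
  assert (HB : 0 < A ^ (a - 1)) by (apply pow_lt, HA).
  assert (Hw : 0 < w) by (apply Rmult_lt_0_compat; [apply sqrt_lt_R0|]; assumption).
  assert (Ew : w ^ 2 = r * (A ^ (a - 1)) ^ 2).
  { unfold w. rewrite Rpow_mult_distr, pow2_sqrt by lra. reflexivity. }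
  assert (EA2 : A ^ (2 * a) = A ^ 2 * (A ^ (a - 1)) ^ 2).
  { rewrite <- pow_mult, <- pow_add. f_equal. lia. }
  assert (EA1 : A ^ (2 * a - 1) = A * (A ^ (a - 1)) ^ 2).
  { rewrite <- pow_mult, tech_pow_Rmult. f_equal. lia. }
  destruct (angle_full_turn a (p0 / (A * w)) (x0 / A) Ha) as [phi [_ [Hc Hs]]].
  { unfold Rdiv at 2. rewrite Rpow_mult_distr, pow_inv, EA.
    replace ((p0 / (A * w)) ^ 2) with (p0 ^ 2 / (A ^ 2 * w ^ 2)) by (field; lra).
    replace (A ^ 2 * w ^ 2) with (r * E) by (rewrite Ew, <- EA, EA2; ring).
    assert (0 < E) by (rewrite <- EA; apply pow_lt, HA).
    replace (x0 ^ (2 * a)) with (E - p0 ^ 2 / r) by (unfold E; ring).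
    field. lra. }
  exists (fun s => A * sin_a a (w * s + phi)), (fun s => A * w * cos_a a (w * s + phi)).
  split; [rewrite Rmult_0_r, Rplus_0_l, Hs; field; lra|].
  split; [rewrite Rmult_0_r, Rplus_0_l, Hc; field; lra|].
  split; intros s; destruct (trig_identities a (w * s + phi) Ha) as [D1 [D2 _]].
  - eapply is_derive_value.
    + apply is_derive_Rscal, (is_derive_Rcomp (sin_a a)); [exact D1|apply is_derive_affine].
    + ring.
  - eapply is_derive_value.
    + apply is_derive_Rscal, (is_derive_Rcomp (cos_a a)); [exact D2|apply is_derive_affine].
    + rewrite Rpow_mult_distr, EA1.
      replace (A * w * (w * - (INR a * sin_a a (w * s + phi) ^ (2 * a - 1))))
        with (- (INR a * A * w ^ 2 * sin_a a (w * s + phi) ^ (2 * a - 1))) by ring.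
      rewrite Ew. ring.
Qed.

(** * Null sets and Lipschitz functions *)


(** Real induction: the supremum m of the points reachable from a is itself reached, because the
    relation at m joins points just left of m to points just right of it; for the same reason m
    cannot lie below b. *)
Lemma cousin_chain (P : R -> R -> Prop) (a b : R) : a <= b ->
  (forall u v w, u <= v -> v <= w -> P u v -> P v w -> P u w) ->
  (forall t, a <= t <= b -> exists d, 0 < d /\
     forall u v, a <= u <= t -> t <= v <= b -> t - d < u -> v < t + d -> P u v) ->
  P a b.
Proof.
  intros Hab Htr Hloc.
  destruct (completeness (fun s => a <= s <= b /\ P a s)) as [m [Hub Hl]].
  - exists b. intros s [Hs _]. lra.
  - exists a. split; [lra|]. destruct (Hloc a ltac:(lra)) as [d [Hd H]]. apply H; lra.
  - assert (Haa : P a a) by (destruct (Hloc a ltac:(lra)) as [d [Hd H]]; apply H; lra).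
    assert (Hma : a <= m) by (apply Hub; split; [lra|exact Haa]).
    assert (Hmb : m <= b) by (apply Hl; intros s [Hs _]; lra).
    destruct (Hloc m ltac:(lra)) as [d [Hd H]].
    assert (Hs : exists s, a <= s <= m /\ m - d < s /\ P a s).
    { apply NNPP. intros HN. assert (m <= m - d); [|lra]. apply Hl. intros s [Hs HP].
      apply Rnot_lt_le. intros h. apply HN. exists s. split; [|split; assumption].
      split; [lra|]. apply Hub. split; assumption. }
    destruct Hs as [s [Hs1 [Hs2 HPs]]].
    set (v := Rmin b (m + d / 2)).
    assert (Hv : m <= v <= b /\ v < m + d).
    { unfold v, Rmin. destruct Rle_dec; lra. }
    assert (HPv : P a v).
    { apply (Htr a s v); [lra|lra|exact HPs|]. apply H; lra. }
    assert (Hvm : v <= m) by (apply Hub; split; [lra|exact HPv]).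
    assert (E : v = b) by (unfold v, Rmin in *; destruct Rle_dec; lra).
    rewrite E in HPv. exact HPv.
Qed.

Lemma sum_f_R0_mono (u : nat -> R) (m k : nat) : (forall i, 0 <= u i) -> (m <= k)%nat ->
  sum_f_R0 u m <= sum_f_R0 u k.
Proof.
  intros Hu H. induction H as [|k H IH]; [lra|]. simpl. pose proof (Hu (S k)). lra.
Qed.

Lemma term_le_sum (u : nat -> R) (k m : nat) : (forall i, 0 <= u i) -> (k <= m)%nat ->
  u k <= sum_f_R0 u m.
Proof.
  intros Hu H. apply Rle_trans with (sum_f_R0 u k); [|apply sum_f_R0_mono; assumption].
  destruct k as [|k]; simpl; [lra|]. pose proof (cond_pos_sum u k Hu). lra.
Qed.

Lemma null_set_add_point (N : R -> Prop) (p : R) :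
  null_set N -> null_set (fun t => N t \/ t = p).
Proof.
  intros HN eps He. destruct (HN (eps / 2) ltac:(lra)) as [a [b [H1 [H2 H3]]]].
  exists (fun k => match k with O => p - eps / 4 | S k => a k end),
         (fun k => match k with O => p + eps / 4 | S k => b k end).
  split; [intros [|k]; [lra|apply H1]|split].
  - intros t [Ht| ->]; [destruct (H2 t Ht) as [k Hk]; exists (S k); exact Hk|exists O; lra].
  - intros [|m]; [simpl; lra|]. rewrite decomp_sum by lia. simpl pred. specialize (H3 m).
    cbv beta iota. lra.
Qed.

(** Each term is the length of the part of interval k lying left of s, so an increment in s measures
    the cover between two times, with multiplicity. *)
Definition cover_measure (a b : nat -> R) (m : nat) (s : R) : R :=
  sum_f_R0 (fun k => Rmin s (b k) - Rmin s (a k)) m.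

Lemma cover_measure_gap (a b u v : R) : a <= b -> u <= v ->
  0 <= (Rmin v b - Rmin v a) - (Rmin u b - Rmin u a).
Proof. intros H1 H2. unfold Rmin. repeat destruct Rle_dec; lra. Qed.

(* The null set is charged to the measure of its cover, where the Lipschitz bound applies;
   elsewhere the derivative controls the increment. *)
Lemma ae_derive_increment (f : R -> R) (L c a b : R) (N : R -> Prop) : a <= b ->
  (forall s t, a <= s <= b -> a <= t <= b -> Rabs (f s - f t) <= L * Rabs (s - t)) ->
  null_set N ->
  (forall t, a < t < b -> ~ N t -> exists l, is_derive f t l /\ l <= c) ->
  f b - f a <= c * (b - a).
Proof.
  intros Hab HL HN Hd.
  apply le_epsilon. intros eta Heta.
  (* K exceeds L - c, the excess of the Lipschitz slope over the slope c. *)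
  set (K := Rabs L + Rabs c + 1).
  assert (HK : 0 < K) by (unfold K; pose proof (Rabs_pos L); pose proof (Rabs_pos c); lra).
  set (e1 := eta / (2 * (b - a + 1))).
  assert (He1 : 0 < e1) by (apply Rdiv_lt_0_compat; lra).
  (* The end points join the null set, since derivatives are given only inside the interval. *)
  assert (HN' : null_set (fun t => (N t \/ t = a) \/ t = b)).
  { apply null_set_add_point, null_set_add_point, HN. }
  destruct (HN' (eta / (2 * K)) ltac:(apply Rdiv_lt_0_compat; lra)) as [p [q [Hpq [Hcov Hsum]]]].
  (* Asking for all large m makes the relation transitive: an exceptional point needs only the
     interval that covers it, and a chain keeps the larger index. *)
  set (P := fun u v => exists m0, forall m, (m0 <= m)%nat ->
    f v - f u <= (c + e1) * (v - u) + K * (cover_measure p q m v - cover_measure p q m u)).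
  assert (Hg : forall m u v, u <= v -> 0 <= cover_measure p q m v - cover_measure p q m u).
  { intros m u v Huv. unfold cover_measure. rewrite <- minus_sum. apply cond_pos_sum.
    intros k. apply cover_measure_gap; [apply Hpq|exact Huv]. }
  assert (HP : P a b).
  { apply cousin_chain; [exact Hab| |].
    - intros u v w Huv Hvw [m1 H1] [m2 H2]. exists (max m1 m2). intros m Hm.
      specialize (H1 m ltac:(lia)). specialize (H2 m ltac:(lia)). lra.
    - intros t Ht. destruct (classic ((N t \/ t = a) \/ t = b)) as [HNt|HNt].
      + destruct (Hcov t HNt) as [k Hk].
        exists (Rmin (t - p k) (q k - t)). split; [apply Rmin_pos; lra|].
        intros u v Hu Hv Hu' Hv'.
        pose proof (Rmin_l (t - p k) (q k - t)). pose proof (Rmin_r (t - p k) (q k - t)).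
        exists k. intros m Hm.
        assert (G : v - u <= cover_measure p q m v - cover_measure p q m u).
        { unfold cover_measure. rewrite <- minus_sum.
          set (g := fun k => Rmin v (q k) - Rmin v (p k) - (Rmin u (q k) - Rmin u (p k))).
          replace (v - u) with (g k).
          - apply (term_le_sum g k m); [|exact Hm]. intros i. apply cover_measure_gap; [apply Hpq|lra].
          - unfold g, Rmin. repeat destruct Rle_dec; lra. }
        assert (Hf : f v - f u <= L * (v - u)).
        { apply Rle_trans with (1 := Rle_abs _). rewrite <- (Rabs_right (v - u)) by lra.
          apply HL; lra. }
        assert (L * (v - u) <= Rabs L * (v - u)) by (apply Rmult_le_compat_r; [lra|apply Rle_abs]).
        assert (- c * (v - u) <= Rabs c * (v - u)).
        { apply Rmult_le_compat_r; [lra|]. rewrite <- Rabs_Ropp. apply Rle_abs. }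
        assert (K * (v - u) <= K * (cover_measure p q m v - cover_measure p q m u)).
        { apply Rmult_le_compat_l; lra. }
        assert (0 <= e1 * (v - u)) by (apply Rmult_le_pos; lra).
        unfold K in *. lra.
      + destruct (Hd t) as [l [Dl Hl]]; [split; apply Rnot_le_lt; intros h; apply HNt; lra|tauto|].
        destruct (proj1 (is_derive_eps f t l) Dl e1 He1) as [d [Hd0 HD]].
        exists d. split; [exact Hd0|]. intros u v Hu Hv Hu' Hv'. exists O. intros m _.
        assert (H1 := HD u ltac:(rewrite Rabs_left1; lra)).
        assert (H2 := HD v ltac:(rewrite Rabs_right; lra)).
        rewrite (Rabs_left1 (u - t)) in H1 by lra. rewrite (Rabs_right (v - t)) in H2 by lra.
        apply Rabs_le_between in H1. apply Rabs_le_between in H2.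
        assert (0 <= K * (cover_measure p q m v - cover_measure p q m u)).
        { apply Rmult_le_pos; [lra|]. apply Hg. lra. }
        assert (l * (v - u) <= c * (v - u)) by (apply Rmult_le_compat_r; lra).
        lra. }
  destruct HP as [m Hm]. specialize (Hm m (le_n m)).
  assert (HG : cover_measure p q m b - cover_measure p q m a <= eta / (2 * K)).
  { apply Rle_trans with (2 := Hsum m). unfold cover_measure. rewrite <- minus_sum.
    apply sum_Rle. intros k _. pose proof (Hpq k). unfold Rmin. repeat destruct Rle_dec; lra. }
  assert (K * (cover_measure p q m b - cover_measure p q m a) <= eta / 2).
  { replace (eta / 2) with (K * (eta / (2 * K))) by (field; lra). apply Rmult_le_compat_l; lra. }
  assert (e1 * (b - a) <= eta / 2).
  { unfold e1. replace (eta / (2 * (b - a + 1)) * (b - a))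
      with (eta / 2 * ((b - a) / (b - a + 1))) by (field; lra).
    rewrite <- (Rmult_1_r (eta / 2)) at 2. apply Rmult_le_compat_l; [lra|].
    apply Rle_div_l; lra. }
  lra.
Qed.

(** Otherwise the identity map would satisfy the increment bound with slope 0. *)
Lemma null_set_misses (N : R -> Prop) (a b : R) : a < b -> null_set N ->
  exists t, a < t < b /\ ~ N t.
Proof.
  intros Hab HN. apply NNPP. intros H.
  assert (E := ae_derive_increment (fun t => t) 1 0 a b N ltac:(lra)).
  assert (b - a <= 0 * (b - a)); [|lra]. apply E.
  - intros s t _ _. lra.
  - exact HN.
  - intros t Ht Hn. exfalso. apply H. exists t. split; assumption.
Qed.

Lemma ae_derive_increment_abs (f : R -> R) (L c a b : R) (N : R -> Prop) : a <= b ->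
  (forall s t, a <= s <= b -> a <= t <= b -> Rabs (f s - f t) <= L * Rabs (s - t)) ->
  null_set N ->
  (forall t, a < t < b -> ~ N t -> exists l, is_derive f t l /\ Rabs l <= c) ->
  Rabs (f b - f a) <= c * (b - a).
Proof.
  intros Hab HL HN Hd. apply Rabs_le. split.
  - assert (- f b - - f a <= c * (b - a)); [|lra].
    apply (ae_derive_increment (fun t => - f t) L c a b N); try assumption.
    + intros s t Hs Ht. replace (- f s - - f t) with (f t - f s) by ring.
      rewrite (Rabs_minus_sym s t). apply HL; assumption.
    + intros t Ht Hn. destruct (Hd t Ht Hn) as [l [D Hl]]. exists (- l). split.
      * apply (is_derive_opp f), D.
      * rewrite <- Rabs_Ropp in Hl. apply Rle_trans with (1 := Rle_abs _) in Hl. exact Hl.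
  - apply (ae_derive_increment f L c a b N); try assumption.
    intros t Ht Hn. destruct (Hd t Ht Hn) as [l [D Hl]]. exists l. split; [exact D|].
    apply Rle_trans with (1 := Rle_abs _) in Hl. exact Hl.
Qed.

(** * Metric speed and reparametrized competitors *)


Lemma sum_upto_S (f : nat -> R) (m : nat) : sum_upto f (S m) = sum_upto f m + f (S m).
Proof. reflexivity. Qed.

Lemma sum_upto_ext (f g : nat -> R) (m : nat) :
  (forall j, (1 <= j <= m)%nat -> f j = g j) -> sum_upto f m = sum_upto g m.
Proof.
  induction m as [|m IH]; intros H; [reflexivity|]. simpl. rewrite IH, H; try lia; auto.
  intros j Hj. apply H. lia.
Qed.

Lemma sum_upto_le (f g : nat -> R) (m : nat) :
  (forall j, (1 <= j <= m)%nat -> f j <= g j) -> sum_upto f m <= sum_upto g m.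
Proof.
  induction m as [|m IH]; intros H; simpl; [lra|].
  apply Rplus_le_compat; [apply IH; intros; apply H; lia|apply H; lia].
Qed.

Lemma sum_upto_plus (f g : nat -> R) (m : nat) :
  sum_upto (fun j => f j + g j) m = sum_upto f m + sum_upto g m.
Proof. induction m as [|m IH]; simpl; [ring|rewrite IH; ring]. Qed.

Lemma sum_upto_scal (k : R) (f : nat -> R) (m : nat) :
  sum_upto (fun j => k * f j) m = k * sum_upto f m.
Proof. induction m as [|m IH]; simpl; [ring|rewrite IH; ring]. Qed.

Lemma sum_upto_zero (f : nat -> R) (m : nat) :
  (forall j, (1 <= j <= m)%nat -> f j = 0) -> sum_upto f m = 0.
Proof.
  intros H. rewrite (sum_upto_ext f (fun _ => 0 * 0)) by (intros; rewrite H; [ring|lia]).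
  rewrite (sum_upto_scal 0 (fun _ => 0)). ring.
Qed.

Lemma sum_upto_nonneg (f : nat -> R) (m : nat) :
  (forall j, (1 <= j <= m)%nat -> 0 <= f j) -> 0 <= sum_upto f m.
Proof. intros H. rewrite <- (sum_upto_zero (fun _ => 0) m); [apply sum_upto_le; exact H|auto]. Qed.

Lemma sum_upto_single (A : R) (j m : nat) : (1 <= j <= m)%nat ->
  sum_upto (fun i => if Nat.eqb i j then A else 0) m = A.
Proof.
  induction m as [|m IH]; intros H; [lia|]. rewrite sum_upto_S.
  destruct (Nat.eq_dec j (S m)) as [->|Hne].
  - rewrite Nat.eqb_refl, sum_upto_zero; [ring|]. intros i Hi.
    destruct (Nat.eqb_spec i (S m)); [lia|reflexivity].
  - rewrite IH by lia. destruct (Nat.eqb_spec (S m) j); [lia|ring].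
Qed.

Lemma sum_upto_term_le (f : nat -> R) (j m : nat) : (1 <= j <= m)%nat ->
  (forall i, (1 <= i <= m)%nat -> 0 <= f i) -> f j <= sum_upto f m.
Proof.
  intros Hj Hf. rewrite <- (sum_upto_single (f j) j m Hj). apply sum_upto_le.
  intros i Hi. destruct (Nat.eqb_spec i j) as [->|_]; [lra|apply Hf, Hi].
Qed.

Lemma is_derive_sum_upto (f : R -> nat -> R) (df : nat -> R) (t : R) (m : nat) :
  (forall j, (1 <= j <= m)%nat -> is_derive (fun s => f s j) t (df j)) ->
  is_derive (fun s => sum_upto (f s) m) t (sum_upto df m).
Proof.
  induction m as [|m IH]; intros H; simpl; [apply (is_derive_const 0)|].
  apply is_derive_Rplus; [apply IH; intros; apply H; lia|apply H; lia].
Qed.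

Lemma xi_1 (alpha : nat -> nat) (x : nat -> R) : xi alpha x 1 = 1.
Proof. reflexivity. Qed.

Lemma xi_succ (alpha : nat -> nat) (x : nat -> R) (j : nat) : (1 <= j)%nat ->
  xi alpha x (S j) = xi alpha x j * x j ^ alpha j.
Proof.
  intros Hj. destruct j as [|j]; [lia|]. unfold xi. simpl. now rewrite Nat.sub_0_r.
Qed.

Lemma xi_ext (alpha beta : nat -> nat) (x y : nat -> R) (j : nat) :
  (forall i, (1 <= i < j)%nat -> x i = y i /\ alpha i = beta i) -> xi alpha x j = xi beta y j.
Proof.
  induction j as [|j IH]; intros H; [reflexivity|].
  destruct j as [|j]; [reflexivity|]. rewrite (xi_succ alpha x (S j)), (xi_succ beta y (S j)) by lia.
  rewrite IH by (intros; apply H; lia). destruct (H (S j)) as [-> ->]; [lia|reflexivity].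
Qed.

(** Triangularity as a factorization: z has entries 1 up to j, so [xi alpha z k] retains only the
    factors of index between j+1 and k-1. *)
Lemma xi_split (alpha : nat -> nat) (y z : nat -> R) (j k : nat) : (j < k)%nat ->
  (forall i, (i <= j)%nat -> z i = 1) -> (forall i, (j < i < k)%nat -> y i = z i) ->
  xi alpha y k = xi alpha y (S j) * xi alpha z k.
Proof.
  intros Hk Hz. induction Hk as [|k Hk IH]; intros Hy.
  - rewrite (xi_ext alpha alpha z (fun _ => 1)) by (intros; split; [apply Hz; lia|reflexivity]).
    replace (xi alpha (fun _ => 1) (S j)) with 1; [ring|].
    clear. unfold xi. induction (S j - 1)%nat as [|m IH]; simpl; [reflexivity|].
    rewrite <- IH, pow1. ring.
  - rewrite !(xi_succ alpha _ k) by lia. rewrite IH by (intros; apply Hy; lia).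
    rewrite Hy by lia. ring.
Qed.

Lemma continuous_pow (f : R -> R) (m : nat) (t : R) :
  continuous f t -> continuous (fun s => f s ^ m) t.
Proof.
  intros H. apply (continuous_comp f (fun y => y ^ m)); [exact H|].
  apply (ex_derive_continuous (fun y => y ^ m)). auto_derive. trivial.
Qed.

Lemma continuous_Rmult (f g : R -> R) (t : R) :
  continuous f t -> continuous g t -> continuous (fun s => f s * g s) t.
Proof. intros; apply (continuous_mult f g); assumption. Qed.

Lemma continuous_xi (alpha : nat -> nat) (x : R -> nat -> R) (j : nat) (t : R) :
  (forall i, (1 <= i < j)%nat -> continuous (fun s => x s i) t) ->
  continuous (fun s => xi alpha (x s) j) t.
Proof.
  induction j as [|j IH]; intros H; [apply (continuous_const 1)|].
  destruct j as [|j]; [apply (continuous_const 1)|].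
  apply (continuous_ext (fun s => xi alpha (x s) (S j) * x s (S j) ^ alpha (S j))).
  { intros s. rewrite (xi_succ alpha (x s) (S j)); [reflexivity|lia]. }
  apply continuous_Rmult; [apply IH; intros; apply H; lia|].
  apply continuous_pow, H. lia.
Qed.

Lemma pow_near (a eta : R) (m : nat) : 0 < eta -> exists d, 0 < d /\
  forall a', Rabs (a' - a) < d -> Rabs (a' ^ m - a ^ m) < eta.
Proof.
  intros He. apply (continuous_eps (fun y => y ^ m) a); [|exact He].
  apply (continuous_pow (fun y => y)). apply continuous_id.
Qed.

Lemma xi_near (alpha : nat -> nat) (x : nat -> R) (j : nat) (eta : R) : 0 < eta ->
  exists d, 0 < d /\ forall y, (forall i, (1 <= i < j)%nat -> Rabs (y i - x i) < d) ->
    Rabs (xi alpha y j - xi alpha x j) < eta.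
Proof.
  revert eta. induction j as [|j IH]; intros eta He.
  { exists 1. split; [lra|]. intros y _. unfold xi; simpl. rewrite Rminus_diag, Rabs_R0. exact He. }
  destruct j as [|j].
  { exists 1. split; [lra|]. intros y _. unfold xi; simpl. rewrite Rminus_diag, Rabs_R0. exact He. }
  destruct (continuity_2d_pt_mult (fun u _ => u) (fun _ v => v) (xi alpha x (S j))
    (x (S j) ^ alpha (S j)) (continuity_2d_pt_id1 _ _) (continuity_2d_pt_id2 _ _)
    (mkposreal eta He)) as [[d Hd] Hm]. simpl in Hm.
  destruct (IH d Hd) as [d1 [Hd1 H1]].
  destruct (pow_near (x (S j)) d (alpha (S j)) Hd) as [d2 [Hd2 H2]].
  exists (Rmin d1 d2). split; [apply Rmin_pos; assumption|].
  intros y Hy. rewrite !(xi_succ alpha _ (S j)) by lia. apply Hm.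
  - apply H1. intros i Hi. apply Rlt_le_trans with (2 := Rmin_l d1 d2). apply Hy. lia.
  - apply H2. apply Rlt_le_trans with (2 := Rmin_r d1 d2). apply Hy. lia.
Qed.

Lemma sqr_le_1_abs (h : R) : h ^ 2 <= 1 -> Rabs h <= 1.
Proof. intros H. apply Rabs_le. split; nra. Qed.

(** Induction on the coordinates: while the first m stay near x, the weight of index m+1 stays below
    M, and so does the speed of the next coordinate. The time T0 is uniform over all subunit curves
    from x. *)
Lemma subunit_stays_near (n : nat) (alpha : nat -> nat) (x : nat -> R) (m : nat) :
  (m <= S n)%nat -> forall rho, 0 < rho -> exists T0, 0 < T0 /\
  forall g T, 0 <= T <= T0 -> subunit n alpha g T ->
    (forall j, (1 <= j <= S n)%nat -> g 0 j = x j) ->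
    forall s, 0 <= s <= T -> forall j, (1 <= j <= m)%nat -> Rabs (g s j - x j) < rho.
Proof.
  induction m as [|m IH]; intros Hm rho Hrho.
  { exists 1. split; [lra|]. intros; lia. }
  destruct (xi_near alpha x (S m) 1 ltac:(lra)) as [d [Hd Hxi]].
  destruct (IH ltac:(lia) (Rmin rho d) ltac:(apply Rmin_pos; assumption)) as [T1 [HT1 H1]].
  set (M := Rabs (xi alpha x (S m)) + 1).
  assert (HM : 0 < M) by (unfold M; pose proof (Rabs_pos (xi alpha x (S m))); lra).
  exists (Rmin T1 (rho / (2 * M))).
  split; [apply Rmin_pos; [assumption|apply Rdiv_lt_0_compat; lra]|].
  intros g T HT Hg Hg0 s Hs j Hj.
  assert (HT1' : 0 <= T <= T1) by (pose proof (Rmin_l T1 (rho / (2 * M))); lra).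
  assert (Hnear := H1 g T HT1' Hg Hg0).
  destruct (Nat.eq_dec j (S m)) as [->|Hne].
  2: { apply Rlt_le_trans with (2 := Rmin_l rho d). apply Hnear; [exact Hs|lia]. }
  destruct Hg as [[L HL] [N [HN Hder]]].
  rewrite <- (Hg0 (S m)) by lia.
  apply Rle_lt_trans with (M * (s - 0)).
  - apply (ae_derive_increment_abs (fun u => g u (S m)) L M 0 s N); [lra| |exact HN|].
    + intros u v Hu Hv. apply HL; try lra. lia.
    + intros u Hu Hnu. destruct (Hder u ltac:(lra) Hnu) as [h [Hh Hdh]].
      exists (h (S m) * xi alpha (g u) (S m)). split; [apply Hdh; lia|].
      rewrite Rabs_mult.
      assert (Rabs (h (S m)) <= 1).
      { apply sqr_le_1_abs. apply Rle_trans with (2 := Hh).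
        apply (sum_upto_term_le (fun j => h j ^ 2)); [lia|]. intros; apply pow2_ge_0. }
      assert (Rabs (xi alpha (g u) (S m)) <= M).
      { assert (Rabs (xi alpha (g u) (S m) - xi alpha x (S m)) < 1).
        { apply Hxi. intros i Hi. apply Rlt_le_trans with (2 := Rmin_r rho d).
          apply Hnear; [lra|lia]. }
        replace (xi alpha (g u) (S m))
          with (xi alpha (g u) (S m) - xi alpha x (S m) + xi alpha x (S m)) by ring.
        eapply Rle_trans; [apply Rabs_triang|]. unfold M; lra. }
      pose proof (Rabs_pos (h (S m))). pose proof (Rabs_pos (xi alpha (g u) (S m))). nra.
  - pose proof (Rmin_r T1 (rho / (2 * M))).
    apply Rle_lt_trans with (M * (rho / (2 * M))).
    + apply Rmult_le_compat_l; lra.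
    + replace (M * (rho / (2 * M))) with (rho / 2) by (field; lra). lra.
Qed.

(** The sum is the squared horizontal norm, at the point y, of the linear functional with
    coefficients q; near x it is almost constant. *)
Lemma weighted_speed_near (alpha : nat -> nat) (q x : nat -> R) (m : nat) (eta : R) : 0 < eta ->
  exists d, 0 < d /\ forall y, (forall i, (1 <= i <= m)%nat -> Rabs (y i - x i) < d) ->
    Rabs (sum_upto (fun j => (q j * xi alpha y j) ^ 2) m
          - sum_upto (fun j => (q j * xi alpha x j) ^ 2) m) < eta.
Proof.
  revert eta. induction m as [|m IH]; intros eta He.
  { exists 1. split; [lra|]. intros y _. simpl. rewrite Rminus_diag, Rabs_R0. exact He. }
  destruct (IH (eta / 2) ltac:(lra)) as [d1 [Hd1 H1]].
  destruct (proj1 (continuous_eps (fun u => (q (S m) * u) ^ 2) (xi alpha x (S m))))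
    with (eps := eta / 2) as [e [He0 He1]].
  { apply (ex_derive_continuous (fun u => (q (S m) * u) ^ 2)). auto_derive. trivial. }
  { lra. }
  destruct (xi_near alpha x (S m) e He0) as [d2 [Hd2 H2]].
  exists (Rmin d1 d2). split; [apply Rmin_pos; assumption|]. intros y Hy. rewrite !sum_upto_S.
  assert (A1 : Rabs (sum_upto (fun j => (q j * xi alpha y j) ^ 2) m
          - sum_upto (fun j => (q j * xi alpha x j) ^ 2) m) < eta / 2).
  { apply H1. intros i Hi. apply Rlt_le_trans with (2 := Rmin_l d1 d2). apply Hy. lia. }
  assert (A2 := He1 (xi alpha y (S m))).
  assert (A3 : Rabs ((q (S m) * xi alpha y (S m)) ^ 2 - (q (S m) * xi alpha x (S m)) ^ 2) < eta / 2).
  { apply A2, H2. intros i Hi. apply Rlt_le_trans with (2 := Rmin_r d1 d2). apply Hy. lia. }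
  apply Rabs_def2 in A1. apply Rabs_def2 in A3. apply Rabs_def1; lra.
Qed.

Lemma lipschitz_sum_upto (q : nat -> R) (g : R -> nat -> R) (L a b : R) (m : nat) :
  (forall s t j, a <= s <= b -> a <= t <= b -> (1 <= j <= m)%nat ->
     Rabs (g s j - g t j) <= L * Rabs (s - t)) ->
  exists K, forall s t, a <= s <= b -> a <= t <= b ->
     Rabs (sum_upto (fun j => q j * g s j) m - sum_upto (fun j => q j * g t j) m)
       <= K * Rabs (s - t).
Proof.
  induction m as [|m IH]; intros H.
  { exists 0. intros s t _ _. simpl. rewrite Rminus_diag, Rabs_R0. lra. }
  destruct IH as [K HK]; [intros; apply H; try assumption; lia|].
  exists (K + Rabs (q (S m)) * L). intros s t Hs Ht. rewrite !sum_upto_S.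
  specialize (HK s t Hs Ht). specialize (H s t (S m) Hs Ht ltac:(lia)).
  match goal with |- Rabs (?A + ?B - (?C + ?D)) <= _ =>
    replace (A + B - (C + D)) with (A - C + q (S m) * (g s (S m) - g t (S m))) by ring end.
  eapply Rle_trans; [apply Rabs_triang|]. rewrite Rabs_mult.
  pose proof (Rabs_pos (q (S m))). nra.
Qed.

(* Test the distance against the linear functional whose gradient is h_j / xi_j. *)
Lemma metric_speed_le_1 (n : nat) (alpha : nat -> nat) (x : R -> nat -> R) (h : nat -> R)
  (t d : R) : 0 < d ->
  (forall s, t <= s < t + d -> ccdist n alpha (x t) (x s) = Finite (s - t)) ->
  (forall j, (1 <= j <= S n)%nat -> is_derive (fun s => x s j) t (h j * xi alpha (x t) j)) ->
  (forall j, (1 <= j <= S n)%nat -> xi alpha (x t) j = 0 -> h j = 0) ->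
  sum_upto (fun j => h j ^ 2) (S n) <= 1.
Proof.
  intros Hd Hdist Hder Hzero. apply Rnot_lt_le. intros HQ.
  set (Q := sum_upto (fun j => h j ^ 2) (S n)) in *.
  (* Where the weight vanishes, h vanishes as well by hypothesis, so q times the weight is h in all
     cases. *)
  set (q := fun j => h j / xi alpha (x t) j).
  assert (Hq : forall j, (1 <= j <= S n)%nat -> q j * xi alpha (x t) j = h j).
  { intros j Hj. unfold q. destruct (Req_dec (xi alpha (x t) j) 0) as [E|E].
    - rewrite (Hzero j Hj E). unfold Rdiv. ring.
    - field. exact E. }
  set (psi := fun y : nat -> R => sum_upto (fun j => q j * y j) (S n)).
  (* Small enough that Q - eta > (Q + eta + 1) / 2 (1 + eta). Comparing the growth of [psi] along x
     and along a nearly shortest curve yields the opposite inequality. *)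
  set (eta := (Q - 1) / (2 * (Q + 6))).
  assert (Heta : 0 < eta) by (apply Rdiv_lt_0_compat; lra).
  assert (Eeta : eta * (2 * (Q + 6)) = Q - 1) by (unfold eta; field; lra).
  assert (Dpsi : is_derive (fun s => psi (x s)) t Q).
  { unfold psi. eapply is_derive_value.
    - apply (is_derive_sum_upto (fun s j => q j * x s j)). intros j Hj.
      apply is_derive_Rscal, Hder, Hj.
    - apply sum_upto_ext. intros j Hj. rewrite <- (Hq j Hj). ring. }
  destruct (proj1 (is_derive_eps _ _ _) Dpsi eta Heta) as [d1 [Hd1 H1]].
  destruct (weighted_speed_near alpha q (x t) (S n) eta Heta) as [rho [Hrho Hnear]].
  destruct (subunit_stays_near n alpha (x t) (S n) (le_n _) rho Hrho) as [T0 [HT0 Hstay]].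
  (* The factor 2 + eta leaves room both for de and for the duration T < de (1 + eta) of a nearly
     shortest curve. *)
  set (de := Rmin (Rmin d d1) T0 / (2 + eta)).
  assert (Hm : 0 < Rmin (Rmin d d1) T0) by (repeat apply Rmin_pos; assumption).
  assert (Hde : 0 < de) by (apply Rdiv_lt_0_compat; lra).
  assert (Ede : de * (2 + eta) = Rmin (Rmin d d1) T0) by (unfold de; field; lra).
  assert (Hmd : Rmin (Rmin d d1) T0 <= d /\ Rmin (Rmin d d1) T0 <= d1 /\ Rmin (Rmin d d1) T0 <= T0).
  { unfold Rmin. repeat destruct Rle_dec; lra. }
  assert (HT : exists T, T < de * (1 + eta) /\ 0 <= T /\ exists g, subunit n alpha g T /\
     forall j, (1 <= j <= S n)%nat -> g 0 j = x t j /\ g T j = x (t + de) j).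
  { apply NNPP. intros HN.
    assert (HD := Hdist (t + de) ltac:(nra)). unfold ccdist in HD.
    match type of HD with Glb_Rbar ?E = _ => destruct (Glb_Rbar_correct E) as [_ Hglb] end.
    assert (HL := Hglb (Finite (de * (1 + eta)))). rewrite HD in HL. simpl in HL.
    assert (de * (1 + eta) <= t + de - t); [|nra]. apply HL.
    intros T [HT [g Hg]]. simpl. apply Rnot_lt_le. intros hlt. apply HN.
    exists T. split; [exact hlt|split; [exact HT|]]. exists g. exact Hg. }
  destruct HT as [T [HTlt [HT [g [Hsub Hends]]]]].
  assert (HTT0 : 0 <= T <= T0) by nra.
  assert (Hnear' := Hstay g T HTT0 Hsub (fun j Hj => proj1 (Hends j Hj))).
  destruct Hsub as [[L HL] [N [HN Hg]]].
  assert (Hup : psi (g T) - psi (g 0) <= (Q + eta + 1) / 2 * (T - 0)).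
  { destruct (lipschitz_sum_upto q g L 0 T (S n)) as [K HK].
    { intros s u j Hs Hu Hj. apply HL; assumption. }
    apply (ae_derive_increment (fun s => psi (g s)) K _ 0 T N HT HK HN).
    intros s Hs Hns. destruct (Hg s Hs Hns) as [v [Hv Hdv]].
    exists (sum_upto (fun j => q j * (v j * xi alpha (g s) j)) (S n)). split.
    - apply (is_derive_sum_upto (fun s j => q j * g s j)). intros j Hj.
      apply is_derive_Rscal, Hdv, Hj.
    - assert (W := Hnear (g s) (fun i Hi => Hnear' s (conj (Rlt_le _ _ (proj1 Hs)) (Rlt_le _ _ (proj2 Hs))) i Hi)).
      rewrite (sum_upto_ext (fun j => (q j * xi alpha (x t) j) ^ 2) (fun j => h j ^ 2)) in W.
      2: { intros j Hj. rewrite Hq by exact Hj. reflexivity. }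
      fold Q in W. apply Rabs_def2 in W.
      (* The derivative of [psi] is split into half the squared norm of [psi], at most (Q + eta) /
         2, and half the squared control, at most 1 / 2. *)
      apply Rle_trans with (sum_upto (fun j => / 2 * ((q j * xi alpha (g s) j) ^ 2 + v j ^ 2)) (S n)).
      + apply sum_upto_le. intros j _. pose proof (pow2_ge_0 (q j * xi alpha (g s) j - v j)). nra.
      + rewrite sum_upto_scal, sum_upto_plus. lra. }
  assert (Eends : psi (g T) - psi (g 0) = psi (x (t + de)) - psi (x t)).
  { unfold psi. f_equal; apply sum_upto_ext; intros j Hj;
    destruct (Hends j Hj) as [E0 E1]; rewrite ?E0, ?E1; reflexivity. }
  assert (Hlow := H1 (t + de)). rewrite Rplus_minus_l, (Rabs_right de) in Hlow by lra.
  specialize (Hlow ltac:(nra)). apply Rabs_le_between in Hlow.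
  assert (HTb : (Q + eta + 1) / 2 * (T - 0) <= (Q + eta + 1) / 2 * (de * (1 + eta))).
  { apply Rmult_le_compat_l; lra. }
  assert (Heta1 : eta < 1) by nra.
  assert (Q - eta <= (Q + eta + 1) / 2 * (1 + eta)).
  { apply Rmult_le_reg_r with de; [exact Hde|]. nra. }
  nra.
Qed.

(** Run at the inverse of [tau], the curve y has control of norm at most 1 and takes time
    [tau b - tau a]. The lower slope c makes the inverse Lipschitz, the upper slope C carries null
    sets to null sets. *)
Lemma ccdist_le_reparam (n : nat) (alpha : nat -> nat) (y : R -> nat -> R) (tau : R -> R)
  (a b c C L : R) (N : R -> Prop) : a <= b -> 0 < c ->
  (forall s t, s <= t -> c * (t - s) <= tau t - tau s <= C * (t - s)) ->
  (forall s t j, a <= s <= b -> a <= t <= b -> (1 <= j <= S n)%nat ->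
     Rabs (y s j - y t j) <= L * Rabs (s - t)) ->
  null_set N ->
  (forall t, a < t < b -> ~ N t -> exists v l, 0 < l /\ is_derive tau t l /\
     sum_upto (fun j => v j ^ 2) (S n) <= l ^ 2 /\
     forall j, (1 <= j <= S n)%nat -> is_derive (fun s => y s j) t (v j * xi alpha (y t) j)) ->
  Rbar_le (ccdist n alpha (y a) (y b)) (tau b - tau a).
Proof.
  intros Hab Hc Htau HL HN Hder.
  assert (Habs : forall s t, c * Rabs (t - s) <= Rabs (tau t - tau s) <= C * Rabs (t - s)).
  { intros s t. destruct (Rle_dec s t) as [h|h].
    - pose proof (Htau s t h). assert (0 <= c * (t - s)) by (apply Rmult_le_pos; lra).
      rewrite !Rabs_right by lra. assumption.
    - pose proof (Htau t s ltac:(lra)). assert (0 <= c * (s - t)) by (apply Rmult_le_pos; lra).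
      rewrite !Rabs_left1 by lra. lra. }
  assert (Ctau : forall t, continuous tau t).
  { intros t. apply (lipschitz_continuous tau C). intros s. apply Habs. }
  assert (Hsurj : forall u, exists t, tau t = u).
  { intros u. set (K := Rabs (u - tau 0) / c).
    assert (HK : 0 <= K) by (apply Rle_mult_inv_pos; [apply Rabs_pos|exact Hc]).
    assert (EK : c * K = Rabs (u - tau 0)) by (unfold K; field; lra).
    destruct (IVT_gen_consistent tau (- K) K u Ctau) as [t [_ Et]].
    - pose proof (Htau (- K) 0 ltac:(lra)). pose proof (Htau 0 K HK).
      pose proof (Rle_abs (u - tau 0)). pose proof (Rle_abs (- (u - tau 0))).
      rewrite Rabs_Ropp in H2.
      rewrite Rmin_left, Rmax_right by nra. lra.
    - exists t. exact Et. }
  set (th := fun u => epsilon (inhabits 0) (fun t => tau t = u)).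
  assert (Hth : forall u, tau (th u) = u).
  { intros u. apply (epsilon_spec (inhabits 0) (fun t => tau t = u)), Hsurj. }
  assert (Hinj : forall t, th (tau t) = t).
  { intros t. destruct (Habs (th (tau t)) t) as [H1 _]. rewrite Hth, Rminus_diag, Rabs_R0 in H1.
    destruct (Req_dec t (th (tau t))) as [E|E]; [now symmetry|].
    assert (0 < Rabs (t - th (tau t))) by (apply Rabs_pos_lt; lra). nra. }
  assert (Lth : forall u v, Rabs (th u - th v) <= / c * Rabs (u - v)).
  { intros u v. destruct (Habs (th v) (th u)) as [H1 _]. rewrite !Hth in H1.
    apply Rmult_le_reg_l with c; [exact Hc|]. rewrite <- Rmult_assoc, Rinv_r, Rmult_1_l by lra.
    exact H1. }
  assert (Hmono : forall s t, s < t -> tau s < tau t).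
  { intros s t Hst. pose proof (Htau s t ltac:(lra)). nra. }
  assert (Hrange : forall u, 0 <= u <= tau b - tau a -> a <= th (u + tau a) <= b).
  { intros u Hu. split; apply Rnot_lt_le; intros h; apply Hmono in h; rewrite Hth in h; lra. }
  unfold ccdist.
  match goal with |- Rbar_le (Glb_Rbar ?E) _ => destruct (Glb_Rbar_correct E) as [Hlb _] end.
  apply Hlb. clear Hlb.
  assert (HT : 0 <= tau b - tau a) by (pose proof (Htau a b Hab); nra).
  split; [exact HT|]. exists (fun u => y (th (u + tau a))). split.
  2: { intros j _. rewrite Rplus_0_l, Hinj. replace (tau b - tau a + tau a) with (tau b) by ring.
       rewrite Hinj. split; reflexivity. }
  split.
  - exists (Rabs L * / c). intros s t Hs Ht j Hj.
    eapply Rle_trans; [apply HL; [apply Hrange, Hs|apply Hrange, Ht|exact Hj]|].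
    assert (H1 := Lth (s + tau a) (t + tau a)).
    replace (s + tau a - (t + tau a)) with (s - t) in H1 by ring.
    rewrite Rmult_assoc.
    apply Rle_trans with (Rabs L * Rabs (th (s + tau a) - th (t + tau a))).
    + apply Rmult_le_compat_r; [apply Rabs_pos|apply Rle_abs].
    + apply Rmult_le_compat_l; [apply Rabs_pos|exact H1].
  - exists (fun u => N (th (u + tau a))). split.
    (* [tau] sends a cover of N to a cover of its image, with lengths multiplied by at most C1. *)
    + intros eps He. set (C1 := Rabs C + 1).
      assert (HC1 : 0 < C1) by (unfold C1; pose proof (Rabs_pos C); lra).
      destruct (HN (eps / C1) ltac:(apply Rdiv_lt_0_compat; assumption)) as [p [q [H1 [H2 H3]]]].
      exists (fun k => tau (p k) - tau a), (fun k => tau (q k) - tau a). split; [|split].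
      * intros k. pose proof (Htau _ _ (H1 k)). specialize (H1 k). nra.
      * intros u Hu. destruct (H2 _ Hu) as [k [Hk1 Hk2]]. exists k.
        apply Hmono in Hk1. apply Hmono in Hk2. rewrite Hth in Hk1, Hk2. lra.
      * intros m. apply Rle_trans with (sum_f_R0 (fun k => C1 * (q k - p k)) m).
        -- apply sum_Rle. intros k _. pose proof (proj2 (Htau _ _ (H1 k))). specialize (H1 k).
           assert (C * (q k - p k) <= C1 * (q k - p k)); [|lra].
           apply Rmult_le_compat_r; [lra|]. unfold C1. pose proof (Rle_abs C). lra.
        -- rewrite (sum_eq _ (fun k => (q k - p k) * C1)) by (intros; ring).
           rewrite <- scal_sum. replace eps with (C1 * (eps / C1)) by (field; lra).
           apply Rmult_le_compat_l; [lra|apply H3].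
    + intros u Hu Hnu.
      assert (Hint : a < th (u + tau a) < b).
      { split; apply Rnot_le_lt; intros h.
        - destruct h as [h|h]; [apply Hmono in h; rewrite Hth in h; lra|].
          assert (E : tau (th (u + tau a)) = u + tau a) by apply Hth. rewrite h in E. lra.
        - destruct h as [h|h]; [apply Hmono in h; rewrite Hth in h; lra|].
          assert (E : tau (th (u + tau a)) = u + tau a) by apply Hth. rewrite <- h in E. lra. }
      destruct (Hder _ Hint Hnu) as [v [l [Hl [Dt [Hv Dy]]]]].
      exists (fun j => / l * v j). split.
      * rewrite (sum_upto_ext _ (fun j => (/ l) ^ 2 * v j ^ 2)) by (intros; ring).
        rewrite sum_upto_scal. apply Rmult_le_reg_l with (l ^ 2); [nra|].
        replace (l ^ 2 * ((/ l) ^ 2 * sum_upto (fun j => v j ^ 2) (S n)))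
          with (sum_upto (fun j => v j ^ 2) (S n)) by (field; lra). lra.
      * intros j Hj. eapply is_derive_value.
        -- apply (is_derive_Rcomp (fun s => y s j) (fun u => th (u + tau a)) u).
           ++ apply Dy, Hj.
           ++ apply (is_derive_Rcomp th (fun u => u + tau a) u (/ l) 1).
              ** apply (is_derive_inverse tau); [exact Dt|lra| |].
                 --- apply (lipschitz_continuous th (/ c)). intros w. apply Lth.
                 --- apply filter_forall. exact Hth.
              ** auto_derive; [trivial|reflexivity].
        -- simpl. ring.
Qed.

(** * Minimizing pieces *)


Lemma ex_RInt_global (f : R -> R) (a b : R) : (forall t, continuous f t) -> ex_RInt f a b.
Proof. intros H. apply (ex_RInt_continuous (V := RC)). auto. Qed.

Lemma RInt_Rext (f g : R -> R) (a b : R) :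
  (forall t, Rmin a b < t < Rmax a b -> f t = g t) -> RInt f a b = RInt g a b.
Proof. apply RInt_ext. Qed.

Lemma is_derive_primitive (f : R -> R) (a t : R) : (forall s, continuous f s) ->
  is_derive (fun u => RInt f a u) t (f t).
Proof.
  intros H. apply (is_derive_RInt f (fun u => RInt f a u) a t); [|apply H].
  apply filter_forall. intros u. apply (RInt_correct (V := RC)).
  apply ex_RInt_global, H.
Qed.

Lemma primitive_start (f : R -> R) (a : R) : RInt f a a = 0.
Proof. apply (RInt_point (V := RC)). Qed.

Lemma continuous_primitive (f : R -> R) (a t : R) : (forall s, continuous f s) ->
  continuous (fun u => RInt f a u) t.
Proof. intros H. eapply is_derive_continuous, is_derive_primitive, H. Qed.

Lemma RInt_of_derive (F f : R -> R) (a b t : R) : (forall s, continuous f s) ->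
  (forall s, a < s < b -> is_derive F s (f s)) ->
  (forall s, a <= s <= b -> continuous F s) -> a <= t <= b ->
  RInt f a t = F t - F a.
Proof.
  intros Hf HF CF Ht.
  assert (E : RInt f a t - F t = RInt f a a - F a).
  { apply (derive_zero_const (fun u => RInt f a u - F u) a b); try lra.
    - intros u Hu. eapply is_derive_value.
      + apply is_derive_Rminus; [apply is_derive_primitive, Hf|apply HF, Hu].
      + ring.
    - intros u Hu. apply (continuous_minus (fun u => RInt f a u) F).
      + apply continuous_primitive, Hf.
      + apply CF, Hu. }
  rewrite primitive_start in E. lra.
Qed.

Lemma RInt_of_derive_except (F f : R -> R) (a b p : R) : a <= p <= b ->
  (forall s, continuous f s) ->
  (forall s, a < s < b -> s <> p -> is_derive F s (f s)) ->
  (forall s, a <= s <= b -> continuous F s) ->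
  RInt f a b = F b - F a.
Proof.
  intros Hp Hf HF CF.
  assert (H1 : RInt f a p = F p - F a).
  { apply (RInt_of_derive F f a p); try lra; [exact Hf| |]; intros; (apply HF || apply CF); lra. }
  assert (H2 : RInt f p b = F b - F p).
  { apply (RInt_of_derive F f p b); try lra; [exact Hf| |]; intros; (apply HF || apply CF); lra. }
  rewrite <- (RInt_Chasles (V := RC) f a p b) by apply ex_RInt_global, Hf.
  unfold plus; simpl. rewrite H1, H2. ring.
Qed.

Lemma primitive_le (f : R -> R) (a s t : R) : (forall u, continuous f u) ->
  (forall u, 0 <= f u) -> s <= t -> RInt f a s <= RInt f a t.
Proof.
  intros Hf H0 [Hst|<-]; [|lra].
  destruct (mvt_closed (fun u => RInt f a u) f s t Hst) as [c [_ E]].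
  - intros u _. apply is_derive_primitive, Hf.
  - pose proof (H0 c). nra.
Qed.

Lemma primitive_pos (f : R -> R) (a b : R) : (forall u, continuous f u) ->
  (forall u, 0 <= f u) -> a < b -> 0 < f a -> 0 < RInt f a b.
Proof.
  intros Hf H0 Hab Hp.
  destruct (proj1 (continuous_eps f a) (Hf a) (f a) Hp) as [d [Hd Hc]].
  set (v := Rmin b (a + d)).
  assert (Hv : a < v <= b /\ v <= a + d).
  { unfold v. split; [split; [apply Rmin_glb_lt; lra|apply Rmin_l]|apply Rmin_r]. }
  destruct (mvt_closed (fun t => RInt f a t) f a v (proj1 (proj1 Hv))) as [c [Hc' E]].
  - intros w _. apply is_derive_primitive, Hf.
  - pose proof (primitive_le f a v b Hf H0 (proj2 (proj1 Hv))).
    cbv beta in E. rewrite primitive_start in E.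
    specialize (Hc c ltac:(rewrite Rabs_right; lra)). apply Rabs_def2 in Hc. nra.
Qed.

Lemma continuous_bounded (f : R -> R) (a b : R) : a <= b -> (forall t, a <= t <= b -> continuous f t) ->
  exists B, 0 <= B /\ forall t, a <= t <= b -> Rabs (f t) <= B.
Proof.
  intros Hab Hf.
  destruct (continuity_ab_maj (fun t => Rabs (f t)) a b Hab) as [m [Hm _]].
  - intros t Ht. apply continuity_pt_filterlim.
    apply (continuous_comp f Rabs); [apply Hf, Ht|]. apply continuity_pt_filterlim, Rcontinuity_abs.
  - exists (Rabs (f m)). split; [apply Rabs_pos|exact Hm].
Qed.

Lemma derive_bounded_lipschitz (f df : R -> R) (a b B : R) :
  (forall t, a <= t <= b -> is_derive f t (df t)) ->
  (forall t, a <= t <= b -> Rabs (df t) <= B) ->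
  forall s t, a <= s <= b -> a <= t <= b -> Rabs (f s - f t) <= B * Rabs (s - t).
Proof.
  intros Hf HB.
  assert (H : forall s t, a <= s -> s < t -> t <= b -> Rabs (f t - f s) <= B * Rabs (t - s)).
  { intros s t Hs Hst Ht.
    destruct (mvt_closed f df s t Hst) as [c [Hc E]].
    - intros u Hu. apply Hf; lra.
    - rewrite E, Rabs_mult. apply Rmult_le_compat_r; [apply Rabs_pos|apply HB; lra]. }
  intros s t Hs Ht. destruct (Rtotal_order s t) as [h|[->|h]].
  - rewrite Rabs_minus_sym, (Rabs_minus_sym s t). apply H; lra.
  - rewrite !Rminus_diag, Rabs_R0. lra.
  - apply H; lra.
Qed.

Lemma primitive_lipschitz (f : R -> R) (a B : R) : (forall u, continuous f u) ->
  (forall u, Rabs (f u) <= B) ->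
  forall s t, Rabs (RInt f a s - RInt f a t) <= B * Rabs (s - t).
Proof.
  intros Hf HB s t.
  apply (derive_bounded_lipschitz (fun u => RInt f a u) f (Rmin s t) (Rmax s t)).
  - intros u _. apply is_derive_primitive, Hf.
  - intros u _. apply HB.
  - split; [apply Rmin_l|apply Rmax_l].
  - split; [apply Rmin_r|apply Rmax_r].
Qed.

Lemma uniform_constant (P : nat -> R -> Prop) (m : nat) :
  (forall j L L', P j L -> L <= L' -> P j L') ->
  (forall j, (1 <= j <= m)%nat -> exists L, P j L) ->
  exists L, forall j, (1 <= j <= m)%nat -> P j L.
Proof.
  intros HP. induction m as [|m IH]; intros H; [exists 0; intros; lia|].
  destruct IH as [L HL]; [intros; apply H; lia|]. destruct (H (S m)) as [L' HL']; [lia|].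
  exists (Rmax L L'). intros j Hj. destruct (Nat.eq_dec j (S m)) as [->|Hne].
  - apply HP with L'; [exact HL'|apply Rmax_r].
  - apply HP with L; [apply HL; lia|apply Rmax_l].
Qed.

Lemma ccdist_coords_ext (n : nat) (alpha : nat -> nat) (x y x' y' : nat -> R) :
  (forall j, (1 <= j <= S n)%nat -> x j = x' j /\ y j = y' j) ->
  ccdist n alpha x y = ccdist n alpha x' y'.
Proof.
  intros H. apply Glb_Rbar_eqset. intros T.
  split; intros [HT [g [Hg He]]]; (split; [exact HT|]); exists g; (split; [exact Hg|]);
    intros j Hj; destruct (H j Hj) as [E1 E2]; destruct (He j Hj); split; congruence.
Qed.

Definition clock (alpha : nat -> nat) (x : R -> nat -> R) (a : R) (j : nat) (t : R) : R :=
  RInt (fun s => xi alpha (x s) j ^ 2) a t.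

(** The Lipschitz and weight bounds hold at all times, so that clocks and integrals on the line are
    free of side conditions. [piece_regular] reaches index n+2 because the clock of index j+1 has to
    be positive for j = n+1 too. *)
Record piece (n : nat) (alpha : nat -> nat) (x : R -> nat -> R) (a b L B : R) (N : R -> Prop)
  : Prop := {
  piece_lt : a < b;
  piece_lip : forall s t j, (1 <= j <= S n)%nat -> Rabs (x s j - x t j) <= L * Rabs (s - t);
  piece_bound : forall t j, (1 <= j <= S (S n))%nat -> Rabs (xi alpha (x t) j) <= B;
  piece_null : null_set N;
  piece_speed : forall t, a < t < b -> ~ N t -> exists h : nat -> R,
    sum_upto (fun j => h j ^ 2) (S n) <= 1 /\
    forall j, (1 <= j <= S n)%nat -> is_derive (fun s => x s j) t (h j * xi alpha (x t) j);
  piece_min : ccdist n alpha (x a) (x b) = Finite (b - a);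
  piece_regular : forall j, (1 <= j <= S (S n))%nat -> xi alpha (x a) j <> 0 }.

Arguments piece_lt {n alpha x a b L B N}.
Arguments piece_lip {n alpha x a b L B N}.
Arguments piece_bound {n alpha x a b L B N}.
Arguments piece_null {n alpha x a b L B N}.
Arguments piece_speed {n alpha x a b L B N}.
Arguments piece_min {n alpha x a b L B N}.
Arguments piece_regular {n alpha x a b L B N}.

(* The coordinates above j follow a fixed curve X run with the clock of xi_{j+1};
   V is its control in the structure generated by those coordinates only. *)
Record tail (n : nat) (alpha : nat -> nat) (x : R -> nat -> R) (a b : R) (j : nat)
  (X V : R -> nat -> R) (r : R) : Prop := {
  tail_one : forall s i, (i <= j)%nat -> X s i = 1;
  tail_V0 : forall s k, (k <= j)%nat -> V s k = 0;
  tail_der : forall s k, (j < k <= S n)%nat ->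
    is_derive (fun u => X u k) s (xi alpha (X s) k * V s k);
  tail_sum : forall s, sum_upto (fun k => V s k ^ 2) (S n) = r;
  tail_zero : forall s k, xi alpha (X s) k = 0 -> V s k = 0;
  tail_rep : forall t k, a <= t <= b -> (j < k <= S n)%nat ->
    x t k = X (clock alpha x a (S j) t) k }.

Arguments tail_one {n alpha x a b j X V r}.
Arguments tail_V0 {n alpha x a b j X V r}.
Arguments tail_der {n alpha x a b j X V r}.
Arguments tail_sum {n alpha x a b j X V r}.
Arguments tail_zero {n alpha x a b j X V r}.
Arguments tail_rep {n alpha x a b j X V r}.

Lemma piece_continuous n alpha x a b L B N : piece n alpha x a b L B N ->
  forall j, (1 <= j <= S n)%nat -> forall t, continuous (fun s => x s j) t.
Proof.
  intros H j Hj t. apply (lipschitz_continuous _ L). intros s. apply (piece_lip H), Hj.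
Qed.

Lemma piece_xi_continuous n alpha x a b L B N : piece n alpha x a b L B N ->
  forall j, (1 <= j <= S (S n))%nat -> forall t, continuous (fun s => xi alpha (x s) j) t.
Proof.
  intros H j Hj t. apply continuous_xi. intros i Hi.
  eapply piece_continuous; [exact H|lia].
Qed.

Lemma piece_xi2_continuous n alpha x a b L B N : piece n alpha x a b L B N ->
  forall j, (1 <= j <= S (S n))%nat -> forall t, continuous (fun s => xi alpha (x s) j ^ 2) t.
Proof. intros H j Hj t. apply continuous_pow. eapply piece_xi_continuous; eassumption. Qed.

Lemma is_derive_clock n alpha x a b L B N : piece n alpha x a b L B N ->
  forall j c, (1 <= j <= S (S n))%nat -> forall t,
  is_derive (clock alpha x c j) t (xi alpha (x t) j ^ 2).
Proof.
  intros H j c Hj t. apply (is_derive_primitive (fun s => xi alpha (x s) j ^ 2)).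
  intros s. eapply piece_xi2_continuous; eassumption.
Qed.

Lemma is_derive_Rmin_left (f : R -> R) (s t l : R) : t < s -> is_derive f t l ->
  is_derive (fun u => f (Rmin u s)) t l.
Proof.
  intros Hts Hf. apply (is_derive_ext_loc f); [|exact Hf].
  generalize (open_lt s t Hts). apply filter_imp. intros u Hu. now rewrite Rmin_left by lra.
Qed.

Lemma is_derive_Rmin_right (f : R -> R) (s t : R) : s < t ->
  is_derive (fun u => f (Rmin u s)) t 0.
Proof.
  intros Hts. apply (is_derive_ext_loc (fun _ => f s)); [|apply (is_derive_const (f s))].
  generalize (open_gt s t Hts). apply filter_imp. intros u Hu. now rewrite Rmin_right by lra.
Qed.

Lemma Rmin_lipschitz (s u v : R) : Rabs (Rmin u s - Rmin v s) <= Rabs (u - v).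
Proof. unfold Rmin. repeat destruct Rle_dec; unfold Rabs; repeat destruct Rcase_abs; lra. Qed.

(** Two expressions for x_k' give h_k = xi_{j+1} V_k where the weights do not vanish; elsewhere the
    left side is 0, by [tail_zero] or by its factor xi_{j+1}. Summed over k, the controls above j
    take up at least r xi_{j+1}^2. *)
Lemma tail_control {n alpha x a b L B N j X V r} : piece n alpha x a b L B N ->
  tail n alpha x a b j X V r -> (j <= S n)%nat ->
  forall t h, a < t < b ->
    (forall k, (1 <= k <= S n)%nat -> is_derive (fun s => x s k) t (h k * xi alpha (x t) k)) ->
    forall k, (j < k <= S n)%nat ->
      (xi alpha (x t) (S j) * V (clock alpha x a (S j) t) k) ^ 2 <= h k ^ 2.
Proof.
  intros HP HT Hj t h Ht Hh k Hk.
  set (s := clock alpha x a (S j) t).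
  assert (Ex : xi alpha (x t) k = xi alpha (x t) (S j) * xi alpha (X s) k).
  { apply (xi_split alpha _ _ j); [lia| |].
    - intros i Hi. apply (tail_one HT), Hi.
    - intros i Hi. apply (tail_rep HT); [lra|lia]. }
  assert (E : h k * xi alpha (x t) k
    = xi alpha (x t) (S j) ^ 2 * (xi alpha (X s) k * V s k)).
  { apply (is_derive_uniq (fun u => x u k) t); [apply Hh; lia|].
    apply (is_derive_ext_loc (fun u => X (clock alpha x a (S j) u) k)).
    - generalize (locally_interior a b t ltac:(lra)).
      apply filter_imp. intros u Hu.
      symmetry. apply (tail_rep HT); [lra|lia].
    - apply (is_derive_Rcomp (fun u => X u k) (clock alpha x a (S j))).
      + apply (tail_der HT). lia.
      + eapply is_derive_clock; [exact HP|lia]. }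
  destruct (Req_dec (xi alpha (x t) (S j)) 0) as [E0|E0].
  { rewrite E0, Rmult_0_l, pow_i by lia. apply pow2_ge_0. }
  destruct (Req_dec (xi alpha (X s) k) 0) as [E1|E1].
  { rewrite (tail_zero HT s k E1), Rmult_0_r, pow_i by lia. apply pow2_ge_0. }
  right. f_equal. symmetry.
  apply Rmult_eq_reg_r with (xi alpha (x t) (S j) * xi alpha (X s) k); [|apply Rmult_integral_contrapositive; split; assumption].
  rewrite <- Ex at 1. rewrite E. ring.
Qed.

(** * The variation *)


(** A primitive of xi_j^2 times the weight 1_{t<s} - k, where the clock ratio k makes it vanish at b
    as well as at a. The factor xi_j^2 keeps the varied curve horizontal. *)
Definition bump (alpha : nat -> nat) (x : R -> nat -> R) (a b : R) (j : nat) (s t : R) : R :=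
  clock alpha x a j (Rmin t s) - clock alpha x a j s / clock alpha x a j b * clock alpha x a j t.

(** A mixed product of the new and the old value of x_j^alpha_j instead of a square: divided by the
    new weight of index j+1 it leaves the old weight. The tail control of the competitor is thus rho
    times the old one. *)
Definition tail_rate (alpha : nat -> nat) (x : R -> nat -> R) (a b : R) (j : nat) (s eps t : R)
  : R :=
  (x t j + eps * bump alpha x a b j s t) ^ alpha j * x t j ^ alpha j * xi alpha (x t) j ^ 2.

Lemma clock_pos {n alpha x a b L B N} j : piece n alpha x a b L B N -> (1 <= j <= S (S n))%nat ->
  0 < clock alpha x a j b.
Proof.
  intros HP Hj. apply primitive_pos.
  - intros u. eapply piece_xi2_continuous; eassumption.
  - intros u. apply pow2_ge_0.
  - apply (piece_lt HP).
  - pose proof (piece_regular HP j Hj). pose proof (pow2_ge_0 (xi alpha (x a) j)). nra.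
Qed.

Lemma clock_le {n alpha x a b L B N} j c s t : piece n alpha x a b L B N ->
  (1 <= j <= S (S n))%nat -> s <= t -> clock alpha x c j s <= clock alpha x c j t.
Proof.
  intros HP Hj Hst. apply primitive_le; [|intros; apply pow2_ge_0|exact Hst].
  intros u. eapply piece_xi2_continuous; eassumption.
Qed.

Lemma clock_start alpha x a j : clock alpha x a j a = 0.
Proof. apply primitive_start. Qed.

Lemma clock_ratio {n alpha x a b L B N} j s : piece n alpha x a b L B N ->
  (1 <= j <= S (S n))%nat -> a <= s <= b ->
  0 <= clock alpha x a j s / clock alpha x a j b <= 1.
Proof.
  intros HP Hj Hs. pose proof (clock_pos j HP Hj) as Hb.
  pose proof (clock_le j a a s HP Hj (proj1 Hs)) as H1. rewrite clock_start in H1.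
  pose proof (clock_le j a s b HP Hj (proj2 Hs)).
  split; [apply Rle_mult_inv_pos; assumption|]. apply Rle_div_l; lra.
Qed.

Lemma clock_lipschitz {n alpha x a b L B N} j c : piece n alpha x a b L B N ->
  (1 <= j <= S (S n))%nat -> forall s t,
  Rabs (clock alpha x c j s - clock alpha x c j t) <= B ^ 2 * Rabs (s - t).
Proof.
  intros HP Hj. apply primitive_lipschitz.
  - intros u. eapply piece_xi2_continuous; eassumption.
  - intros u. rewrite <- RPow_abs. apply pow_incr. split; [apply Rabs_pos|].
    apply (piece_bound HP), Hj.
Qed.

Lemma bump_lipschitz {n alpha x a b L B N} j s : piece n alpha x a b L B N ->
  (1 <= j <= S (S n))%nat -> a <= s <= b -> forall u v,
  Rabs (bump alpha x a b j s u - bump alpha x a b j s v) <= 2 * B ^ 2 * Rabs (u - v).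
Proof.
  intros HP Hj Hs u v. unfold bump.
  pose proof (clock_ratio j s HP Hj Hs) as Hk.
  set (k := clock alpha x a j s / clock alpha x a j b) in *.
  pose proof (clock_lipschitz j a HP Hj (Rmin u s) (Rmin v s)) as H1.
  pose proof (clock_lipschitz j a HP Hj u v) as H2.
  pose proof (Rmin_lipschitz s u v). pose proof (pow2_ge_0 B).
  match goal with |- Rabs (?A - k * ?C - (?D - k * ?F)) <= _ =>
    replace (A - k * C - (D - k * F)) with ((A - D) + - k * (C - F)) by ring end.
  eapply Rle_trans; [apply Rabs_triang|]. rewrite (Rabs_mult (- k)), Rabs_Ropp, (Rabs_right k) by lra.
  pose proof (Rabs_pos (clock alpha x a j u - clock alpha x a j v)).
  pose proof (Rabs_pos (u - v)). nra.
Qed.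

Lemma bump_ends alpha x a b j s : a <= s <= b -> 0 < clock alpha x a j b ->
  bump alpha x a b j s a = 0 /\ bump alpha x a b j s b = 0.
Proof.
  intros Hs Hb. unfold bump. rewrite Rmin_left, Rmin_right, clock_start by lra.
  split; [ring|field; lra].
Qed.

Definition bump_weight (alpha : nat -> nat) (x : R -> nat -> R) (a b : R) (j : nat) (s t : R) : R :=
  (if Rlt_dec t s then 1 else 0) - clock alpha x a j s / clock alpha x a j b.

Lemma bump_weight_bound {n alpha x a b L B N} j s t : piece n alpha x a b L B N ->
  (1 <= j <= S (S n))%nat -> a <= s <= b -> Rabs (bump_weight alpha x a b j s t) <= 1.
Proof.
  intros HP Hj Hs. pose proof (clock_ratio j s HP Hj Hs).
  unfold bump_weight. apply Rabs_le. destruct Rlt_dec; lra.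
Qed.

Lemma is_derive_truncated (f : R -> R) (s t l : R) : t <> s -> is_derive f t l ->
  is_derive (fun u => f (Rmin u s)) t ((if Rlt_dec t s then 1 else 0) * l).
Proof.
  intros Hne Hf. destruct Rlt_dec.
  - rewrite Rmult_1_l. apply is_derive_Rmin_left; assumption.
  - rewrite Rmult_0_l. apply is_derive_Rmin_right. lra.
Qed.

Lemma is_derive_bump n alpha x a b L B N j s t : piece n alpha x a b L B N ->
  (1 <= j <= S (S n))%nat -> t <> s ->
  is_derive (bump alpha x a b j s) t (bump_weight alpha x a b j s t * xi alpha (x t) j ^ 2).
Proof.
  intros HP Hj Hne.
  assert (D : is_derive (clock alpha x a j) t (xi alpha (x t) j ^ 2)).
  { eapply is_derive_clock; eassumption. }
  eapply is_derive_value.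
  - apply is_derive_Rminus; [apply is_derive_truncated; eassumption|].
    apply is_derive_Rscal, D.
  - unfold bump_weight. ring.
Qed.

Lemma continuous_bump n alpha x a b L B N j s t : piece n alpha x a b L B N ->
  (1 <= j <= S (S n))%nat -> a <= s <= b -> continuous (bump alpha x a b j s) t.
Proof.
  intros HP Hj Hs. apply (lipschitz_continuous _ (2 * B ^ 2)).
  intros u. eapply bump_lipschitz; eassumption.
Qed.

Lemma continuous_tail_rate n alpha x a b L B N j s eps t : piece n alpha x a b L B N ->
  (1 <= j <= S n)%nat -> a <= s <= b -> continuous (tail_rate alpha x a b j s eps) t.
Proof.
  intros HP Hj Hs. unfold tail_rate.
  assert (Cx : continuous (fun u => x u j) t) by (eapply piece_continuous; eassumption).
  apply continuous_Rmult; [apply continuous_Rmult|].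
  - apply continuous_pow. apply (continuous_plus (fun u => x u j)); [exact Cx|].
    apply continuous_Rmult; [apply continuous_const|]. eapply continuous_bump; try eassumption. lia.
  - apply continuous_pow, Cx.
  - eapply piece_xi2_continuous; [eassumption|lia].
Qed.

Definition splice {A : Type} (j : nat) (u : nat -> A) (v : A) (w : nat -> A) (i : nat) : A :=
  if Nat.ltb i j then u i else if Nat.eqb i j then v else w i.

Lemma splice_lt A j (u w : nat -> A) v i : (i < j)%nat -> splice j u v w i = u i.
Proof. intros H. unfold splice. now rewrite (proj2 (Nat.ltb_lt i j) H). Qed.

Lemma splice_eq A j (u w : nat -> A) v : splice j u v w j = v.
Proof. unfold splice. now rewrite Nat.ltb_irrefl, Nat.eqb_refl. Qed.

Lemma splice_gt A j (u w : nat -> A) v i : (j < i)%nat -> splice j u v w i = w i.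
Proof.
  intros H. unfold splice. destruct (Nat.ltb_spec i j); [lia|].
  destruct (Nat.eqb_spec i j); [lia|reflexivity].
Qed.

(* Competitor: coordinate j is moved by eps * bump, the coordinates above j run along the same
   tail curve with the clock of the perturbed xi_{j+1}, rescaled by rho to reach the same end. *)
Lemma variation_bound {n alpha x a b L B N j X V r} s eps rho :
  piece n alpha x a b L B N -> tail n alpha x a b j X V r -> (1 <= j <= S n)%nat ->
  a <= s <= b ->
  rho * RInt (tail_rate alpha x a b j s eps) a b = clock alpha x a (S j) b ->
  Rabs eps * (2 * L + B) + B ^ 2 * eps ^ 2 + Rabs (r * (rho ^ 2 - 1) / 2) * B ^ 2 <= 1 / 2 ->
  0 <= eps * ((x s j - x a j)
              - clock alpha x a j s / clock alpha x a j b * (x b j - x a j))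
       + B ^ 2 * eps ^ 2 * (b - a) + r * (rho ^ 2 - 1) / 2 * clock alpha x a (S j) b.
Proof.
  intros HP HT Hj Hs Hrho Hsmall.
  pose proof (piece_lt HP) as Hab.
  set (k := clock alpha x a j s / clock alpha x a j b) in *.
  assert (Hk : 0 <= k <= 1) by (apply (clock_ratio j s HP); [lia|exact Hs]).
  set (psi := tail_rate alpha x a b j s eps) in *.
  assert (Cpsi : forall t, continuous psi t).
  { intros t. eapply continuous_tail_rate; eassumption. }
  set (sg := clock alpha x a (S j)) in *.
  set (m := r * (rho ^ 2 - 1) / 2) in *.
  (* The second term has derivative eps w h_j xi_j without integrating h. The third absorbs the
     square of the perturbation of the control, and the last pays for the rescaled tail. *)
  set (tau := fun t => t + eps * (x (Rmin t s) j - k * x t j) + B ^ 2 * eps ^ 2 * t + m * sg t).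
  set (I := fun t => RInt psi a t).
  set (y := fun t => splice j (x t) (x t j + eps * bump alpha x a b j s t) (X (rho * I t))).
  assert (DI : forall t, is_derive (fun u => rho * I u) t (rho * psi t)).
  { intros t. apply is_derive_Rscal, is_derive_primitive, Cpsi. }
  assert (HB0 : 0 <= B).
  { eapply Rle_trans; [apply Rabs_pos|]. apply (piece_bound HP a 1). lia. }
  assert (HL0 : 0 <= L).
  { pose proof (piece_lip HP (a + 1) a 1 ltac:(lia)) as H.
    replace (a + 1 - a) with 1 in H by ring. rewrite Rabs_R1 in H.
    pose proof (Rabs_pos (x (a + 1) 1%nat - x a 1%nat)). lra. }
  assert (Hlo : forall i t, (i < j)%nat -> y t i = x t i).
  { intros i t Hi. apply splice_lt, Hi. }
  assert (Hmid : forall t, y t j = x t j + eps * bump alpha x a b j s t).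
  { intros t. apply splice_eq. }
  assert (Hhi : forall i t, (j < i)%nat -> y t i = X (rho * I t) i).
  { intros i t Hi. apply splice_gt, Hi. }
  assert (Hxi_lo : forall t i, (i <= j)%nat -> xi alpha (y t) i = xi alpha (x t) i).
  { intros t i Hi. apply xi_ext. intros l Hl. split; [apply Hlo; lia|reflexivity]. }
  assert (Hxi_hi : forall t i, (j < i)%nat -> xi alpha (y t) i
     = xi alpha (x t) j * y t j ^ alpha j * xi alpha (X (rho * I t)) i).
  { intros t i Hi. rewrite (xi_split alpha (y t) (X (rho * I t)) j i Hi).
    - rewrite xi_succ, Hxi_lo by lia. reflexivity.
    - intros l Hl. apply (tail_one HT), Hl.
    - intros l Hl. apply Hhi. lia. }
  assert (Dhi : forall i t, (j < i <= S n)%nat -> is_derive (fun u => y u i) t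
     (rho * psi t * (xi alpha (X (rho * I t)) i * V (rho * I t) i))).
  { intros i t Hi. apply (is_derive_ext (fun u => X (rho * I u) i)).
    { intros u. symmetry. apply Hhi. lia. }
    apply (is_derive_Rcomp (fun u => X u i) (fun u => rho * I u)).
    - apply (tail_der HT). exact Hi.
    - apply DI. }
  assert (Hm : Rbar_le (ccdist n alpha (y a) (y b)) (tau b - tau a)).
  { destruct (uniform_constant (fun i K => forall u v, a <= u <= b -> a <= v <= b ->
        Rabs (y u i - y v i) <= K * Rabs (u - v)) (S n)) as [K HK].
    { intros i K K' H HKK u v Hu Hv. eapply Rle_trans; [apply H; assumption|].
      apply Rmult_le_compat_r; [apply Rabs_pos|exact HKK]. }
    { intros i Hi. destruct (lt_eq_lt_dec i j) as [[h|h]|h].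
      - exists L. intros u v _ _. rewrite !Hlo by exact h. apply (piece_lip HP), Hi.
      - subst i. exists (L + Rabs eps * (2 * B ^ 2)). intros u v _ _. rewrite !Hmid.
        pose proof (piece_lip HP u v j Hj).
        pose proof (bump_lipschitz j s HP ltac:(lia) Hs u v).
        replace (x u j + eps * bump alpha x a b j s u - (x v j + eps * bump alpha x a b j s v))
          with ((x u j - x v j) + eps * (bump alpha x a b j s u - bump alpha x a b j s v)) by ring.
        eapply Rle_trans; [apply Rabs_triang|]. rewrite Rabs_mult. pose proof (Rabs_pos eps). nra.
      - destruct (continuous_bounded (fun t => rho * psi t * xi alpha (X (rho * I t)) i) a b)
          as [K [HK0 HK]]; [lra| |].
        { intros t _. apply continuous_Rmult.
          - apply continuous_Rmult; [apply continuous_const|apply Cpsi].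
          - apply (continuous_comp (fun t => rho * I t) (fun u => xi alpha (X u) i)).
            + eapply is_derive_continuous, DI.
            + apply continuous_xi. intros l Hl. destruct (le_lt_dec l j) as [h'|h'].
              * apply (continuous_ext (fun _ => 1)); [|apply continuous_const].
                intros u. symmetry. apply (tail_one HT), h'.
              * eapply is_derive_continuous, (tail_der HT). lia. }
        (* |V_i| <= 1 + r because V_i^2 <= r. *)
        exists (K * (1 + r)). apply (derive_bounded_lipschitz _ (fun t =>
          rho * psi t * (xi alpha (X (rho * I t)) i * V (rho * I t) i)) a b).
        + intros t _. apply Dhi. lia.
        + intros t Ht. rewrite <- Rmult_assoc, Rabs_mult.
          apply Rmult_le_compat; try apply Rabs_pos; [apply HK, Ht|].
          pose proof (tail_sum HT (rho * I t)) as Hr.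
          pose proof (sum_upto_term_le (fun k => V (rho * I t) k ^ 2) i (S n) Hi
            (fun _ _ => pow2_ge_0 _)). cbv beta in H.
          apply Rabs_le. rewrite Hr in H. split; nra. }
    (* [Hsmall] keeps the slope of [tau] within 1/2 of 1. The kink of [bump] at s is put in the null
       set. *)
    apply (ccdist_le_reparam n alpha y tau a b (1 / 2) (3 / 2) K (fun t => N t \/ t = s)); [lra|lra| | | |].
    - intros u v Huv.
      pose proof (piece_lip HP v u j Hj) as H1.
      pose proof (piece_lip HP (Rmin v s) (Rmin u s) j Hj) as H2.
      pose proof (Rmin_lipschitz s v u) as H3.
      pose proof (clock_lipschitz (S j) a HP ltac:(lia) v u) as H4.
      fold sg in H4. rewrite (Rabs_right (v - u)) in * by lra.
      assert (H5 : Rabs (tau v - tau u - (v - u)) <= 1 / 2 * (v - u)).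
      { unfold tau.
        replace (v + eps * (x (Rmin v s) j - k * x v j) + B ^ 2 * eps ^ 2 * v + m * sg v
          - (u + eps * (x (Rmin u s) j - k * x u j) + B ^ 2 * eps ^ 2 * u + m * sg u) - (v - u))
          with (eps * ((x (Rmin v s) j - x (Rmin u s) j) + - k * (x v j - x u j))
            + B ^ 2 * eps ^ 2 * (v - u) + m * (sg v - sg u)) by ring.
        eapply Rle_trans; [apply Rabs_triang|].
        apply Rle_trans with (Rabs eps * (2 * L * (v - u)) + B ^ 2 * eps ^ 2 * (v - u)
          + Rabs m * (B ^ 2 * (v - u))).
        - apply Rplus_le_compat.
          + eapply Rle_trans; [apply Rabs_triang|]. apply Rplus_le_compat.
            * rewrite Rabs_mult. apply Rmult_le_compat_l; [apply Rabs_pos|].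
              eapply Rle_trans; [apply Rabs_triang|].
              rewrite (Rabs_mult (- k)), Rabs_Ropp, (Rabs_right k) by lra.
              pose proof (Rabs_pos (x v j - x u j)). nra.
            * rewrite Rabs_right; [lra|]. apply Rle_ge. apply Rmult_le_pos; [|lra].
              apply Rmult_le_pos; apply pow2_ge_0.
          + rewrite Rabs_mult. apply Rmult_le_compat_l; [apply Rabs_pos|exact H4].
        - assert (0 <= Rabs eps * B * (v - u)).
          { apply Rmult_le_pos; [apply Rmult_le_pos; [apply Rabs_pos|exact HB0]|lra]. }
          pose proof (Rmult_le_compat_r (v - u) _ _ ltac:(lra) Hsmall). lra. }
      apply Rabs_le_between in H5. lra.
    - intros u v i Hu Hv Hi. apply HK; assumption.
    - apply null_set_add_point, (piece_null HP).
    - intros t Ht Hnt. apply not_or_and in Hnt. destruct Hnt as [HNt Hts].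
      destruct (piece_speed HP t Ht HNt) as [h [Hh Dh]].
      set (w := bump_weight alpha x a b j s t).
      assert (Hw : Rabs w <= 1) by (apply (bump_weight_bound j s t HP); [lia|exact Hs]).
      set (q := xi alpha (x t) j).
      set (z := eps * (h j * q * w) + B ^ 2 * eps ^ 2 + m * xi alpha (x t) (S j) ^ 2).
      set (g := fun i => if Nat.leb i j then h i else 0).
      set (e := eps * q * w).
      (* Controls below j are kept, that of j gains e, those above j are rho times the old weight of
         index j+1 times V. *)
      set (v := fun i => g i + (if Nat.eqb i j then e else 0)
                  + rho * q * x t j ^ alpha j * V (rho * I t) i).
      exists v, (1 + z). split; [|split; [|split]].
      + assert (Hq : Rabs q <= B) by (apply (piece_bound HP); lia).
        assert (Hhj : Rabs (h j) <= 1).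
        { apply sqr_le_1_abs. apply Rle_trans with (2 := Hh).
          apply (sum_upto_term_le (fun j => h j ^ 2)); [exact Hj|]. intros; apply pow2_ge_0. }
        assert (H1 : Rabs (eps * (h j * q * w)) <= Rabs eps * B).
        { rewrite Rabs_mult. apply Rmult_le_compat_l; [apply Rabs_pos|]. rewrite !Rabs_mult.
          pose proof (Rabs_pos (h j)). pose proof (Rabs_pos q). pose proof (Rabs_pos w).
          assert (Rabs (h j) * Rabs q <= 1 * B) by (apply Rmult_le_compat; lra).
          assert (0 <= Rabs (h j) * Rabs q) by (apply Rmult_le_pos; lra).
          assert (Rabs (h j) * Rabs q * Rabs w <= B * 1) by (apply Rmult_le_compat; lra). lra. }
        assert (H2 : Rabs (m * xi alpha (x t) (S j) ^ 2) <= Rabs m * B ^ 2).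
        { rewrite Rabs_mult. apply Rmult_le_compat_l; [apply Rabs_pos|].
          rewrite <- RPow_abs. apply pow_incr. split; [apply Rabs_pos|].
          apply (piece_bound HP). lia. }
        apply Rabs_le_between in H1. apply Rabs_le_between in H2.
        assert (0 <= B ^ 2 * eps ^ 2) by (apply Rmult_le_pos; apply pow2_ge_0).
        assert (0 <= Rabs eps * L) by (apply Rmult_le_pos; [apply Rabs_pos|exact HL0]).
        unfold z. lra.
      + unfold tau. eapply is_derive_value.
        * apply is_derive_Rplus; [apply is_derive_Rplus; [apply is_derive_Rplus|]|].
          -- apply (is_derive_id t).
          -- apply is_derive_Rscal, is_derive_Rminus.
             ++ apply (is_derive_truncated (fun u => x u j)); [exact Hts|apply Dh, Hj].
             ++ apply is_derive_Rscal, Dh, Hj.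
          -- apply is_derive_Rscal, (is_derive_id t).
          -- apply is_derive_Rscal. eapply is_derive_clock; [exact HP|lia].
        * unfold z, w, bump_weight. fold k q. unfold one; simpl. ring.
      + assert (Hsum : forall i, (1 <= i <= S n)%nat -> v i ^ 2 = g i ^ 2
           + (if Nat.eqb i j then 2 * h j * e + e ^ 2 else 0)
           + (rho * q * x t j ^ alpha j) ^ 2 * V (rho * I t) i ^ 2).
        { intros i Hi. unfold v, g. destruct (lt_eq_lt_dec i j) as [[h'|h']|h'].
          - rewrite (tail_V0 HT) by lia.
            destruct (Nat.eqb_spec i j); [lia|]. ring.
          - subst i. rewrite (tail_V0 HT) by lia.
            rewrite Nat.eqb_refl, Nat.leb_refl. ring.
          - destruct (Nat.eqb_spec i j); [lia|]. destruct (Nat.leb_spec i j); [lia|]. ring. }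
        rewrite (sum_upto_ext _ _ _ Hsum), !sum_upto_plus, sum_upto_single, sum_upto_scal by exact Hj.
        rewrite (tail_sum HT).
        (* By [tail_control] the tail takes up r xi_{j+1}^2 of the unit control, which leaves only
           the rest to the coordinates up to j. *)
        assert (Hg : sum_upto (fun i => g i ^ 2) (S n) + xi alpha (x t) (S j) ^ 2 * r <= 1).
        { apply Rle_trans with (2 := Hh).
          rewrite <- (tail_sum HT (sg t)), <- sum_upto_scal, <- sum_upto_plus.
          apply sum_upto_le. intros i Hi. unfold g. destruct (Nat.leb_spec i j) as [h'|h'].
          - rewrite (tail_V0 HT) by lia. lra.
          - pose proof (tail_control HP HT (proj2 Hj) t h Ht Dh i ltac:(lia)).
            fold sg in H. rewrite Rpow_mult_distr in H. lra. }
        assert (Exi : xi alpha (x t) (S j) = q * x t j ^ alpha j) by (apply xi_succ; lia).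
        replace ((rho * q * x t j ^ alpha j) ^ 2) with (rho ^ 2 * xi alpha (x t) (S j) ^ 2)
          by (rewrite Exi; ring).
        assert (He : e ^ 2 <= B ^ 2 * eps ^ 2).
        { unfold e. replace ((eps * q * w) ^ 2) with (eps ^ 2 * q ^ 2 * w ^ 2) by ring.
          assert (Hq : q ^ 2 <= B ^ 2).
          { rewrite <- (pow2_abs q). apply pow_incr. split; [apply Rabs_pos|].
            apply (piece_bound HP). lia. }
          assert (Hw2 : w ^ 2 <= 1).
          { rewrite <- (pow2_abs w), <- (pow1 2). apply pow_incr. split; [apply Rabs_pos|exact Hw]. }
          pose proof (pow2_ge_0 eps). pose proof (pow2_ge_0 q). pose proof (pow2_ge_0 w).
          assert (eps ^ 2 * q ^ 2 <= eps ^ 2 * B ^ 2) by (apply Rmult_le_compat_l; assumption).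
          assert (0 <= eps ^ 2 * q ^ 2) by (apply Rmult_le_pos; assumption).
          assert (eps ^ 2 * q ^ 2 * w ^ 2 <= eps ^ 2 * B ^ 2 * 1) by (apply Rmult_le_compat; lra).
          lra. }
        (* Hence the squared control is at most 1 + 2 z, and so at most (1 + z)^2. *)
        assert (Ez : 2 * z = 2 * h j * e + 2 * (B ^ 2 * eps ^ 2)
          + (rho ^ 2 - 1) * (xi alpha (x t) (S j) ^ 2 * r)).
        { unfold z, e, m. field. }
        assert (0 <= B ^ 2 * eps ^ 2) by (apply Rmult_le_pos; apply pow2_ge_0).
        pose proof (pow2_ge_0 z).
        replace ((1 + z) ^ 2) with (1 + 2 * z + z ^ 2) by ring. rewrite Ez. nra.
      + intros i Hi. destruct (lt_eq_lt_dec i j) as [[h'|h']|h'].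
        * apply (is_derive_ext (fun u => x u i)); [intros u; symmetry; apply Hlo, h'|].
          eapply is_derive_value; [apply Dh, Hi|]. rewrite Hxi_lo by lia. f_equal.
          unfold v, g. rewrite (tail_V0 HT) by lia.
          destruct (Nat.leb_spec i j); [|lia]. destruct (Nat.eqb_spec i j); [lia|]. ring.
        * subst i. apply (is_derive_ext (fun u => x u j + eps * bump alpha x a b j s u)).
          { intros u. symmetry. apply Hmid. }
          eapply is_derive_value.
          -- apply is_derive_Rplus; [apply Dh, Hj|]. apply is_derive_Rscal.
             eapply is_derive_bump; [exact HP|lia|exact Hts].
          -- rewrite Hxi_lo by lia. unfold v, g.
             rewrite (tail_V0 HT) by lia.
             rewrite Nat.leb_refl, Nat.eqb_refl. unfold e. fold w q. ring.
        * eapply is_derive_value; [apply Dhi; lia|]. rewrite Hxi_hi by lia. rewrite Hmid.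
          unfold v, g. destruct (Nat.eqb_spec i j); [lia|]. destruct (Nat.leb_spec i j); [lia|].
          unfold psi, tail_rate. fold q. ring. }
  assert (Hb := bump_ends alpha x a b j s Hs ltac:(eapply clock_pos; [exact HP|lia])).
  (* The competitor joins the end points of the piece: [bump] vanishes there, and rho brings the
     tail clock to its old final value. *)
  rewrite (ccdist_coords_ext n alpha (y a) (y b) (x a) (x b)) in Hm.
  2: { intros i Hi. destruct (lt_eq_lt_dec i j) as [[h|h]|h].
       - rewrite !Hlo by exact h. split; reflexivity.
       - subst i. rewrite !Hmid. destruct Hb as [-> ->]. split; ring.
       - rewrite !Hhi by exact h. unfold I. rewrite Hrho, primitive_start, Rmult_0_r.
         rewrite !(tail_rep HT _ i) by (try lia; lra).
         rewrite clock_start. split; reflexivity. }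
  rewrite (piece_min HP) in Hm. simpl in Hm.
  assert (E0 : sg a = 0) by apply clock_start.
  unfold tau in Hm. rewrite Rmin_right, Rmin_left, E0 in Hm by lra. lra.
Qed.

(** * First-order condition *)


Lemma local_min_derive_zero (f : R -> R) (l d : R) : 0 < d -> f 0 = 0 ->
  (forall e, Rabs e < d -> 0 <= f e) -> is_derive f 0 l -> l = 0.
Proof.
  intros Hd H0 Hmin Hf. apply NNPP. intros Hl.
  assert (Hl' : 0 < Rabs l) by (apply Rabs_pos_lt, Hl).
  destruct (proj1 (is_derive_eps f 0 l) Hf (Rabs l / 2) ltac:(lra)) as [d1 [Hd1 H1]].
  set (e := Rmin d d1 / 2).
  assert (He : 0 < e /\ e < d /\ e < d1).
  { unfold e. pose proof (Rmin_pos d d1 Hd Hd1). pose proof (Rmin_l d d1). pose proof (Rmin_r d d1). lra. }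
  destruct (Rlt_dec 0 l) as [h|h].
  - specialize (H1 (- e)). rewrite Rminus_0_r, Rabs_Ropp, (Rabs_right e), (Rabs_right l), H0 in H1 by lra.
    specialize (H1 ltac:(lra)). apply Rabs_le_between in H1.
    specialize (Hmin (- e)). rewrite Rabs_Ropp, Rabs_right in Hmin by lra.
    specialize (Hmin ltac:(lra)). nra.
  - specialize (H1 e). rewrite Rminus_0_r, (Rabs_right e), (Rabs_left l), H0 in H1 by lra.
    specialize (H1 ltac:(lra)). apply Rabs_le_between in H1.
    specialize (Hmin e). rewrite Rabs_right in Hmin by lra.
    specialize (Hmin ltac:(lra)). nra.
Qed.

Lemma continuous_snd_2d (f : R -> R) (e t : R) : continuous f t ->
  continuity_2d_pt (fun _ v => f v) e t.
Proof.
  intros Hf. apply (continuity_1d_2d_pt_comp f (fun _ v => v)).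
  - apply continuity_pt_filterlim, Hf.
  - apply continuity_2d_pt_id2.
Qed.

Lemma is_derive_tail_integral n alpha x a b L B N j s : piece n alpha x a b L B N ->
  (1 <= j <= S n)%nat -> a <= s <= b ->
  is_derive (fun eps => RInt (tail_rate alpha x a b j s eps) a b) 0
    (RInt (fun t => INR (alpha j) * bump alpha x a b j s t * x t j ^ (2 * alpha j - 1)
                    * xi alpha (x t) j ^ 2) a b).
Proof.
  intros HP Hj Hs.
  assert (D : forall e t, is_derive (fun eps => tail_rate alpha x a b j s eps t) e
    (INR (alpha j) * bump alpha x a b j s t * (x t j + e * bump alpha x a b j s t) ^ pred (alpha j)
       * (x t j ^ alpha j * xi alpha (x t) j ^ 2))).
  { intros e t. unfold tail_rate.
    apply (is_derive_Rext (fun eps => (x t j ^ alpha j * xi alpha (x t) j ^ 2) *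
       (x t j + eps * bump alpha x a b j s t) ^ alpha j)); [intros; ring|].
    eapply is_derive_value.
    - apply is_derive_Rscal, is_derive_pow.
      apply (is_derive_Rext (fun eps => bump alpha x a b j s t * eps + x t j)); [intros; ring|].
      apply is_derive_affine.
    - cbv beta. ring. }
  eapply is_derive_value.
  - apply (is_derive_RInt_param (fun e t => tail_rate alpha x a b j s e t) a b 0).
    + apply filter_forall. intros e t _. eexists. apply D.
    + intros t _. apply (continuity_2d_pt_ext (fun e t =>
        INR (alpha j) * bump alpha x a b j s t
          * (x t j + e * bump alpha x a b j s t) ^ pred (alpha j)
          * (x t j ^ alpha j * xi alpha (x t) j ^ 2))).
      { intros e u. symmetry. apply is_derive_unique, D. }
      assert (Cb : continuous (bump alpha x a b j s) t) by (eapply continuous_bump; [exact HP|lia|exact Hs]).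
      assert (Cx : continuous (fun u => x u j) t) by (eapply piece_continuous; eassumption).
      apply continuity_2d_pt_mult; [apply continuity_2d_pt_mult|].
      * apply (continuous_snd_2d (fun u => INR (alpha j) * bump alpha x a b j s u)).
        apply continuous_Rmult; [apply continuous_const|exact Cb].
      * apply (continuity_1d_2d_pt_comp (fun y => y ^ pred (alpha j))).
        -- apply derivable_continuous_pt, derivable_pt_pow.
        -- apply continuity_2d_pt_plus; [apply (continuous_snd_2d (fun u => x u j)), Cx|].
           apply continuity_2d_pt_mult; [apply continuity_2d_pt_id1|].
           apply (continuous_snd_2d (bump alpha x a b j s)), Cb.
      * apply (continuous_snd_2d (fun u => x u j ^ alpha j * xi alpha (x u) j ^ 2)).
        apply continuous_Rmult; [apply continuous_pow, Cx|].
        eapply piece_xi2_continuous; [exact HP|lia].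
    + apply filter_forall. intros e. apply ex_RInt_global. intros t.
      eapply continuous_tail_rate; eassumption.
  - apply RInt_Rext. intros t _. refine (eq_trans (is_derive_unique _ _ _ (D 0 t)) _).
    rewrite Rmult_0_l, Rplus_0_r. destruct (Nat.eq_dec (alpha j) 0) as [E|E].
    + rewrite E. simpl INR. ring.
    + replace (2 * alpha j - 1)%nat with (pred (alpha j) + alpha j)%nat by lia.
      rewrite pow_add. ring.
Qed.

(** With rho = sg / J(eps), [variation_bound] says that the differentiable function [Th], zero at 0,
    is nonnegative nearby. Its derivative at 0 is c1 - r G, since rho'(0) = - G / sg. *)
Lemma stationarity {n alpha x a b L B N j X V r} s :
  piece n alpha x a b L B N -> tail n alpha x a b j X V r -> (1 <= j <= S n)%nat ->
  a <= s <= b ->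
  (x s j - x a j) - clock alpha x a j s / clock alpha x a j b * (x b j - x a j)
  = r * RInt (fun t => INR (alpha j) * bump alpha x a b j s t * x t j ^ (2 * alpha j - 1)
                    * xi alpha (x t) j ^ 2) a b.
Proof.
  intros HP HT Hj Hs.
  set (c1 := x s j - x a j - _).
  set (G := RInt _ a b).
  set (J := fun eps => RInt (tail_rate alpha x a b j s eps) a b).
  set (sg := clock alpha x a (S j) b).
  assert (Hsg : 0 < sg) by (eapply clock_pos; [exact HP|lia]).
  assert (J0 : J 0 = sg).
  { apply RInt_Rext. intros t _. unfold tail_rate.
    rewrite xi_succ, Rmult_0_l, Rplus_0_r by lia. ring. }
  assert (DJ : is_derive J 0 G) by (eapply is_derive_tail_integral; eassumption).
  set (rho := fun eps => sg * / J eps).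
  assert (Drho : is_derive rho 0 (- G / sg)).
  { eapply is_derive_value.
    - apply is_derive_Rscal, is_derive_inv; [exact DJ|]. rewrite J0. lra.
    - rewrite J0. field. lra. }
  assert (rho0 : rho 0 = 1) by (unfold rho; rewrite J0; field; lra).
  set (Th := fun eps => eps * c1 + B ^ 2 * (b - a) * eps ^ 2 + r * sg / 2 * (rho eps ^ 2 - 1)).
  assert (DTh : is_derive Th 0 (c1 - r * G)).
  { eapply is_derive_value.
    - apply is_derive_Rplus; [apply is_derive_Rplus|].
      + apply (is_derive_Rmult (fun e => e) (fun _ => c1)); [apply (is_derive_id 0)|apply (is_derive_const c1)].
      + apply is_derive_Rscal, is_derive_pow, (is_derive_id 0).
      + apply is_derive_Rscal, is_derive_Rminus; [apply is_derive_pow, Drho|apply (is_derive_const 1)].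
    - rewrite rho0. unfold zero, one; simpl. field. lra. }
  assert (Crho : continuous rho 0) by (eapply is_derive_continuous, Drho).
  assert (CJ : continuous J 0) by (eapply is_derive_continuous, DJ).
  (* The smallness condition of [variation_bound] reads M eps <= 1/2; it holds near 0 because M is
     continuous there with M 0 = 0. *)
  set (M := fun eps => Rabs eps * (2 * L + B) + B ^ 2 * eps ^ 2
                + Rabs (r * (rho eps ^ 2 - 1) / 2) * B ^ 2).
  assert (CR : forall f : R -> R, continuous f 0 -> continuous (fun e => Rabs (f e)) 0).
  { intros f Hf. apply (continuous_comp f Rabs); [exact Hf|].
    apply continuity_pt_filterlim, Rcontinuity_abs. }
  assert (CM : continuous M 0).
  { unfold M. apply (continuous_plus (fun e => Rabs e * (2 * L + B) + B ^ 2 * e ^ 2)).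
    - apply (continuous_plus (fun e => Rabs e * (2 * L + B))).
      + apply continuous_Rmult; [apply CR, continuous_id|apply continuous_const].
      + apply continuous_Rmult; [apply continuous_const|apply continuous_pow, continuous_id].
    - apply continuous_Rmult; [|apply continuous_const]. apply CR.
      unfold Rdiv. apply continuous_Rmult; [|apply continuous_const].
      apply continuous_Rmult; [apply continuous_const|].
      apply (continuous_minus (fun e => rho e ^ 2)); [apply continuous_pow, Crho|apply continuous_const]. }
  assert (M0 : M 0 = 0).
  { unfold M. rewrite rho0, Rabs_R0. replace (r * (1 ^ 2 - 1) / 2) with 0 by field. rewrite Rabs_R0. ring. }
  destruct (proj1 (continuous_eps M 0) CM (1 / 2) ltac:(lra)) as [d1 [Hd1 H1]].
  destruct (proj1 (continuous_eps J 0) CJ sg Hsg) as [d2 [Hd2 H2]].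
  assert (E : c1 - r * G = 0); [|lra].
  apply (local_min_derive_zero Th _ (Rmin d1 d2)).
  - apply Rmin_pos; assumption.
  - unfold Th. rewrite rho0. field.
  - intros e He.
    destruct (Rlt_Rmin _ _ _ He) as [He1 He2].
    specialize (H1 e). rewrite Rminus_0_r, M0, Rminus_0_r in H1. specialize (H1 He1).
    apply Rabs_def2 in H1.
    specialize (H2 e). rewrite Rminus_0_r, J0 in H2. specialize (H2 He2). apply Rabs_def2 in H2.
    pose proof (variation_bound s e (rho e) HP HT Hj Hs) as HV.
    fold c1 sg (J e) in HV.
    assert (Er : rho e * J e = sg) by (unfold rho; field; lra).
    specialize (HV Er). unfold M in H1. specialize (HV ltac:(lra)). unfold Th. lra.
  - exact DTh.
Qed.

(** This is - dH/dx_j once the energy of the coordinates above j has been collapsed into the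
    constant r; [dHdx_value] makes the link. *)
Definition momentum_drift (alpha : nat -> nat) (x : R -> nat -> R) (j : nat) (r t : R) : R :=
  - (INR (alpha j) * r * x t j ^ (2 * alpha j - 1) * xi alpha (x t) j ^ 2).

Lemma continuous_momentum_drift n alpha x a b L B N j r t : piece n alpha x a b L B N ->
  (1 <= j <= S n)%nat -> continuous (momentum_drift alpha x j r) t.
Proof.
  intros HP Hj. unfold momentum_drift.
  apply (continuous_opp (fun t => INR (alpha j) * r * x t j ^ (2 * alpha j - 1) * xi alpha (x t) j ^ 2)).
  apply continuous_Rmult; [|eapply piece_xi2_continuous; [exact HP|lia]].
  apply continuous_Rmult; [apply continuous_const|]. apply continuous_pow.
  eapply piece_continuous; eassumption.
Qed.

(** Integrating [bump] by parts against the drift removes it from [stationarity] and leaves an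
    identity at each s. The multiplier [lam] is the momentum at a; it is fixed by the value of x_j
    at b. *)
Lemma first_order {n alpha x a b L B N j X V r} :
  piece n alpha x a b L B N -> tail n alpha x a b j X V r -> (1 <= j <= S n)%nat ->
  exists lam, forall s, a <= s <= b ->
    x s j = x a j + RInt (fun t => xi alpha (x t) j ^ 2
              * (lam + RInt (momentum_drift alpha x j r) a t)) a s.
Proof.
  intros HP HT Hj.
  assert (Hjj : (1 <= j <= S (S n))%nat) by lia.
  pose proof (piece_lt HP) as Hab.
  set (dr := momentum_drift alpha x j r). set (Q := fun t => RInt dr a t).
  assert (Cdr : forall t, continuous dr t).
  { intros t. eapply continuous_momentum_drift; eassumption. }
  assert (DQ : forall t, is_derive Q t (dr t)) by (intros t; apply is_derive_primitive, Cdr).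
  assert (Cxi : forall t, continuous (fun t => xi alpha (x t) j ^ 2) t).
  { intros t. eapply piece_xi2_continuous; eassumption. }
  assert (CK : forall t, continuous (fun t => xi alpha (x t) j ^ 2 * Q t) t).
  { intros t. apply continuous_Rmult; [apply Cxi|]. eapply is_derive_continuous, DQ. }
  set (K := fun t => RInt (fun t => xi alpha (x t) j ^ 2 * Q t) a t).
  assert (DK : forall t, is_derive K t (xi alpha (x t) j ^ 2 * Q t)).
  { intros t. apply (is_derive_primitive (fun t => xi alpha (x t) j ^ 2 * Q t)), CK. }
  assert (Hcb : 0 < clock alpha x a j b) by (eapply clock_pos; eassumption).
  exists ((x b j - x a j - K b) / clock alpha x a j b). intros s Hs.
  set (k := clock alpha x a j s / clock alpha x a j b).
  set (E := bump alpha x a b j s).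
  assert (CE : forall t, continuous E t) by (intros t; eapply continuous_bump; eassumption).
  assert (HG := stationarity s HP HT Hj Hs). fold k in HG.
  assert (H1 : RInt (fun t => E t * dr t) a b = - (K s - k * K b)).
  (* The primitive that performs the integration by parts; its only possible kink is at s. *)
  { rewrite (RInt_of_derive_except (fun t => E t * Q t - (K (Rmin t s) - k * K t)) _ a b s Hs).
    - destruct (bump_ends alpha x a b j s Hs Hcb) as [E1 E2]. fold E in E1, E2.
      rewrite E1, E2, Rmin_right, Rmin_left by lra.
      assert (Ka : K a = 0) by apply primitive_start. rewrite Ka. eqR. ring.
    - intros t. apply continuous_Rmult; [apply CE|apply Cdr].
    - intros t _ Hts. eapply is_derive_value.
      + apply is_derive_Rminus.
        * apply is_derive_Rmult; [eapply is_derive_bump; eassumption|apply DQ].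
        * apply is_derive_Rminus; [apply is_derive_truncated; [exact Hts|apply DK]|].
          apply is_derive_Rscal, DK.
      + unfold bump_weight. fold k E. ring.
    - intros t _. apply (continuous_minus (fun t => E t * Q t)).
      + apply continuous_Rmult; [apply CE|eapply is_derive_continuous, DQ].
      + apply (continuous_minus (fun t => K (Rmin t s))).
        * apply (continuous_comp (fun t => Rmin t s) K).
          -- apply (lipschitz_continuous _ 1). intros u. rewrite Rmult_1_l. apply Rmin_lipschitz.
          -- eapply is_derive_continuous, DK.
        * apply continuous_Rmult; [apply continuous_const|eapply is_derive_continuous, DK]. }
  assert (H2 : RInt (fun t => E t * dr t) a b
     = - r * RInt (fun t => INR (alpha j) * E t * x t j ^ (2 * alpha j - 1)
                    * xi alpha (x t) j ^ 2) a b).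
  { rewrite <- (RInt_scal (V := RC)).
    - apply RInt_Rext. intros t _. unfold dr, momentum_drift.
      match goal with |- _ = scal _ ?z => change (scal (- r) z) with (- r * z) end.
      eqR. ring.
    - apply ex_RInt_global. intros t. apply continuous_Rmult; [|apply Cxi].
      apply continuous_Rmult; [apply continuous_Rmult; [apply continuous_const|apply CE]|].
      apply continuous_pow. eapply piece_continuous; eassumption. }
  set (lam := (x b j - x a j - K b) / clock alpha x a j b).
  assert (H3 : RInt (fun t => xi alpha (x t) j ^ 2 * (lam + Q t)) a s
     = K s + lam * clock alpha x a j s).
  { rewrite (RInt_of_derive (fun t => K t + lam * clock alpha x a j t) _ a b s).
    - assert (Ka : K a = 0) by apply primitive_start. rewrite clock_start, Ka. eqR. ring.
    - intros t. apply continuous_Rmult; [apply Cxi|].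
      apply (continuous_plus (fun _ => lam)); [apply continuous_const|eapply is_derive_continuous, DQ].
    - intros t _. eapply is_derive_value.
      + apply is_derive_Rplus; [apply DK|]. apply is_derive_Rscal. eapply is_derive_clock; eassumption.
      + ring.
    - intros t _. apply (continuous_plus K); [eapply is_derive_continuous, DK|].
      apply continuous_Rmult; [apply continuous_const|].
      eapply is_derive_continuous, is_derive_clock; eassumption.
    - exact Hs. }
  fold Q in H3. change (x s j = x a j + RInt (fun t => xi alpha (x t) j ^ 2 * (lam + Q t)) a s).
  rewrite H3. fold E in HG.
  assert (Ek : lam * clock alpha x a j s = k * (x b j - x a j - K b)).
  { unfold lam, k. field. lra. }
  rewrite Ek. lra.
Qed.

(** * Normal lift of a minimizing piece *)


Lemma gronwall_zero (N dN : R -> R) (K a b : R) :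
  (forall t, a <= t <= b -> continuous N t) ->
  (forall t, a < t < b -> is_derive N t (dN t)) ->
  (forall t, a < t < b -> dN t <= K * N t) ->
  (forall t, 0 <= N t) -> N a = 0 -> forall t, a <= t <= b -> N t = 0.
Proof.
  intros CN DN HK H0 Ha t [[Hat|<-] Htb]; [|exact Ha].
  destruct (mvt_open (fun u => N u * exp (- K * u)) (fun u => (dN u - K * N u) * exp (- K * u)) a t Hat)
    as [c [Hc E]].
  - intros u Hu. eapply is_derive_value.
    + apply is_derive_Rmult; [apply DN; lra|].
      apply (is_derive_Rcomp exp (fun u => - K * u) u (exp (- K * u)) (- K)).
      * apply is_derive_exp.
      * auto_derive; [trivial|ring].
    + simpl. ring.
  - intros u Hu. apply continuous_Rmult; [apply CN; lra|].
    apply (ex_derive_continuous (fun u => exp (- K * u))). auto_derive. trivial.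
  - cbv beta in E. rewrite Ha in E. pose proof (HK c ltac:(lra)). pose proof (exp_pos (- K * c)).
    pose proof (exp_pos (- K * t)). pose proof (H0 t).
    assert (0 <= (K * N c - dN c) * exp (- K * c) * (t - a)) by (repeat apply Rmult_le_pos; lra).
    assert (N t * exp (- K * t) <= 0) by lra. nra.
Qed.

Lemma pow_lipschitz_bounded (B : R) (m : nat) : 0 <= B -> exists D, 0 <= D /\
  forall u v, Rabs u <= B -> Rabs v <= B -> Rabs (u ^ m - v ^ m) <= D * Rabs (u - v).
Proof.
  intros HB. induction m as [|m [D [HD IH]]].
  { exists 0. split; [lra|]. intros u v _ _. simpl. rewrite Rminus_diag, Rabs_R0. lra. }
  exists (B ^ m + B * D). split; [pose proof (pow_le B m HB); nra|].
  intros u v Hu Hv. specialize (IH u v Hu Hv). rewrite <- !tech_pow_Rmult.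
  replace (u * u ^ m - v * v ^ m) with (u ^ m * (u - v) + v * (u ^ m - v ^ m)) by ring.
  eapply Rle_trans; [apply Rabs_triang|]. rewrite !Rabs_mult, <- RPow_abs.
  assert (Rabs u ^ m <= B ^ m) by (apply pow_incr; split; [apply Rabs_pos|exact Hu]).
  pose proof (Rabs_pos (u - v)). pose proof (Rabs_pos v). pose proof (Rabs_pos (u ^ m - v ^ m)).
  assert (Rabs u ^ m * Rabs (u - v) <= B ^ m * Rabs (u - v)) by (apply Rmult_le_compat_r; assumption).
  assert (Rabs v * Rabs (u ^ m - v ^ m) <= B * (D * Rabs (u - v))) by (apply Rmult_le_compat; assumption).
  lra.
Qed.

(** Gronwall for the squared distance between (x,p) and the oscillator run with the clock; powers
    are Lipschitz on the compact range of both. It serves twice: to extend a tail, and to reach the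
    closed formulas. *)
Lemma clocked_oscillator_unique (a b r : R) (al : nat) (e x p F G : R -> R) : a <= b ->
  (forall t, continuous e t) ->
  (forall t, a < t < b -> is_derive x t (e t * p t)) ->
  (forall t, a < t < b -> is_derive p t (- (INR al * r * x t ^ (2 * al - 1) * e t))) ->
  (forall t, a <= t <= b -> continuous x t) ->
  (forall t, a <= t <= b -> continuous p t) ->
  (forall s, is_derive F s (G s)) ->
  (forall s, is_derive G s (- (INR al * r * F s ^ (2 * al - 1)))) ->
  F 0 = x a -> G 0 = p a ->
  forall t, a <= t <= b -> x t = F (RInt e a t) /\ p t = G (RInt e a t).
Proof.
  intros Hab Ce Dx Dp Cx Cp DF DG EF EG.
  set (sg := fun t => RInt e a t).
  assert (Dsg : forall t, is_derive sg t (e t)) by (intros t; apply is_derive_primitive, Ce).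
  assert (DFs : forall t, is_derive (fun t => F (sg t)) t (e t * G (sg t))).
  { intros t. apply (is_derive_Rcomp F sg); [apply DF|apply Dsg]. }
  assert (DGs : forall t, is_derive (fun t => G (sg t)) t (e t * - (INR al * r * F (sg t) ^ (2 * al - 1)))).
  { intros t. apply (is_derive_Rcomp G sg); [apply DG|apply Dsg]. }
  destruct (continuous_bounded x a b Hab Cx) as [B1 [HB1 H1]].
  destruct (continuous_bounded (fun t => F (sg t)) a b Hab) as [B2 [HB2 H2]].
  { intros t _. eapply is_derive_continuous, DFs. }
  destruct (continuous_bounded e a b Hab (fun t _ => Ce t)) as [B3 [HB3 H3]].
  destruct (pow_lipschitz_bounded (B1 + B2) (2 * al - 1) ltac:(lra)) as [D [HD0 HD]].
  set (c := Rabs (INR al * r)). assert (Hc : 0 <= c) by apply Rabs_pos.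
  set (N := fun t => (x t - F (sg t)) ^ 2 + (p t - G (sg t)) ^ 2).
  assert (HN : forall t, a <= t <= b -> N t = 0).
  { apply (gronwall_zero N (fun t => 2 * (x t - F (sg t)) * (e t * (p t - G (sg t)))
      + 2 * (p t - G (sg t)) * (- (INR al * r * e t) * (x t ^ (2 * al - 1) - F (sg t) ^ (2 * al - 1))))
      (B3 * (1 + c * D))).
    - intros t Ht. apply (continuous_plus (fun t => (x t - F (sg t)) ^ 2)); apply continuous_pow.
      + apply (continuous_minus x); [apply Cx, Ht|eapply is_derive_continuous, DFs].
      + apply (continuous_minus p); [apply Cp, Ht|eapply is_derive_continuous, DGs].
    - intros t Ht. eapply is_derive_value.
      + apply is_derive_Rplus; apply is_derive_pow; apply is_derive_Rminus.
        * apply Dx, Ht.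
        * apply DFs.
        * apply Dp, Ht.
        * apply DGs.
      + simpl INR. simpl pred. simpl (_ ^ 1). cbv beta. ring.
    - intros t Ht. cbv beta.
      specialize (H1 t ltac:(lra)). specialize (H2 t ltac:(lra)). specialize (H3 t ltac:(lra)).
      specialize (HD (x t) (F (sg t)) ltac:(lra) ltac:(lra)).
      set (u := x t - F (sg t)) in *. set (v := p t - G (sg t)).
      set (w := x t ^ (2 * al - 1) - F (sg t) ^ (2 * al - 1)) in *.
      change (N t) with (u ^ 2 + v ^ 2).
      assert (Hu2 : 2 * (Rabs u * Rabs v) <= u ^ 2 + v ^ 2).
      { rewrite <- (pow2_abs u), <- (pow2_abs v). pose proof (pow2_ge_0 (Rabs u - Rabs v)). lra. }
      assert (A1 : 2 * u * (e t * v) <= B3 * (2 * (Rabs u * Rabs v))).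
      { eapply Rle_trans; [apply Rle_abs|]. rewrite !Rabs_mult, (Rabs_right 2) by lra.
        assert (Rabs (e t) * (Rabs u * Rabs v) <= B3 * (Rabs u * Rabs v)).
        { apply Rmult_le_compat_r; [apply Rmult_le_pos; apply Rabs_pos|exact H3]. }
        lra. }
      assert (A2 : 2 * v * (- (INR al * r * e t) * w) <= B3 * (c * D) * (2 * (Rabs u * Rabs v))).
      { eapply Rle_trans; [apply Rle_abs|].
        replace (2 * v * (- (INR al * r * e t) * w)) with (- 2 * (v * (INR al * r * e t) * w)) by ring.
        rewrite Rabs_mult, (Rabs_left (-2)), !(Rabs_mult _ w), !(Rabs_mult v), (Rabs_mult (INR al * r)) by lra.
        fold c.
        assert (Rabs v * Rabs w <= Rabs v * (D * Rabs u)).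
        { apply Rmult_le_compat_l; [apply Rabs_pos|exact HD]. }
        assert (c * Rabs (e t) <= c * B3) by (apply Rmult_le_compat_l; assumption).
        assert (c * Rabs (e t) * (Rabs v * Rabs w) <= c * B3 * (Rabs v * (D * Rabs u))).
        { apply Rmult_le_compat; try assumption.
          - apply Rmult_le_pos; [exact Hc|apply Rabs_pos].
          - apply Rmult_le_pos; apply Rabs_pos. }
        lra. }
      assert (B3 * (2 * (Rabs u * Rabs v)) <= B3 * (u ^ 2 + v ^ 2)) by (apply Rmult_le_compat_l; assumption).
      assert (B3 * (c * D) * (2 * (Rabs u * Rabs v)) <= B3 * (c * D) * (u ^ 2 + v ^ 2)).
      { apply Rmult_le_compat_l; [|exact Hu2]. apply Rmult_le_pos; [exact HB3|]. apply Rmult_le_pos; assumption. }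
      lra.
    - intros t. apply Rplus_le_le_0_compat; apply pow2_ge_0.
    - unfold N, sg. rewrite primitive_start, EF, EG. ring. }
  intros t Ht. specialize (HN t Ht). unfold N in HN.
  pose proof (pow2_ge_0 (x t - F (sg t))). pose proof (pow2_ge_0 (p t - G (sg t))).
  split; apply Rminus_diag_uniq; apply Rsqr_0_uniq; unfold Rsqr; fold (sg t); nra.
Qed.

(* [r j] is the conserved quantity R_j^2 of the paper. *)
Definition normal_coord (alpha : nat -> nat) (x : R -> nat -> R) (a b : R) (p : R -> nat -> R)
  (r : nat -> R) (j : nat) : Prop :=
  (forall t, is_derive (fun s => p s j) t (momentum_drift alpha x j (r (S j)) t)) /\
  (forall t, a <= t <= b -> x t j = x a j + RInt (fun s => xi alpha (x s) j ^ 2 * p s j) a t) /\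
  (forall t, a <= t <= b -> r j = p t j ^ 2 + r (S j) * x t j ^ (2 * alpha j)).

Definition normal (n : nat) (alpha : nat -> nat) (x : R -> nat -> R) (a b : R)
  (p : R -> nat -> R) (r : nat -> R) : Prop :=
  r (S (S n)) = 0 /\ forall j, (1 <= j <= S n)%nat -> normal_coord alpha x a b p r j.

Lemma normal_coord_ext alpha x a b p r p' r' j :
  (forall t, p t j = p' t j) -> r j = r' j -> r (S j) = r' (S j) ->
  normal_coord alpha x a b p r j -> normal_coord alpha x a b p' r' j.
Proof.
  intros Hp Hr HrS [H1 [H2 H3]]. rewrite HrS in H1, H3. rewrite Hr in H3. split; [|split].
  - intros t. apply (is_derive_Rext (fun s => p s j)); [exact Hp|apply H1].
  - intros t Ht. rewrite (H2 t Ht) at 1. f_equal. apply RInt_Rext. intros s _. now rewrite Hp.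
  - intros t Ht. rewrite <- Hp. apply H3, Ht.
Qed.

Lemma is_derive_of_integral_form (f e p : R -> R) (a b t : R) :
  (forall s, continuous e s) -> (forall s, continuous p s) ->
  (forall s, a <= s <= b -> f s = f a + RInt (fun u => e u * p u) a s) -> a < t < b ->
  is_derive f t (e t * p t).
Proof.
  intros Ce Cp Hf Ht.
  apply (is_derive_ext_loc (fun s => f a + RInt (fun u => e u * p u) a s)).
  - generalize (locally_interior a b t ltac:(lra)).
      apply filter_imp. intros u Hu. symmetry. apply Hf. lra.
  - eapply is_derive_value.
    + apply is_derive_Rplus; [apply (is_derive_const (f a))|].
      apply (is_derive_primitive (fun u => e u * p u)).
      intros s. apply continuous_Rmult; [apply Ce|apply Cp].
    + unfold zero; simpl. ring.
Qed.

Lemma constant_of_derive_zero (f : R -> R) : (forall t, is_derive f t 0) -> forall s t, f s = f t.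
Proof.
  intros H s t. apply (derive_zero_const f (Rmin s t) (Rmax s t)); try (intros; apply H).
  - intros u _. eapply is_derive_continuous, H.
  - split; [apply Rmin_l|apply Rmax_l].
  - split; [apply Rmin_r|apply Rmax_r].
Qed.

(** The rate e lets it apply to x_j in time and, with e = 1, to its oscillator in clock time. *)
Lemma energy_derivative (x p : R -> R) (t e r : R) (al : nat) :
  is_derive x t (e * p t) -> is_derive p t (- (INR al * r * x t ^ (2 * al - 1) * e)) ->
  is_derive (fun s => p s ^ 2 + r * x s ^ (2 * al)) t 0.
Proof.
  intros Hx Hp. eapply is_derive_value.
  - apply is_derive_Rplus; [apply is_derive_pow, Hp|apply is_derive_Rscal, is_derive_pow, Hx].
  - replace (pred (2 * al)) with (2 * al - 1)%nat by lia. rewrite mult_INR. simpl INR. simpl pred. ring.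
Qed.

(** In its own clock, coordinate j is the oscillator F and can join the tail. As xi_{j+1}^2 = F^(2
    alpha_j) xi_j^2, the old tail runs inside with the inner clock [Sg]. The new squared speed is
    the energy of the oscillator. *)
Lemma tail_extend n alpha x a b L B N j X V r p :
  piece n alpha x a b L B N -> (1 <= j <= S n)%nat -> tail n alpha x a b j X V r ->
  (forall t, is_derive p t (momentum_drift alpha x j r t)) ->
  (forall t, a < t < b -> is_derive (fun s => x s j) t (xi alpha (x t) j ^ 2 * p t)) ->
  exists X' V', tail n alpha x a b (j - 1) X' V' (p a ^ 2 + r * x a j ^ (2 * alpha j)).
Proof.
  intros HP Hj HT Dp Dx.
  pose proof (piece_lt HP) as Hab.
  assert (Hjj : (1 <= j <= S (S n))%nat) by lia.
  assert (Hr : 0 <= r).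
  { rewrite <- (tail_sum HT 0). apply sum_upto_nonneg. intros; apply pow2_ge_0. }
  assert (Cxi : forall t, continuous (fun t => xi alpha (x t) j ^ 2) t).
  { intros t. eapply piece_xi2_continuous; eassumption. }
  assert (Cp : forall t, continuous p t) by (intros t; eapply is_derive_continuous, Dp).
  destruct (oscillator_solution r (x a j) (p a) (alpha j) Hr) as [F [G [F0 [G0 [DF DG]]]]].
  assert (Hosc : forall t, a <= t <= b -> x t j = F (clock alpha x a j t)).
  { intros t Ht. apply (clocked_oscillator_unique a b r (alpha j) (fun t => xi alpha (x t) j ^ 2)
      (fun t => x t j) p F G); try assumption; try lra.
    - intros u _. apply Dp.
    - intros u _. eapply piece_continuous; eassumption.
    - intros u _. apply Cp. }
  set (Sg := fun s => RInt (fun u => F u ^ (2 * alpha j)) 0 s).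
  assert (DSg : forall s, is_derive Sg s (F s ^ (2 * alpha j))).
  { intros s. apply (is_derive_primitive (fun u => F u ^ (2 * alpha j))).
    intros u. apply continuous_pow. eapply is_derive_continuous, DF. }
  assert (Hclock : forall t, a <= t <= b -> clock alpha x a (S j) t = Sg (clock alpha x a j t)).
  { intros t Ht.
    assert (E : clock alpha x a (S j) t - Sg (clock alpha x a j t)
       = clock alpha x a (S j) a - Sg (clock alpha x a j a)).
    { assert (D : forall u, is_derive (fun t => clock alpha x a (S j) t - Sg (clock alpha x a j t)) u
         (xi alpha (x u) (S j) ^ 2 - xi alpha (x u) j ^ 2 * F (clock alpha x a j u) ^ (2 * alpha j))).
      { intros u. apply is_derive_Rminus; [eapply is_derive_clock; [exact HP|lia]|].
        apply (is_derive_Rcomp Sg); [apply DSg|eapply is_derive_clock; eassumption]. }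
      apply (derive_zero_const (fun t => clock alpha x a (S j) t - Sg (clock alpha x a j t)) a b);
        try lra.
      - intros u Hu. eapply is_derive_value; [apply D|].
        rewrite xi_succ, <- Hosc by (try lia; lra). rewrite pow_double. ring.
      - intros u _. eapply is_derive_continuous, D. }
    assert (E0 : Sg 0 = 0) by apply primitive_start.
    rewrite !clock_start, E0 in E. lra. }
  set (X' := fun s => splice j (fun _ => 1) (F s) (X (Sg s))).
  set (V' := fun s => splice j (fun _ => 0) (G s) (fun i => F s ^ alpha j * V (Sg s) i)).
  assert (X1 : forall s i, (i < j)%nat -> X' s i = 1).
  { intros s i Hi. apply splice_lt, Hi. }
  assert (X2 : forall s, X' s j = F s).
  { intros s. apply splice_eq. }
  assert (X3 : forall s i, (j < i)%nat -> X' s i = X (Sg s) i).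
  { intros s i Hi. apply splice_gt, Hi. }
  assert (V1 : forall s i, (i < j)%nat -> V' s i = 0).
  { intros s i Hi. apply splice_lt, Hi. }
  assert (V2 : forall s, V' s j = G s).
  { intros s. apply splice_eq. }
  assert (V3 : forall s i, (j < i)%nat -> V' s i = F s ^ alpha j * V (Sg s) i).
  { intros s i Hi. apply splice_gt, Hi. }
  assert (Xi2 : forall s, xi alpha (X' s) j = 1).
  { intros s. rewrite (xi_ext alpha alpha _ (X s)).
    2: { intros i Hi. split; [|reflexivity]. rewrite X1 by lia.
         symmetry. apply (tail_one HT). lia. }
    clear - HT Hj. assert (forall i, (i <= S j)%nat -> xi alpha (X s) i = 1).
    { induction i as [|i IH]; intros Hi; [reflexivity|]. destruct i as [|i]; [reflexivity|].
      rewrite xi_succ, IH, (tail_one HT), pow1 by lia. ring. }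
    apply H. lia. }
  assert (Xi3 : forall s i, (j < i)%nat -> xi alpha (X' s) i = F s ^ alpha j * xi alpha (X (Sg s)) i).
  { intros s i Hi. rewrite (xi_split alpha (X' s) (X (Sg s)) j i Hi).
    - rewrite xi_succ, Xi2, X2 by lia. ring.
    - intros l Hl. apply (tail_one HT), Hl.
    - intros l Hl. apply X3. lia. }
  exists X', V'. split.
  - intros s i Hi. apply X1. lia.
  - intros s i Hi. apply V1. lia.
  - intros s k Hk. destruct (Nat.eq_dec k j) as [->|Hne].
    + apply (is_derive_Rext F); [intros u; symmetry; apply X2|].
      rewrite Xi2, V2, Rmult_1_l. apply DF.
    + apply (is_derive_Rext (fun u => X (Sg u) k)); [intros u; symmetry; apply X3; lia|].
      rewrite Xi3, V3 by lia. eapply is_derive_value.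
      * apply (is_derive_Rcomp (fun u => X u k) Sg); [|apply DSg].
        apply (tail_der HT). lia.
      * rewrite pow_double. ring.
  - intros s. rewrite (sum_upto_ext _ (fun i => (if Nat.eqb i j then G s ^ 2 else 0)
        + F s ^ (2 * alpha j) * V (Sg s) i ^ 2)).
    + rewrite sum_upto_plus, sum_upto_single, sum_upto_scal, (tail_sum HT) by exact Hj.
      rewrite <- F0, <- G0, (Rmult_comm _ r).
      apply (constant_of_derive_zero (fun s => G s ^ 2 + r * F s ^ (2 * alpha j))). intros u.
      apply (energy_derivative F G u 1).
      * rewrite Rmult_1_l. apply DF.
      * rewrite Rmult_1_r. apply DG.
    + intros i Hi. destruct (lt_eq_lt_dec i j) as [[h|h]|h].
      * rewrite V1, (tail_V0 HT) by lia. destruct (Nat.eqb_spec i j); [lia|]. ring.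
      * subst i. rewrite V2, (tail_V0 HT), Nat.eqb_refl by lia. ring.
      * rewrite V3 by lia. destruct (Nat.eqb_spec i j); [lia|].
        rewrite pow_double. ring.
  - intros s k Hk. destruct (lt_eq_lt_dec k j) as [[h|h]|h].
    + apply V1, h.
    + subst k. rewrite Xi2 in Hk. lra.
    + rewrite Xi3 in Hk by exact h. rewrite V3 by exact h.
      destruct (Rmult_integral _ _ Hk) as [E|E]; [rewrite E; ring|].
      rewrite (tail_zero HT _ _ E). ring.
  - intros t k Ht Hk. replace (S (j - 1)) with j by lia.
    destruct (Nat.eq_dec k j) as [->|Hne].
    + rewrite X2. apply Hosc, Ht.
    + rewrite X3, <- Hclock by (try lia; lra). apply (tail_rep HT); [exact Ht|lia].
Qed.

Lemma upd_same x j v : upd x j v j = v.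
Proof. unfold upd. now rewrite Nat.eqb_refl. Qed.

Lemma upd_other x j v i : i <> j -> upd x j v i = x i.
Proof. intros H. unfold upd. now rewrite (proj2 (Nat.eqb_neq i j) H). Qed.

Lemma piece_normal {n alpha x a b L B N} : piece n alpha x a b L B N ->
  exists p r, normal n alpha x a b p r.
Proof.
  intros HP. pose proof (piece_lt HP) as Hab.
  assert (HI : forall d, (d <= S n)%nat -> exists X V p r,
    tail n alpha x a b (S n - d) X V (r (S (S n - d))) /\ r (S (S n)) = 0 /\
    forall k, (S n - d < k <= S n)%nat -> normal_coord alpha x a b p r k).
  { induction d as [|d IH]; intros Hd.
    (* Above n+1 there is no coordinate: the empty tail has speed 0, whence r_{n+2} = 0. *)
    - exists (fun _ _ => 1), (fun _ _ => 0), (fun _ _ => 0), (fun _ => 0).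
      split; [|split; [reflexivity|intros; lia]]. split; try reflexivity; try (intros; lia).
      intros s. apply sum_upto_zero. intros; ring.
    - destruct IH as [X [V [p [r [HT [Hr0 Hk]]]]]]; [lia|].
      set (j := (S n - d)%nat) in *. assert (Hj : (1 <= j <= S n)%nat) by lia.
      replace (S n - S d)%nat with (j - 1)%nat by lia. replace (S (j - 1)) with j by lia.
      destruct (first_order HP HT Hj) as [lam Hlam].
      set (pj := fun t => lam + RInt (momentum_drift alpha x j (r (S j))) a t).
      assert (Dpj : forall t, is_derive pj t (momentum_drift alpha x j (r (S j)) t)).
      { intros t. eapply is_derive_value.
        - apply is_derive_Rplus; [apply (is_derive_const lam)|]. apply is_derive_primitive.
          intros s. eapply continuous_momentum_drift; eassumption.
        - unfold zero; simpl. ring. }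
      assert (Dx : forall t, a < t < b -> is_derive (fun s => x s j) t (xi alpha (x t) j ^ 2 * pj t)).
      { intros t Ht. apply (is_derive_of_integral_form (fun s => x s j) (fun s => xi alpha (x s) j ^ 2) pj a b);
          try assumption.
        - intros s. eapply piece_xi2_continuous; [exact HP|lia].
        - intros s. eapply is_derive_continuous, Dpj. }
      set (rj := pj a ^ 2 + r (S j) * x a j ^ (2 * alpha j)).
      (* Only the values at j are new, and [normal_coord] at a larger index k involves just p_k, r_k
         and r_{k+1}. *)
      set (p' := fun t => upd (p t) j (pj t)). set (r' := upd r j rj).
      assert (Ep : forall t, p' t j = pj t) by (intros t; apply upd_same).
      assert (Er : r' j = rj) by apply upd_same.
      assert (Ep' : forall i t, i <> j -> p' t i = p t i) by (intros; apply upd_other; assumption).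
      assert (Er' : forall i, i <> j -> r' i = r i) by (intros; apply upd_other; assumption).
      destruct (tail_extend _ _ _ _ _ _ _ _ _ _ _ _ pj HP Hj HT Dpj Dx)
        as [X' [V' HT']].
      exists X', V', p', r'. rewrite Er. split; [exact HT'|]. split; [rewrite Er' by lia; exact Hr0|].
      intros k Hk'. destruct (Nat.eq_dec k j) as [->|Hne].
      2: { apply (normal_coord_ext _ _ _ _ p r); try (intros; symmetry; first [apply Ep'|apply Er']; lia).
           apply Hk. lia. }
      rewrite <- Er' in Dpj by lia.
      split; [|split].
      + intros t. apply (is_derive_Rext pj); [intros; symmetry; apply Ep|apply Dpj].
      + intros t Ht. rewrite (Hlam t Ht) at 1. f_equal. apply RInt_Rext. intros s _. rewrite Ep. reflexivity.
      + intros t Ht. rewrite Er, Ep. unfold rj. rewrite <- (Er' (S j)) by lia.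
        apply (derive_zero_const (fun t => pj t ^ 2 + r' (S j) * x t j ^ (2 * alpha j)) a b); try lra.
        * intros u Hu. apply (energy_derivative (fun t => x t j) pj u (xi alpha (x u) j ^ 2)).
          -- apply Dx, Hu.
          -- apply Dpj.
        * intros u _. apply (continuous_plus (fun t => pj t ^ 2)).
          -- apply continuous_pow. eapply is_derive_continuous, Dpj.
          -- apply continuous_Rmult; [apply continuous_const|]. apply continuous_pow.
             eapply piece_continuous; eassumption. }
  destruct (HI (S n) (le_n _)) as [X [V [p [r [_ [Hr0 Hk]]]]]].
  exists p, r. split; [exact Hr0|]. intros j Hj. apply Hk. lia.
Qed.

(** * Gluing the pieces *)


Record geod (n : nat) (alpha : nat -> nat) (x : R -> nat -> R) (T L B : R) (N : R -> Prop)
  : Prop := {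
  geod_T : 0 < T;
  geod_lip : forall s t j, (1 <= j <= S n)%nat -> Rabs (x s j - x t j) <= L * Rabs (s - t);
  geod_bound : forall t j, (1 <= j <= S (S n))%nat -> Rabs (xi alpha (x t) j) <= B;
  geod_null : null_set N;
  geod_speed : forall t, 0 < t < T -> ~ N t -> exists h : nat -> R,
    sum_upto (fun j => h j ^ 2) (S n) <= 1 /\
    forall j, (1 <= j <= S n)%nat -> is_derive (fun s => x s j) t (h j * xi alpha (x t) j);
  geod_min : forall t, 0 <= t <= T -> exists eps, 0 < eps /\
    forall s s', 0 <= s <= T -> 0 <= s' <= T -> Rabs (s - t) < eps -> Rabs (s' - t) < eps ->
      ccdist n alpha (x s) (x s') = Finite (Rabs (s - s'));
  geod_start : forall j, (1 <= j <= S n)%nat -> alpha j <> 0%nat -> x 0 j <> 0 }.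

Arguments geod_T {n alpha x T L B N}.
Arguments geod_lip {n alpha x T L B N}.
Arguments geod_bound {n alpha x T L B N}.
Arguments geod_null {n alpha x T L B N}.
Arguments geod_speed {n alpha x T L B N}.
Arguments geod_min {n alpha x T L B N}.
Arguments geod_start {n alpha x T L B N}.

Lemma geod_continuous n alpha x T L B N : geod n alpha x T L B N ->
  forall j, (1 <= j <= S n)%nat -> forall t, continuous (fun s => x s j) t.
Proof.
  intros H j Hj t. apply (lipschitz_continuous _ L). intros s. apply (geod_lip H), Hj.
Qed.

Lemma geod_xi_continuous n alpha x T L B N : geod n alpha x T L B N ->
  forall j, (1 <= j <= S (S n))%nat -> forall t, continuous (fun s => xi alpha (x s) j) t.
Proof.
  intros H j Hj t. apply continuous_xi. intros i Hi. eapply geod_continuous; [exact H|lia].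
Qed.

Lemma geod_piece n alpha x T L B N a b : geod n alpha x T L B N ->
  0 <= a -> a < b -> b <= T -> ccdist n alpha (x a) (x b) = Finite (b - a) ->
  (forall j, (1 <= j <= S (S n))%nat -> xi alpha (x a) j <> 0) -> piece n alpha x a b L B N.
Proof.
  intros H Ha Hab Hb Hd Hr. split; try assumption.
  - apply (geod_lip H).
  - apply (geod_bound H).
  - apply (geod_null H).
  - intros t Ht. apply (geod_speed H). lra.
Qed.

Lemma normal_p_continuous {n alpha x a b p r} : normal n alpha x a b p r ->
  forall j, (1 <= j <= S n)%nat -> forall t, continuous (fun s => p s j) t.
Proof.
  intros [_ H] j Hj t. destruct (H j Hj) as [D _]. eapply is_derive_continuous, D.
Qed.

Lemma normal_velocity {n alpha x T L B N a b p r} : geod n alpha x T L B N ->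
  normal n alpha x a b p r -> forall j, (1 <= j <= S n)%nat -> forall t, a < t < b ->
  is_derive (fun s => x s j) t (xi alpha (x t) j ^ 2 * p t j).
Proof.
  intros HG HN j Hj t Ht.
  apply (is_derive_of_integral_form (fun s => x s j) (fun s => xi alpha (x s) j ^ 2)
    (fun s => p s j) a b).
  - intros s. apply continuous_pow. eapply geod_xi_continuous; [exact HG|lia].
  - intros s. eapply normal_p_continuous; eassumption.
  - destruct HN as [_ HN]. apply (HN j Hj).
  - exact Ht.
Qed.

Lemma downward_induction (P : nat -> Prop) (m : nat) : P (S m) ->
  (forall j, (1 <= j <= m)%nat -> P (S j) -> P j) -> forall j, (1 <= j <= S m)%nat -> P j.
Proof.
  intros H0 HS. assert (H : forall d, (d <= m)%nat -> P (S m - d)%nat).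
  { induction d as [|d IH]; intros Hd; [exact H0|].
    apply HS; [lia|]. replace (S (S m - S d)) with (S m - d)%nat by lia. apply IH. lia. }
  intros j Hj. replace j with (S m - (S m - j))%nat by lia. apply H. lia.
Qed.

Definition conserved (n : nat) (alpha : nat -> nat) (y q r : nat -> R) : Prop :=
  r (S (S n)) = 0 /\
  forall j, (1 <= j <= S n)%nat -> r j = q j ^ 2 + r (S j) * y j ^ (2 * alpha j).

Lemma normal_conserved {n alpha X a b p r} t : normal n alpha X a b p r -> a <= t <= b ->
  conserved n alpha (X t) (p t) r.
Proof. intros [H0 HN] Ht. split; [exact H0|]. intros j Hj. apply (HN j Hj), Ht. Qed.

Lemma conserved_r_nonneg {n alpha y q r} : conserved n alpha y q r ->
  forall j, (1 <= j <= S (S n))%nat -> 0 <= r j.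
Proof.
  intros [H0 H]. apply downward_induction; [lra|].
  intros j Hj Hr. rewrite (H j Hj).
  pose proof (pow2_ge_0 (q j)). pose proof (pow_double_nonneg (y j) (alpha j)). nra.
Qed.

Lemma normal_r_nonneg n alpha x a b p r : a <= b -> normal n alpha x a b p r ->
  forall j, (1 <= j <= S (S n))%nat -> 0 <= r j.
Proof.
  intros Hab HN. eapply conserved_r_nonneg, (normal_conserved a HN). lra.
Qed.

(** Descent in j: equal r_{j+1} gives both momenta the same drift, so they differ by a constant,
    which is 0 because both produce x_j' at a time with xi_j <> 0. Conservation then gives r_j.
    Momenta live on the whole line, so they agree at all times. *)
Lemma normal_unique n alpha x T L B N a b p r a' b' p' r' c d : geod n alpha x T L B N ->
  normal n alpha x a b p r -> normal n alpha x a' b' p' r' ->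
  a <= c -> a' <= c -> c < d -> d <= b -> d <= b' ->
  (forall t j, c <= t <= d -> (1 <= j <= S n)%nat -> xi alpha (x t) j <> 0) ->
  (forall j, (1 <= j <= S (S n))%nat -> r j = r' j) /\
  (forall j, (1 <= j <= S n)%nat -> forall t, p t j = p' t j).
Proof.
  intros HG HN HN' Hac Hac' Hcd Hdb Hdb' Hxi.
  assert (Hp : forall j, (1 <= j <= S n)%nat -> r (S j) = r' (S j) -> forall t, p t j = p' t j).
  { intros j Hj Hr.
    set (t := (c + d) / 2). assert (Ht : c < t < d) by (unfold t; lra).
    assert (Et : p t j = p' t j).
    { apply Rmult_eq_reg_l with (xi alpha (x t) j ^ 2).
      - apply (is_derive_uniq (fun s => x s j) t); eapply normal_velocity; try eassumption; lra.
      - apply pow_nonzero, Hxi; [lra|exact Hj]. }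
    intros s. destruct HN as [_ HN]. destruct HN' as [_ HN'].
    assert (E : p s j - p' s j = p t j - p' t j); [|lra].
    apply (constant_of_derive_zero (fun s => p s j - p' s j)). intros u.
    eapply is_derive_value.
    - apply is_derive_Rminus; [apply (HN j Hj)|apply (HN' j Hj)].
    - rewrite Hr. ring. }
  assert (Hr : forall j, (1 <= j <= S (S n))%nat -> r j = r' j).
  { apply downward_induction.
    - destruct HN as [-> _]. destruct HN' as [-> _]. reflexivity.
    - intros j Hj Hr. specialize (Hp j Hj Hr c).
      destruct HN as [_ HN]. destruct HN' as [_ HN'].
      destruct (HN j Hj) as [_ [_ H3]]. destruct (HN' j Hj) as [_ [_ H3']].
      rewrite (H3 c), (H3' c), Hp, Hr by lra. reflexivity. }
  split; [exact Hr|]. intros j Hj. apply Hp; [exact Hj|]. apply Hr. lia.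
Qed.

(** Suppose alpha_j <> 0 and x_j vanishes on an interval where xi_j does not. Then p_j = 0 there and
    r_j = 0. As x_j(0) <> 0, conservation at time 0 gives r_{j+1} = 0 and p_j(0) = 0, so p_j
    vanishes identically and x_j is constant, a contradiction. *)
Lemma regular_times_dense n alpha x T L B N b p r : geod n alpha x T L B N ->
  0 < b -> normal n alpha x 0 b p r ->
  forall m, (m <= S n)%nat -> forall a0, 0 <= a0 < b ->
  exists c d, a0 < c /\ c < d /\ d < b /\
    forall t j, c <= t <= d -> (1 <= j <= S m)%nat -> xi alpha (x t) j <> 0.
Proof.
  intros HG Hb HN. induction m as [|m IH]; intros Hm a0 Ha0.
  { exists (a0 + (b - a0) / 3), (a0 + 2 * (b - a0) / 3). split; [lra|split; [lra|split; [lra|]]].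
    intros t j _ Hj. replace j with 1%nat by lia. rewrite xi_1. lra. }
  destruct (IH ltac:(lia) a0 Ha0) as [c [d [Hc [Hcd [Hd Hreg]]]]].
  set (j := S m) in *. assert (Hj : (1 <= j <= S n)%nat) by (unfold j; lia).
  assert (Hgoal : forall c' d', c <= c' -> c' < d' -> d' <= d ->
    (forall t, c' <= t <= d' -> x t j ^ alpha j <> 0) ->
    exists c d, a0 < c /\ c < d /\ d < b /\
    forall t i, c <= t <= d -> (1 <= i <= S j)%nat -> xi alpha (x t) i <> 0).
  { intros c' d' H1 H2 H3 Hx. exists c', d'. split; [lra|split; [lra|split; [lra|]]].
    intros t i Ht Hi. destruct (Nat.eq_dec i (S j)) as [->|Hne].
    - rewrite xi_succ by lia. apply Rmult_integral_contrapositive.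
      split; [apply Hreg; [lra|lia]|apply Hx, Ht].
    - apply Hreg; [lra|lia]. }
  destruct (Nat.eq_dec (alpha j) 0) as [E|E].
  { apply (Hgoal c d); try lra. intros t _. rewrite E. simpl. lra. }
  destruct (classic (exists t, c < t < d /\ x t j <> 0)) as [[t [Ht Hxt]]|Hall].
  - destruct (proj1 (continuous_eps (fun s => x s j) t)) with (eps := Rabs (x t j)) as [e [He Hce]].
    { eapply geod_continuous; eassumption. }
    { apply Rabs_pos_lt, Hxt. }
    apply (Hgoal t (Rmin d (t + e / 2))).
    + lra.
    + apply Rmin_glb_lt; lra.
    + apply Rmin_l.
    + intros s Hs. apply pow_nonzero. intros E0.
      specialize (Hce s). pose proof (Rmin_r d (t + e / 2)).
      rewrite Rabs_right in Hce by lra. specialize (Hce ltac:(lra)).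
      rewrite E0, Rminus_0_l, Rabs_Ropp in Hce. lra.
  - exfalso.
    assert (Hz : forall t, c < t < d -> x t j = 0).
    { intros t Ht. apply NNPP. intros h. apply Hall. exists t. split; assumption. }
    set (t := (c + d) / 2). assert (Ht : c < t < d) by (unfold t; lra).
    assert (Hpt : p t j = 0).
    { assert (E1 : xi alpha (x t) j ^ 2 * p t j = 0).
      { apply (is_derive_uniq (fun s => x s j) t).
        - eapply normal_velocity; try eassumption. lra.
        - apply (is_derive_ext_loc (fun _ => 0)); [|apply (is_derive_const 0)].
          generalize (locally_interior c d t ltac:(lra)).
      apply filter_imp. intros u Hu. symmetry. apply Hz. lra. }
      destruct (Rmult_integral _ _ E1) as [E2|E2]; [|exact E2].
      exfalso. apply (pow_nonzero (xi alpha (x t) j) 2); [|exact E2]. apply Hreg; [lra|lia]. }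
    assert (HrS : 0 <= r (S j)).
    { eapply normal_r_nonneg; [|exact HN|lia]. lra. }
    destruct HN as [_ HN]. destruct (HN j Hj) as [D1 [D2 D3]].
    assert (Hr : r j = 0).
    { rewrite (D3 t), Hpt, (Hz t Ht), pow_i, (pow_i (2 * alpha j)) by (try lia; lra). ring. }
    assert (Hx0 : 0 < x 0 j ^ (2 * alpha j)).
    { destruct (pow_double_nonneg (x 0 j) (alpha j)) as [h|h]; [exact h|].
      exfalso. apply (pow_nonzero (x 0 j) (2 * alpha j)); [|symmetry; exact h].
      apply (geod_start HG); assumption. }
    rewrite (D3 0) in Hr by lra. pose proof (pow2_ge_0 (p 0 j)).
    assert (HrS0 : r (S j) = 0) by nra.
    assert (Hp0 : p 0 j = 0) by nra.
    assert (Hp : forall s, p s j = 0).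
    { intros s. rewrite <- Hp0. apply (constant_of_derive_zero (fun s => p s j)). intros u.
      eapply is_derive_value; [apply D1|]. unfold momentum_drift. rewrite HrS0. ring. }
    apply (geod_start HG j Hj E).
    replace (x 0 j) with (x t j); [apply Hz, Ht|]. rewrite (D2 t) by lra.
    rewrite (RInt_Rext _ (fun _ => 0)) by (intros; rewrite Hp; ring).
    rewrite RInt_const. unfold scal; simpl. unfold mult; simpl. ring.
Qed.

Lemma geod_start_regular n alpha x T L B N : geod n alpha x T L B N ->
  forall j, (1 <= j <= S (S n))%nat -> xi alpha (x 0) j <> 0.
Proof.
  intros HG. induction j as [|j IH]; intros Hj; [lia|].
  destruct j as [|j]; [rewrite xi_1; lra|]. rewrite xi_succ by lia.
  apply Rmult_integral_contrapositive. split; [apply IH; lia|].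
  destruct (Nat.eq_dec (alpha (S j)) 0) as [E|E]; [rewrite E; simpl; lra|].
  apply pow_nonzero, (geod_start HG); [lia|exact E].
Qed.

Lemma geod_initial_piece {n alpha x T L B N} : geod n alpha x T L B N ->
  exists b, 0 < b <= T /\ ccdist n alpha (x 0) (x b) = Finite b.
Proof.
  intros HG. pose proof (geod_T HG) as HT.
  destruct (geod_min HG 0 ltac:(lra)) as [eps [He Hm]].
  set (b := Rmin T (eps / 2)).
  assert (Hb : 0 < b) by (apply Rmin_pos; lra).
  pose proof (Rmin_l T (eps / 2)). pose proof (Rmin_r T (eps / 2)). fold b in H, H0.
  exists b. split; [lra|]. rewrite Hm by (rewrite ?Rminus_0_r, ?Rabs_R0, ?Rabs_right; lra).
  f_equal. rewrite Rabs_left1; lra.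
Qed.

(** The momentum p is already defined at all times by its drift. Only the integral formula and the
    conservation law have to be continued past b, and there they are those of p', equal to p by
    [normal_unique]. *)
Lemma normal_glue n alpha x T L B N b p r c d b2 p' r' : geod n alpha x T L B N ->
  normal n alpha x 0 b p r -> normal n alpha x c b2 p' r' ->
  0 <= c -> c < d -> d <= b -> b <= b2 ->
  (forall t j, c <= t <= d -> (1 <= j <= S n)%nat -> xi alpha (x t) j <> 0) ->
  normal n alpha x 0 b2 p r.
Proof.
  intros HG HN HN' Hc Hcd Hdb Hbb Hreg.
  destruct (normal_unique _ _ _ _ _ _ _ _ _ _ _ _ _ _ _ c d HG HN HN') as [Er Ep]; try lra; try assumption.
  pose proof HN as [H0 H1]. pose proof HN' as [_ H1'].
  split; [exact H0|]. intros j Hj.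
  destruct (H1 j Hj) as [D1 [D2 D3]]. destruct (H1' j Hj) as [_ [D2' D3']].
  split; [exact D1|split]; intros t Ht; destruct (Rle_dec t b) as [h|h]; try (apply D2; lra); try (apply D3; lra).
  - assert (Cf : forall s, continuous (fun s => xi alpha (x s) j ^ 2 * p s j) s).
    { intros s. apply continuous_Rmult; [|eapply normal_p_continuous; eassumption].
      apply continuous_pow. eapply geod_xi_continuous; [exact HG|lia]. }
    rewrite (D2' t), (D2 c) by lra.
    rewrite <- (RInt_Chasles (V := RC) _ 0 c t) by apply ex_RInt_global, Cf.
    rewrite (RInt_Rext (fun s => xi alpha (x s) j ^ 2 * p' s j) (fun s => xi alpha (x s) j ^ 2 * p s j)).
    + unfold plus; simpl. ring.
    + intros s _. rewrite Ep by exact Hj. reflexivity.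
  - rewrite Er, Er, Ep by lia. apply D3'. lra.
Qed.

Lemma geod_normal {n alpha x T L B N} : geod n alpha x T L B N ->
  exists p r, normal n alpha x 0 T p r.
Proof.
  intros HG. pose proof (geod_T HG) as HT.
  destruct (geod_initial_piece HG) as [b0 [Hb0 Hd0]].
  assert (HP0 : piece n alpha x 0 b0 L B N).
  { apply (geod_piece _ _ _ T); try assumption; try lra.
    - rewrite Rminus_0_r. exact Hd0.
    - eapply geod_start_regular; eassumption. }
  set (E := fun b => 0 < b <= T /\ exists p r, normal n alpha x 0 b p r).
  assert (HE0 : E b0) by (split; [exact Hb0|eapply piece_normal; eassumption]).
  destruct (completeness E) as [m [Hub Hl]].
  { exists T. intros b [Hb _]. lra. }
  { exists b0. exact HE0. }
  assert (Hm0 : b0 <= m) by (apply Hub, HE0).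
  assert (HmT : m <= T) by (apply Hl; intros b [Hb _]; lra).
  destruct (geod_min HG m ltac:(lra)) as [eps [He Hmin]].
  assert (Hb1 : exists b1, E b1 /\ m - eps < b1).
  { apply NNPP. intros HN. assert (m <= m - eps); [|lra]. apply Hl. intros b Hb.
    apply Rnot_lt_le. intros h. apply HN. exists b. split; assumption. }
  destruct Hb1 as [b1 [HE1 Hb1]]. pose proof (Hub b1 HE1) as Hb1m.
  destruct HE1 as [Hb1T [p [r HN1]]].
  destruct (regular_times_dense _ _ _ _ _ _ _ b1 p r HG ltac:(lra) HN1 (S n) (le_n _)
    (Rmax 0 (m - eps))) as [c [d [Hc [Hcd [Hd Hreg]]]]].
  { split; [apply Rmax_l|]. apply Rmax_lub_lt; lra. }
  pose proof (Rmax_l 0 (m - eps)). pose proof (Rmax_r 0 (m - eps)).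
  (* Both c and b2 lie in the window of minimality around m, and b2 exceeds m unless m = T. *)
  set (b2 := Rmin T (m + eps / 2)).
  assert (Hb2 : m <= b2 <= T /\ b2 <= m + eps / 2) by (unfold b2, Rmin; destruct Rle_dec; lra).
  assert (HP : piece n alpha x c b2 L B N).
  { apply (geod_piece _ _ _ T); try assumption; try lra.
    - rewrite Hmin; try lra.
      + f_equal. rewrite Rabs_left; lra.
      + rewrite Rabs_left; lra.
      + rewrite Rabs_right; lra.
    - intros j Hj. apply Hreg; [lra|lia]. }
  destruct (piece_normal HP) as [p' [r' HN2]].
  assert (HN : normal n alpha x 0 b2 p r).
  { apply (normal_glue _ _ _ _ _ _ _ b1 p r c d b2 p' r' HG HN1 HN2); try lra.
    intros t j Ht Hj. apply Hreg; [lra|lia]. }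
  assert (Hle : b2 <= m) by (apply Hub; split; [lra|exists p, r; exact HN]).
  assert (EbT : b2 = T) by (unfold b2, Rmin in *; destruct Rle_dec; lra).
  exists p, r. rewrite <- EbT. exact HN.
Qed.

(** Telescoping of xi_k^2 r_k = xi_k^2 q_k^2 + xi_{k+1}^2 r_{k+1}. *)
Lemma energy_tail_sum (alpha : nat -> nat) (z q r : nat -> R) (j m : nat) : (j <= m)%nat ->
  (forall k, (j < k <= m)%nat -> r k = q k ^ 2 + r (S k) * z k ^ (2 * alpha k)) ->
  sum_upto (fun k => xi alpha z k ^ 2 * q k ^ 2) m + xi alpha z (S m) ^ 2 * r (S m)
  = sum_upto (fun k => xi alpha z k ^ 2 * q k ^ 2) j + xi alpha z (S j) ^ 2 * r (S j).
Proof.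
  intros Hjm. induction Hjm as [|m Hjm IH]; intros H; [reflexivity|].
  rewrite <- IH by (intros; apply H; lia). rewrite sum_upto_S, (xi_succ alpha z (S m)) by lia.
  rewrite (H (S m)) by lia.
  rewrite pow_double. ring.
Qed.

Lemma conserved_energy {n alpha y q r} : conserved n alpha y q r ->
  sum_upto (fun k => xi alpha y k ^ 2 * q k ^ 2) (S n) = r 1%nat.
Proof.
  intros [H0 H]. pose proof (energy_tail_sum alpha y q r 0 (S n) ltac:(lia)) as E.
  rewrite H0, Rmult_0_r, Rplus_0_r in E. rewrite E; [rewrite xi_1; simpl; ring|].
  intros k Hk. apply H. lia.
Qed.

(** At a time outside the null set the control is xi_j p_j wherever xi_j <> 0, and the square sum of
    the xi_j p_j is r_1, so r_1 <= 1. If r_1 < 1, the initial piece could be run faster than its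
    distance permits. *)
Lemma geod_unit_energy {n alpha x T L B N p r} : geod n alpha x T L B N ->
  normal n alpha x 0 T p r -> r 1%nat = 1.
Proof.
  intros HG HN. pose proof (geod_T HG) as HT.
  apply Rle_antisym.
  - destruct (null_set_misses N 0 T HT (geod_null HG)) as [t [Ht Hnt]].
    destruct (geod_speed HG t Ht Hnt) as [h [Hh Dh]].
    rewrite <- (conserved_energy (normal_conserved t HN ltac:(lra))).
    apply Rle_trans with (2 := Hh). apply sum_upto_le. intros j Hj.
    destruct (Req_dec (xi alpha (x t) j) 0) as [E|E].
    { rewrite E, pow_i, Rmult_0_l by lia. apply pow2_ge_0. }
    right. rewrite <- Rpow_mult_distr. f_equal. apply Rmult_eq_reg_r with (xi alpha (x t) j); [|exact E].
    rewrite (is_derive_uniq (fun s => x s j) t _ _ (Dh j Hj)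
      (normal_velocity HG HN j Hj t Ht)). ring.
  - apply Rnot_lt_le. intros Hr.
    assert (Hr0 : 0 <= r 1%nat) by (eapply normal_r_nonneg; [|exact HN|lia]; lra).
    destruct (geod_initial_piece HG) as [b [Hb Hd]].
    (* c^2 >= r_1 by the inequality of means, while c < 1. *)
    set (c := (1 + r 1%nat) / 2).
    assert (Hle : Rbar_le (ccdist n alpha (x 0) (x b)) (c * b - c * 0)).
    { apply (ccdist_le_reparam n alpha x (fun t => c * t) 0 b c c L N).
      - lra.
      - unfold c; lra.
      - intros s t _. lra.
      - intros s t j _ _ Hj. apply (geod_lip HG), Hj.
      - apply (geod_null HG).
      - intros t Ht _. exists (fun j => xi alpha (x t) j * p t j), c.
        split; [unfold c; lra|]. split; [|split].
        + auto_derive; [trivial|ring].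
        + rewrite (sum_upto_ext _ (fun j => xi alpha (x t) j ^ 2 * p t j ^ 2)) by (intros; ring).
          rewrite (conserved_energy (normal_conserved t HN ltac:(lra))). unfold c. nra.
        + intros j Hj. eapply is_derive_value.
          * eapply normal_velocity; try eassumption. lra.
          * ring. }
    rewrite Hd in Hle. simpl in Hle. unfold c in Hle. nra.
Qed.

(** * Hamiltonian lift and spherical coordinates *)


Definition trunc (n : nat) (alpha : nat -> nat) (i : nat) : nat :=
  if Nat.leb i n then alpha i else 0%nat.

Lemma trunc_le n alpha i : (i <= n)%nat -> trunc n alpha i = alpha i.
Proof. intros H. unfold trunc. destruct (Nat.leb_spec i n); [reflexivity|lia]. Qed.

Lemma trunc_gt n alpha i : (n < i)%nat -> trunc n alpha i = 0%nat.
Proof. intros H. unfold trunc. destruct (Nat.leb_spec i n); [lia|reflexivity]. Qed.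

Lemma xi_trunc n alpha x j : (j <= S n)%nat -> xi (trunc n alpha) x j = xi alpha x j.
Proof. intros H. apply xi_ext. intros i Hi. split; [reflexivity|apply trunc_le; lia]. Qed.

Lemma subunit_exponents_ext n alpha beta g T :
  (forall x j, (1 <= j <= S n)%nat -> xi alpha x j = xi beta x j) ->
  subunit n alpha g T -> subunit n beta g T.
Proof.
  intros H [HL [N [HN Hg]]]. split; [exact HL|]. exists N. split; [exact HN|].
  intros t Ht Hnt. destruct (Hg t Ht Hnt) as [h [Hh Hd]]. exists h. split; [exact Hh|].
  intros j Hj. rewrite <- H by exact Hj. apply Hd, Hj.
Qed.

Lemma ccdist_trunc n alpha x y : ccdist n (trunc n alpha) x y = ccdist n alpha x y.
Proof.
  apply Glb_Rbar_eqset. intros T.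
  split; intros [HT [g [Hg He]]]; (split; [exact HT|]); exists g; (split; [|exact He]);
    (eapply subunit_exponents_ext; [|exact Hg]); intros z j Hj.
  - apply xi_trunc. lia.
  - symmetry. apply xi_trunc. lia.
Qed.

Definition clamp (T t : R) : R := Rmax 0 (Rmin T t).

Lemma clamp_id T t : 0 <= t <= T -> clamp T t = t.
Proof. intros H. unfold clamp. now rewrite Rmin_right, Rmax_right by lra. Qed.

Lemma clamp_range T t : 0 <= T -> 0 <= clamp T t <= T.
Proof. intros H. unfold clamp, Rmax, Rmin. repeat destruct Rle_dec; lra. Qed.

Lemma clamp_lipschitz T s t : Rabs (clamp T s - clamp T t) <= Rabs (s - t).
Proof.
  unfold clamp, Rmax, Rmin. repeat destruct Rle_dec; unfold Rabs; repeat destruct Rcase_abs; lra.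
Qed.

Lemma is_derive_clamp (f : R -> R) (T t l : R) : 0 < t < T ->
  (is_derive (fun s => f (clamp T s)) t l <-> is_derive f t l).
Proof.
  intros Ht. split; apply is_derive_ext_loc; generalize (locally_interior 0 T t Ht);
    apply filter_imp; intros u Hu; rewrite clamp_id by lra; reflexivity.
Qed.

(* Clamping time makes the curve globally Lipschitz; truncating the exponents removes the
   irrelevant value of alpha at n+1, so that xi_{n+2} = xi_{n+1} does not vanish at x^0. *)
Lemma arclength_geodesic_geod n alpha x0 T x : riemannian_point n alpha x0 -> 0 < T ->
  arclength_geodesic n alpha x T ->
  (forall j, (1 <= j <= S n)%nat -> x 0 j = x0 j) ->
  exists L B N, geod n (trunc n alpha) (fun t => x (clamp T t)) T L B N.
Proof.
  intros Hr HT [[[L0 HL0] [N [HN Hh]]] Hmin] H0.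
  set (X := fun t => x (clamp T t)).
  assert (HL : forall s t j, (1 <= j <= S n)%nat -> Rabs (X s j - X t j) <= Rabs L0 * Rabs (s - t)).
  { intros s t j Hj. eapply Rle_trans; [apply HL0; try apply clamp_range; try lra; exact Hj|].
    apply Rle_trans with (Rabs L0 * Rabs (clamp T s - clamp T t)).
    - apply Rmult_le_compat_r; [apply Rabs_pos|apply Rle_abs].
    - apply Rmult_le_compat_l; [apply Rabs_pos|apply clamp_lipschitz]. }
  assert (HX0 : forall j, (1 <= j <= S n)%nat -> X 0 j = x0 j).
  { intros j Hj. unfold X. rewrite clamp_id by lra. apply H0, Hj. }
  destruct (uniform_constant (fun j B => forall t, Rabs (xi (trunc n alpha) (X t) j) <= B) (S (S n)))
    as [B HB].
  { intros j L L' H HLL t. eapply Rle_trans; [apply H|exact HLL]. }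
  { intros j Hj. destruct (continuous_bounded (fun t => xi (trunc n alpha) (X t) j) 0 T) as [B [_ HB]].
    - lra.
    - intros t _. apply continuous_xi. intros i Hi. apply (lipschitz_continuous _ (Rabs L0)).
      intros u. apply HL. lia.
    - exists B. intros t. pose proof (clamp_range T t ltac:(lra)) as Hc. specialize (HB _ Hc).
      unfold X in *. rewrite (clamp_id T (clamp T t)) in HB by exact Hc. exact HB. }
  exists (Rabs L0), B, N. split; try assumption.
  - intros t j Hj. apply HB, Hj.
  - intros t Ht Hnt. destruct (Hh t Ht Hnt) as [h Dh].
    assert (EX : X t = x t) by (unfold X; rewrite clamp_id by lra; reflexivity).
    (* Where xi_j vanishes, h_j is undetermined; the value 0 meets the last hypothesis of
       [metric_speed_le_1]. *)
    set (h' := fun j => if Req_EM_T (xi alpha (x t) j) 0 then 0 else h j).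
    assert (Eh : forall j, h' j * xi alpha (x t) j = h j * xi alpha (x t) j).
    { intros j. unfold h'. destruct Req_EM_T as [E|E]; [rewrite E; ring|reflexivity]. }
    exists h'. fold (X t). rewrite EX. split.
    + destruct (Hmin t ltac:(lra)) as [eps [He Hm]].
      apply (metric_speed_le_1 n alpha x h' t (Rmin eps (T - t))).
      * apply Rmin_pos; lra.
      * intros s Hs. pose proof (Rmin_l eps (T - t)). pose proof (Rmin_r eps (T - t)).
        rewrite Hm; try lra.
        -- f_equal. rewrite Rabs_left1; lra.
        -- rewrite Rminus_diag, Rabs_R0. exact He.
        -- rewrite Rabs_right; lra.
      * intros j Hj. rewrite Eh. apply Dh, Hj.
      * intros j _ E. unfold h'. destruct Req_EM_T; [reflexivity|contradiction].
    + intros j Hj. rewrite xi_trunc, Eh by lia.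
      apply (proj2 (is_derive_clamp (fun s => x s j) T t _ Ht)), Dh, Hj.
  - intros t Ht. destruct (Hmin t Ht) as [eps [He Hm]]. exists eps. split; [exact He|].
    intros s s' Hs Hs' H1 H2. unfold X. rewrite ccdist_trunc, !clamp_id by assumption. apply Hm; assumption.
  - intros j Hj Ha. fold (X 0). rewrite HX0 by exact Hj.
    destruct (le_lt_dec j n) as [h|h].
    + rewrite trunc_le in Ha by exact h. apply Hr; [lia|exact Ha].
    + rewrite trunc_gt in Ha by exact h. lia.
Qed.

(** Among the indices concerned, the exponents differ at most at n+1, where they come multiplied by
    r_{n+2} = 0. *)
Lemma normal_untrunc {n alpha X a b p r} : normal n (trunc n alpha) X a b p r ->
  normal n alpha X a b p r.
Proof.
  intros [H0 HN]. split; [exact H0|]. intros j Hj. destruct (HN j Hj) as [D1 [D2 D3]].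
  assert (Ej : r (S j) = 0 \/ trunc n alpha j = alpha j).
  { destruct (le_lt_dec j n) as [h|h]; [right; apply trunc_le, h|left].
    replace (S j) with (S (S n)) by lia. exact H0. }
  split; [|split].
  - intros t. eapply is_derive_value; [apply D1|]. unfold momentum_drift.
    rewrite xi_trunc by lia. destruct Ej as [-> | ->]; ring.
  - intros t Ht. rewrite (D2 t Ht) at 1. f_equal. apply RInt_Rext.
    intros s _. rewrite xi_trunc by lia. reflexivity.
  - intros t Ht. rewrite (D3 t Ht) at 1. destruct Ej as [-> | ->]; ring.
Qed.

(** The terms of H above j collapse to xi_{j+1}^2 r_{j+1} by [energy_tail_sum]. This persists while
    x_j moves, because the relations used involve only coordinates above j. *)
Lemma dHdx_value n alpha y q r j : (1 <= j <= S n)%nat -> r (S (S n)) = 0 ->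
  (forall k, (j < k <= S n)%nat -> r k = q k ^ 2 + r (S k) * y k ^ (2 * alpha k)) ->
  dHdx n alpha y q j = INR (alpha j) * r (S j) * y j ^ (2 * alpha j - 1) * xi alpha y j ^ 2.
Proof.
  intros Hj Hr0 Hr. unfold dHdx. apply is_derive_unique.
  assert (Elo : forall s k, (k <= j)%nat -> xi alpha (upd y j s) k = xi alpha y k).
  { intros s k Hk. apply xi_ext. intros i Hi. split; [|reflexivity].
    apply upd_other. lia. }
  apply (is_derive_Rext (fun s => / 2 * (sum_upto (fun k => xi alpha y k ^ 2 * q k ^ 2) j
     + xi alpha y j ^ 2 * r (S j) * s ^ (2 * alpha j)))).
  - intros s. unfold Ham. f_equal.
    pose proof (energy_tail_sum alpha (upd y j s) q r j (S n) (proj2 Hj)) as E.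
    rewrite Hr0, Rmult_0_r, Rplus_0_r in E. rewrite E.
    + f_equal.
      * apply sum_upto_ext. intros k Hk. rewrite Elo by lia. reflexivity.
      * rewrite xi_succ, Elo by lia. rewrite upd_same, pow_double. ring.
    + intros k Hk. rewrite upd_other by lia. apply Hr, Hk.
  - eapply is_derive_value.
    + apply is_derive_Rscal, is_derive_Rplus; [apply is_derive_const|].
      apply is_derive_Rscal, is_derive_pow, is_derive_id.
    + replace (pred (2 * alpha j)) with (2 * alpha j - 1)%nat by lia.
      rewrite mult_INR. unfold zero, one; simpl INR; simpl. field.
Qed.

Lemma conserved_ext n alpha y y' q r : (forall j, (1 <= j <= S n)%nat -> y j = y' j) ->
  conserved n alpha y q r -> conserved n alpha y' q r.
Proof. intros E [H0 H]. split; [exact H0|]. intros j Hj. rewrite <- E by exact Hj. apply H, Hj. Qed.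

(** [Raux] counts downwards, its index d standing for j = n+1-d; its recursion is the square root of
    the relation between r_j and r_{j+1}. *)
Lemma Rconst_value {n alpha y q r} : conserved n alpha y q r ->
  forall j, (1 <= j <= S (S n))%nat -> Rconst n alpha y q j = sqrt (r j).
Proof.
  intros HC j Hj. pose proof (conserved_r_nonneg HC) as Hnn. destruct HC as [H0 H].
  unfold Rconst. destruct (Nat.leb_spec (n + 2) j) as [h|h].
  { replace j with (S (S n)) by lia. rewrite H0. symmetry. apply sqrt_0. }
  assert (HA : forall d, (d <= n)%nat -> Raux n alpha y q d = sqrt (r (S n - d)%nat)).
  { induction d as [|d IH]; intros Hd.
    - rewrite Nat.sub_0_r. rewrite (H (S n)) by lia. rewrite H0, Rmult_0_l, Rplus_0_r. simpl Raux.
      rewrite <- sqrt_Rsqr_abs. f_equal. unfold Rsqr. ring.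
    - simpl Raux. rewrite IH by lia. rewrite Rmult_1_r, sqrt_sqrt by (apply Hnn; lia).
      replace (S n - d)%nat with (S (n - d)) by lia. f_equal.
      change (S n - S d)%nat with (n - d)%nat. rewrite (H (n - d)%nat) by lia. simpl. ring. }
  rewrite HA by lia. f_equal. f_equal. lia.
Qed.

(** * Spherical coordinates of the initial covector *)

Lemma alpha_t_pos alpha j : (1 <= alpha_t alpha j)%nat.
Proof. unfold alpha_t. destruct (Nat.eqb_spec (alpha j) 0); lia. Qed.

(** For alpha_j = 0 both sides are 1: replacing the exponent by 1 is compensated by replacing x^0_j
    by 1. *)
Lemma x0_t_pow alpha y j : x0_t alpha y j ^ (2 * alpha_t alpha j) = y j ^ (2 * alpha j).
Proof.
  unfold x0_t, alpha_t. destruct (Nat.eqb_spec (alpha j) 0) as [->|_]; [simpl; ring|reflexivity].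
Qed.

Lemma riemannian_pow_pos n alpha y j : riemannian_point n alpha y -> (1 <= j <= n)%nat ->
  0 < y j ^ (2 * alpha j) /\ x0_t alpha y j <> 0.
Proof.
  intros Hr Hj. destruct (Nat.eq_dec (alpha j) 0) as [E|E].
  - unfold x0_t. rewrite E. simpl. lra.
  - pose proof (Hr j Hj E) as Hy. split.
    + destruct (pow_double_nonneg (y j) (alpha j)) as [h|h]; [exact h|].
      exfalso. apply (pow_nonzero (y j) (2 * alpha j) Hy). symmetry. exact h.
    + unfold x0_t. destruct (Nat.eqb_spec (alpha j) 0); [contradiction|exact Hy].
Qed.

Lemma rho_sqr (m : nat) (s : R) : (1 <= m)%nat -> rho m s ^ 2 = s ^ (2 * m).
Proof.
  intros Hm. unfold rho. rewrite Rpow_mult_distr, <- pow_mult, Nat.mul_comm, pow_mult, pow2_abs,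
    <- pow_mult, <- pow_add. f_equal. lia.
Qed.

Lemma rho_opp (m : nat) (s : R) : rho m (- s) = - rho m s.
Proof. unfold rho. rewrite Rabs_Ropp. ring. Qed.

Lemma rho_quotient_sqr alpha y j s : x0_t alpha y j <> 0 ->
  rho (alpha_t alpha j) (s / x0_t alpha y j) ^ 2 * y j ^ (2 * alpha j) = s ^ (2 * alpha_t alpha j).
Proof.
  intros Hy. rewrite rho_sqr by apply alpha_t_pos. rewrite <- x0_t_pow, <- Rpow_mult_distr.
  f_equal. field. exact Hy.
Qed.

Lemma prod_upto_ext (f g : nat -> R) (m : nat) :
  (forall j, (1 <= j <= m)%nat -> f j = g j) -> prod_upto f m = prod_upto g m.
Proof.
  induction m as [|m IH]; intros H; [reflexivity|]. simpl. rewrite IH, H; try lia; auto.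
  intros j Hj. apply H. lia.
Qed.

Lemma prod_delta_upd alpha y phi m v k : (k <= m)%nat ->
  prod_upto (delta alpha y (upd phi (S m) v)) k = prod_upto (delta alpha y phi) k.
Proof.
  intros Hk. apply prod_upto_ext. intros i Hi. unfold delta. now rewrite upd_other by lia.
Qed.

(** D is the radius left by the previous angles and q the coordinate to split off. If D = 0 then q =
    0, and c = 1, z = 0 is an arbitrary choice. *)
Lemma polar_split (D q r' Y : R) : 0 <= r' -> 0 < Y -> D ^ 2 = q ^ 2 + r' * Y ->
  exists c z, 0 <= z /\ c ^ 2 + z = 1 /\ q = c * D /\ D ^ 2 * z = r' * Y.
Proof.
  intros Hr HY E. assert (0 <= r' * Y) by (apply Rmult_le_pos; lra).
  destruct (Req_dec D 0) as [->|HD].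
  - exists 1, 0. pose proof (pow2_ge_0 q). split; [lra|split; [ring|split; [nra|nra]]].
  - assert (HD2 : 0 < D ^ 2) by (pose proof (pow2_ge_0 D); pose proof (pow_nonzero D 2 HD); lra).
    exists (q / D), (r' * Y / D ^ 2). split; [apply Rle_mult_inv_pos; assumption|].
    split; [|split; field; lra].
    replace ((q / D) ^ 2 + r' * Y / D ^ 2) with ((q ^ 2 + r' * Y) / D ^ 2) by (field; lra).
    rewrite <- E. field. lra.
Qed.

(** Angles are chosen in increasing order, keeping the squared product of the first m factors
    [delta] equal to r_{m+1}. The last angle ranges over a full turn in order to absorb the sign of
    p_{n+1}. *)
Lemma spherical_coords_exist n alpha y q r : (1 <= n)%nat -> riemannian_point n alpha y ->
  conserved n alpha y q r -> r 1%nat = 1 -> exists phi, spherical_coords n alpha y q phi.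
Proof.
  intros Hn Hr HC Hr1. pose proof (conserved_r_nonneg HC) as Hnn.
  destruct HC as [H0 H].
  assert (HS : forall m phi, (S m <= n)%nat ->
    prod_upto (delta alpha y phi) m ^ 2 = r (S m) ->
    exists c s, 0 <= s /\ c ^ 2 + s ^ (2 * alpha_t alpha (S m)) = 1 /\
      q (S m) = c * prod_upto (delta alpha y phi) m /\
      (prod_upto (delta alpha y phi) m * rho (alpha_t alpha (S m)) (s / x0_t alpha y (S m))) ^ 2
        = r (S (S m))).
  { intros m phi Hm HD. destruct (riemannian_pow_pos n alpha y (S m) Hr ltac:(lia)) as [HY Hx].
    destruct (polar_split (prod_upto (delta alpha y phi) m) (q (S m)) (r (S (S m)))
      (y (S m) ^ (2 * alpha (S m)))) as [c [z [Hz [Ec [Eq Ez]]]]].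
    - apply Hnn. lia.
    - exact HY.
    - rewrite HD. apply H. lia.
    - destruct (nonneg_root z (2 * alpha_t alpha (S m)) Hz) as [s [Hs Es]].
      { pose proof (alpha_t_pos alpha (S m)). lia. }
      exists c, s. split; [exact Hs|]. rewrite Es. split; [exact Ec|]. split; [exact Eq|].
      apply Rmult_eq_reg_r with (y (S m) ^ (2 * alpha (S m))); [|lra].
      rewrite Rpow_mult_distr, Rmult_assoc, rho_quotient_sqr, Es by exact Hx. exact Ez. }
  assert (HI : forall m, (m <= n - 1)%nat -> exists phi,
    (forall j, (1 <= j <= m)%nat -> 0 <= phi j <= pi_a (alpha_t alpha j) /\
       q j = cos_a (alpha_t alpha j) (phi j) * prod_upto (delta alpha y phi) (j - 1)) /\
    prod_upto (delta alpha y phi) m ^ 2 = r (S m)).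
  { induction m as [|m IH]; intros Hm.
    - exists (fun _ => 0). split; [intros; lia|]. rewrite Hr1. simpl. ring.
    - destruct IH as [phi [Hphi HD]]; [lia|].
      destruct (HS m phi ltac:(lia) HD) as [c [s [Hs [Ec [Eq ED]]]]].
      destruct (angle_upper_half (alpha_t alpha (S m)) c s (alpha_t_pos _ _) Hs Ec) as [v [Hv [Hc Hsn]]].
      exists (upd phi (S m) v). split.
      + intros j Hj. rewrite prod_delta_upd by lia. unfold upd. destruct (Nat.eqb_spec j (S m)) as [->|Hne].
        * split; [exact Hv|]. rewrite Hc. simpl. rewrite Nat.sub_0_r. exact Eq.
        * apply Hphi. lia.
      + simpl prod_upto. rewrite prod_delta_upd by lia. unfold delta at 2. rewrite upd_same, Hsn. exact ED. }
  destruct n as [|m]; [lia|].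
  destruct (HI m ltac:(lia)) as [phi [Hphi HD]].
  destruct (HS m phi ltac:(lia) HD) as [c [s [Hs [Ec [Eq ED]]]]].
  set (D := prod_upto (delta alpha y phi) m) in *.
  (* Here r_{n+1} = p_{n+1}^2, so the product is p_{n+1} up to sign; as [rho] is odd, the sign can
     be moved into s. *)
  assert (Hsign : exists s', s' ^ (2 * alpha_t alpha (S m)) = s ^ (2 * alpha_t alpha (S m)) /\
    q (S (S m)) = D * rho (alpha_t alpha (S m)) (s' / x0_t alpha y (S m))).
  { rewrite (H (S (S m))), H0 in ED by lia.
    set (w := D * rho (alpha_t alpha (S m)) (s / x0_t alpha y (S m))) in *.
    assert (Ew : (q (S (S m)) - w) * (q (S (S m)) + w) = 0) by nra.
    destruct (Rmult_integral _ _ Ew) as [E|E].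
    - exists s. split; [reflexivity|]. fold w. lra.
    - exists (- s). split; [apply pow_double_opp|].
      replace (- s / x0_t alpha y (S m)) with (- (s / x0_t alpha y (S m))) by (unfold Rdiv; ring).
      rewrite rho_opp. replace (D * - rho (alpha_t alpha (S m)) (s / x0_t alpha y (S m))) with (- w)
        by (unfold w; ring). lra. }
  destruct Hsign as [s' [Es' Eq']]. rewrite <- Es' in Ec.
  destruct (angle_full_turn (alpha_t alpha (S m)) c s' (alpha_t_pos _ _) Ec) as [v [Hv [Hc Hsn]]].
  exists (upd phi (S m) v). split; [|split; [|split]].
  - intros j Hj. rewrite upd_other by lia. apply Hphi. lia.
  - rewrite upd_same. exact Hv.
  - intros j Hj. rewrite prod_delta_upd by lia. unfold upd. destruct (Nat.eqb_spec j (S m)) as [->|Hne].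
    + rewrite Hc. simpl. rewrite Nat.sub_0_r. exact Eq.
    + apply Hphi. lia.
  - simpl prod_upto. rewrite prod_delta_upd by lia. unfold delta at 2. rewrite upd_same, Hsn. exact Eq'.
Qed.

(** The invariant of the construction holds for every admissible choice of angles, so the closed
    formulas may be proved for all of them. *)
Lemma spherical_prod_sqr n alpha y q r phi : riemannian_point n alpha y ->
  conserved n alpha y q r -> r 1%nat = 1 -> spherical_coords n alpha y q phi ->
  forall m, (m <= n)%nat -> prod_upto (delta alpha y phi) m ^ 2 = r (S m).
Proof.
  intros Hr [H0 H] Hr1 [_ [_ [Hq _]]]. induction m as [|m IH]; intros Hm.
  { rewrite Hr1. simpl. ring. }
  specialize (IH ltac:(lia)). specialize (Hq (S m) ltac:(lia)).
  simpl (S m - 1)%nat in Hq. rewrite Nat.sub_0_r in Hq.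
  destruct (riemannian_pow_pos n alpha y (S m) Hr ltac:(lia)) as [HY Hx].
  simpl prod_upto. set (D := prod_upto (delta alpha y phi) m) in *.
  apply Rmult_eq_reg_r with (y (S m) ^ (2 * alpha (S m))); [|lra].
  rewrite Rpow_mult_distr, Rmult_assoc. unfold delta. rewrite rho_quotient_sqr by exact Hx.
  pose proof (H (S m) ltac:(lia)) as HrS. rewrite <- IH, Hq in HrS.
  destruct (trig_identities (alpha_t alpha (S m)) (phi (S m)) (alpha_t_pos _ _)) as [_ [_ E]].
  replace (sin_a (alpha_t alpha (S m)) (phi (S m)) ^ (2 * alpha_t alpha (S m)))
    with (1 - cos_a (alpha_t alpha (S m)) (phi (S m)) ^ 2) by lra.
  rewrite Rpow_mult_distr in HrS. lra.
Qed.

(** In the linear case alpha_j r_{j+1} = 0 and there is no force. Otherwise the squared product of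
    the [delta] factors is r_{j+1}, which forces the sine of phi_j to be nonzero and matches the
    frequency [omega_coef] with the amplitude [A_coef]. *)
Lemma f_fun_oscillator n alpha y q r phi j : riemannian_point n alpha y ->
  conserved n alpha y q r -> r 1%nat = 1 -> spherical_coords n alpha y q phi ->
  (1 <= j <= S n)%nat ->
  f_fun n alpha y q phi j 0 = y j /\ g_fun n alpha y q phi j 0 = q j /\
  (forall s, is_derive (f_fun n alpha y q phi j) s (g_fun n alpha y q phi j s)) /\
  (forall s, is_derive (g_fun n alpha y q phi j) s
     (- (INR (alpha j) * r (S j) * f_fun n alpha y q phi j s ^ (2 * alpha j - 1)))).
Proof.
  intros Hr HC Hr1 Hs Hj. unfold f_fun, g_fun.
  destruct (ClassicalEpsilon.excluded_middle_informative (linear_case n alpha y q j)) as [Hlin|Hlin].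
  - assert (E : INR (alpha j) * r (S j) = 0).
    { destruct Hlin as [E|E].
      - rewrite (Rconst_value HC) in E by lia.
        apply sqrt_eq_0 in E; [rewrite E; ring|]. apply (conserved_r_nonneg HC). lia.
      - rewrite E. simpl. ring. }
    split; [ring|split; [reflexivity|split]]; intros s.
    + auto_derive; [trivial|ring].
    + rewrite E. eapply is_derive_value; [apply is_derive_const|]. unfold zero; simpl. ring.
  - assert (Hne : r (S j) <> 0 /\ alpha j <> 0%nat).
    { split; intros E; apply Hlin; [left|right; exact E].
      rewrite (Rconst_value HC) by lia. rewrite E. apply sqrt_0. }
    destruct Hne as [HrS Ha].
    (* r_{n+2} = 0 places j = n+1 in the linear case. *)
    assert (Hjn : (1 <= j <= n)%nat).
    { split; [lia|]. destruct HC as [H0 _]. destruct (Nat.eq_dec j (S n)) as [->|h]; [contradiction|lia]. }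
    assert (Eat : alpha_t alpha j = alpha j).
    { unfold alpha_t. destruct (Nat.eqb_spec (alpha j) 0); [contradiction|reflexivity]. }
    assert (Ext : x0_t alpha y j = y j).
    { unfold x0_t. destruct (Nat.eqb_spec (alpha j) 0); [contradiction|reflexivity]. }
    pose proof (Hr j Hjn Ha) as Hy.
    pose proof (spherical_prod_sqr _ _ _ _ _ _ Hr HC Hr1 Hs j (proj2 Hjn)) as HD.
    replace j with (S (j - 1)) in HD at 1 by lia. simpl prod_upto in HD.
    replace (S (j - 1)) with j in HD by lia.
    destruct Hs as [_ [_ [Hq _]]]. specialize (Hq j Hjn).
    set (D := prod_upto (delta alpha y phi) (j - 1)) in *.
    unfold delta in HD. rewrite Eat, Ext in HD. rewrite Eat in Hq.
    unfold A_coef, omega_coef. fold D. set (sn := sin_a (alpha j) (phi j)) in *.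
    rewrite Rpow_mult_distr, rho_sqr in HD by lia.
    assert (Hsn : sn <> 0).
    { intros E. apply HrS. rewrite <- HD, E. unfold Rdiv. rewrite Rmult_0_l, pow_i by lia. ring. }
    split; [|split; [|split]].
    + rewrite Rmult_0_r, Rplus_0_l. fold sn. field. exact Hsn.
    + rewrite Rmult_0_r, Rplus_0_l, Hq. field. split; assumption.
    + intros s. destruct (trig_identities (alpha j) (sn / y j * D * s + phi j) ltac:(lia)) as [D1 _].
      eapply is_derive_value.
      * apply is_derive_Rscal, (is_derive_Rcomp (sin_a (alpha j))); [exact D1|apply is_derive_affine].
      * ring.
    + intros s. destruct (trig_identities (alpha j) (sn / y j * D * s + phi j) ltac:(lia)) as [_ [D2 _]].
      eapply is_derive_value.
      * apply is_derive_Rscal, (is_derive_Rcomp (cos_a (alpha j))); [exact D2|apply is_derive_affine].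
      * rewrite Rpow_mult_distr, <- HD. set (S1 := sin_a (alpha j) _).
        set (u := sn / y j). assert (Hu : u <> 0).
        { unfold u, Rdiv. apply Rmult_integral_contrapositive. split; [exact Hsn|].
          apply Rinv_neq_0_compat, Hy. }
        assert (EA : y j / sn = / u) by (unfold u; field; split; assumption).
        assert (Eu : u ^ (2 * alpha j) = u * u ^ (2 * alpha j - 1)).
        { rewrite tech_pow_Rmult. f_equal. lia. }
        rewrite EA, Eu, pow_inv. field. split; [apply pow_nonzero|]; exact Hu.
Qed.

(** Descent in j: once q and p agree above j, their j-th components have the same derivative and
    differ by a constant. It vanishes at a small time t0, where xi_j <> 0 by continuity from the
    Riemannian point and both components produce x_j'. *)
Lemma lift_unique n alpha T x X p r L B N : 0 < T ->
  X = (fun t => x (clamp T t)) -> geod n (trunc n alpha) X T L B N ->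
  normal n (trunc n alpha) X 0 T p r ->
  forall q, hamiltonian_lift n alpha x q T ->
  forall j, (1 <= j <= S (S n))%nat -> forall k, (j <= k <= S n)%nat ->
  forall t, 0 <= t <= T -> q t k = p t k.
Proof.
  intros HT EX HG HNt q [Hqc Hqd].
  pose proof (normal_untrunc HNt) as HN.
  assert (EXt : forall t, 0 <= t <= T -> X t = x t).
  { intros t Ht. rewrite EX, clamp_id by exact Ht. reflexivity. }
  apply (downward_induction (fun j => forall k, (j <= k <= S n)%nat ->
    forall t, 0 <= t <= T -> q t k = p t k)); [intros; lia|].
  intros j Hj IH k Hk. destruct (Nat.eq_dec k j) as [->|Hne]; [|apply IH; lia]. clear Hk.
  set (Dl := fun t => q t j - p t j).
  assert (DD : forall t, 0 < t < T -> is_derive Dl t 0).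
  { intros t Ht. destruct (Hqd j Hj t Ht) as [_ Hq].
    pose proof (normal_conserved t HN ltac:(lra)) as [HC0 HC].
    rewrite EXt in HC by lra.
    eapply is_derive_value.
    - apply is_derive_Rminus; [exact Hq|]. destruct HN as [_ HN]. apply (HN j Hj).
    - rewrite (dHdx_value n alpha (x t) (q t) r j Hj HC0).
      + unfold momentum_drift. rewrite EXt by lra. ring.
      + intros k Hk. rewrite IH by (try lia; lra). apply HC. lia. }
  assert (Hxi0 : xi alpha (X 0) j <> 0).
  { rewrite <- (xi_trunc n) by lia. eapply geod_start_regular; [exact HG|lia]. }
  destruct (proj1 (continuous_eps (fun t => xi (trunc n alpha) (X t) j) 0)) with (eps := Rabs (xi alpha (X 0) j))
    as [e [He Hce]].
  { eapply geod_xi_continuous; [exact HG|lia]. }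
  { apply Rabs_pos_lt, Hxi0. }
  set (t0 := Rmin e T / 2).
  assert (Ht0 : 0 < t0 /\ t0 < e /\ t0 < T).
  { unfold t0. pose proof (Rmin_pos e T He HT). pose proof (Rmin_l e T). pose proof (Rmin_r e T). lra. }
  assert (D0 : Dl t0 = 0).
  { specialize (Hce t0). rewrite Rminus_0_r, Rabs_right, !xi_trunc in Hce by (try lia; lra).
    specialize (Hce ltac:(lra)).
    assert (Hxt : xi alpha (X t0) j <> 0).
    { intros E. rewrite E, Rminus_0_l, Rabs_Ropp in Hce. lra. }
    destruct (Hqd j Hj t0 ltac:(lra)) as [Hq _].
    assert (Hp : is_derive (fun s => x s j) t0 (xi alpha (x t0) j ^ 2 * p t0 j)).
    { apply (proj1 (is_derive_clamp (fun s => x s j) T t0 _ ltac:(lra))).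
      apply (is_derive_Rext (fun s => X s j)); [intros s; rewrite EX; reflexivity|].
      rewrite <- EXt, <- (xi_trunc n) by (try lia; lra).
      eapply normal_velocity; [exact HG|exact HNt|exact Hj|lra]. }
    assert (E := is_derive_uniq _ _ _ _ Hq Hp). rewrite EXt in Hxt by lra.
    apply Rmult_eq_reg_l in E; [unfold Dl; lra|]. apply pow_nonzero, Hxt. }
  intros t Ht. apply Rminus_diag_uniq. rewrite <- (clamp_id T t Ht) at 1. rewrite <- D0.
  unfold Dl. rewrite <- (clamp_id T t0) at 1 by lra.
  (* A lift is continuous only within [0,T]; clamping the time makes it continuous on the line. *)
  apply (derive_zero_const (fun t => q (clamp T t) j - p t j) 0 T); try lra.
  - intros u Hu. apply (is_derive_ext_loc Dl); [|apply DD, Hu].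
    generalize (locally_interior 0 T u Hu). apply filter_imp. intros v Hv.
    unfold Dl. rewrite clamp_id by lra. reflexivity.
  - intros u _. apply (continuous_minus (fun t => q (clamp T t) j));
      [|eapply normal_p_continuous; eassumption].
    assert (Hc := clamp_range T u ltac:(lra)). apply continuous_eps. intros eps Heps.
    destruct (proj1 (filterlim_locally _ _) (Hqc j Hj _ Hc) (mkposreal eps Heps)) as [d Hd].
    exists d. split; [apply cond_pos|]. intros v Hv. apply Hd; [|apply clamp_range; lra].
    apply Rle_lt_trans with (2 := Hv). apply clamp_lipschitz.
Qed.

Theorem mainTheorem8 :
  forall (n : nat) (alpha : nat -> nat) (x0 : nat -> R) (T : R) (x : R -> nat -> R),
    (1 <= n)%nat ->
    riemannian_point n alpha x0 ->
    0 < T ->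
    arclength_geodesic n alpha x T ->
    (forall j, (1 <= j <= S n)%nat -> x 0 j = x0 j) ->
    exists p : R -> nat -> R,
      hamiltonian_lift n alpha x p T /\
      Ham n alpha x0 (p 0) = / 2 /\
      (forall q : R -> nat -> R,
         hamiltonian_lift n alpha x q T -> Ham n alpha x0 (q 0) = / 2 ->
         forall t, 0 <= t <= T -> forall j, (1 <= j <= S n)%nat -> q t j = p t j) /\
      (exists phi, spherical_coords n alpha x0 (p 0) phi) /\
      (forall phi, spherical_coords n alpha x0 (p 0) phi ->
         forall j, (1 <= j <= S n)%nat -> forall t, 0 <= t <= T ->
           let sigma := RInt (fun s => (xi alpha (x s) j) ^ 2) 0 t in
           x t j = f_fun n alpha x0 (p 0) phi j sigma /\
           p t j = g_fun n alpha x0 (p 0) phi j sigma).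
Proof.
  intros n alpha x0 T x Hn Hr HT Hgeo H0.
  destruct (arclength_geodesic_geod n alpha x0 T x Hr HT Hgeo H0) as [L [B [N HG]]].
  remember (fun t => x (clamp T t)) as X eqn:EX.
  assert (EXt : forall t, 0 <= t <= T -> X t = x t).
  { intros t Ht. rewrite EX, clamp_id by exact Ht. reflexivity. }
  destruct (geod_normal HG) as [p [r HN']].
  pose proof (geod_unit_energy HG HN') as Hr1.
  pose proof (normal_untrunc HN') as HN.
  assert (HC0 : conserved n alpha x0 (p 0) r).
  { apply (conserved_ext n alpha (x 0)); [exact H0|].
    rewrite <- EXt by lra. apply (normal_conserved 0 HN). lra. }
  assert (HV : forall j, (1 <= j <= S n)%nat -> forall t, 0 < t < T ->
    is_derive (fun s => X s j) t (xi alpha (X t) j ^ 2 * p t j)).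
  { intros j Hj t Ht. rewrite <- (xi_trunc n) by lia. eapply normal_velocity; eassumption. }
  exists p. split; [|split; [|split; [|split]]].
  - split.
    + intros j Hj t _. eapply filterlim_filter_le_1; [apply filter_le_within|].
      apply (normal_p_continuous HN j Hj t).
    + intros j Hj t Ht. split.
      * apply (proj1 (is_derive_clamp (fun s => x s j) T t _ Ht)). rewrite <- EXt by lra.
        apply (is_derive_Rext (fun s => X s j)); [intros s; rewrite EX; reflexivity|].
        apply HV; assumption.
      * pose proof (normal_conserved t HN ltac:(lra)) as [HC1 HC].
        rewrite <- EXt by lra. rewrite (dHdx_value n alpha (X t) (p t) r j Hj HC1).
        -- destruct HN as [_ HN]. apply (HN j Hj).
        -- intros k Hk. apply HC. lia.
  - unfold Ham. rewrite (conserved_energy HC0), Hr1. ring.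
  - intros q Hq _ t Ht j Hj.
    apply (lift_unique n alpha T x X p r L B N HT EX HG HN' q Hq j); try lia. exact Ht.
  - eapply spherical_coords_exist; eassumption.
  - intros phi Hphi j Hj t Ht sigma.
    destruct (f_fun_oscillator _ _ _ _ _ _ j Hr HC0 Hr1 Hphi Hj) as [F0 [G0 [DF DG]]].
    assert (Es : sigma = RInt (fun s => xi (trunc n alpha) (X s) j ^ 2) 0 t).
    { apply RInt_Rext. intros s Hs. rewrite Rmin_left, Rmax_right in Hs by lra.
      rewrite xi_trunc, EXt by (try lia; lra). reflexivity. }
    rewrite Es. rewrite <- (EXt t Ht).
    (* In the clock sigma, (x_j, p_j) and (f_j, g_j) obey the same oscillator with the same initial
       values. *)
    apply (clocked_oscillator_unique 0 T (r (S j)) (alpha j)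
      (fun s => xi (trunc n alpha) (X s) j ^ 2) (fun s => X s j) (fun s => p s j)); try assumption; try lra.
    + intros s. apply continuous_pow. eapply geod_xi_continuous; [exact HG|lia].
    + intros s Hs. cbv beta. rewrite xi_trunc by lia. apply HV; assumption.
    + intros s Hs. cbv beta. rewrite xi_trunc by lia. destruct HN as [_ HN]. apply (HN j Hj).
    + intros s _. eapply geod_continuous; eassumption.
    + intros s _. eapply normal_p_continuous; eassumption.
    + rewrite F0, EXt by lra. symmetry. apply H0, Hj.
Qed.
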